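(* Let $(M,g)$ be a compact connected Riemannian manifold of dimension $n\ge 2$ with smooth boundary $\partial M$ and with $g\in\mathcal C^6(M;\mathrm{Sym}^2M)$, let $T>2D_g(M)$, and let $\mathcal M=[0,T]\times M$ with Lorentzian metric $\bar g=-dt^2+g$. Let $(q,\mathcal A)\in\mathcal C(\mathcal M)\times\mathcal C^1(\mathcal M;T^*\mathcal M)$ (complex-valued) be such that $\mathrm{supp}\,q\subset\mathcal E$ and $\mathrm{supp}\,\mathcal A\subset\mathcal E$. Suppose that the geodesic ray transform is injective on $(M,g)$ in the following sense: whenever $f\in\mathcal C(M)$ and $\alpha\in\mathcal C(M;T^*M)$ satisfy $\mathcal I_{\gamma(\cdot;y,v)}(f,\alpha)=0$ for all $(y,v)\in\partial_-SM$, then $f\equiv0$ and $\alpha^s\equiv0$. Then: (i) If $\mathcal L_q(\beta)=0$ for all maximal null geodesics $\beta$, then $q\equiv0$ on $\mathcal M$. (ii) If $\mathcal L_{\mathcal A}(\beta)=0$ for all maximal null geodesics $\beta$, then there exists $\psi\in\mathcal C^2(\mathcal M)$ vanishing on $\partial\mathcal M$ such that $\mathcal A\equiv\bar d\psi$ on $\mathcal M$.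
   Context: Geodesics. $SM$ is the unit tangent bundle of $M$; for $(y,v)\in SM$, $\gamma(\cdot;y,v)$ is the unit speed geodesic with $\gamma(0)=y$, $\dot\gamma(0)=v$, and $$\tau_{exit}(y,v)=\inf\{t>0 : \gamma(t;y,v)\in\partial M,\ \dot\gamma(t;y,v)\notin T_{\gamma(t;y,v)}\partial M\}.$$ With $\nu$ the outward unit normal on $\partial M$, $$\partial_-SM=\{(y,v)\in SM : y\in\partial M,\ \langle v,\nu(y)\rangle_g<0,\ \tau_{exit}(y,v)<\infty\}.$$ For $(y,v)\in\partial_-SM$, $\gamma=\gamma(\cdot;y,v)$ is called a maximal geodesic, considered on $I=(0,\tau_{exit}(y,v))$. Geodesic ray transform. $\mathcal I_\gamma(f,\alpha)=\int_I[f(\gamma(t))+\alpha(\gamma(t))\dot\gamma(t)]\,dt$ for $(f,\alpha)\in\mathcal C(M)\times\mathcal C(M;T^*M)$. Solenoidal part. Every $\alpha\in L^2(M;T^*M)$ decomposes uniquely as $\alpha=\alpha^s+d\psi$ with $\delta\alpha^s=0$ and $\psi\in H^1_0(M)$ the weak solution of $\Delta_g\psi=\delta\alpha$, where $\delta\alpha=\sum_{i,j}|g|^{-1/2}\partial_i(|g|^{1/2}g^{ij}\alpha_j)$ is the divergence on one-forms; $\alpha^s$ is the solenoidal part of $\alpha$. The set $\mathcal E$. For $x\in M$, $D_g(x)=\sup\{\tau_{exit}(y,v) : (y,v)\in\partial_-SM,\ x\text{ lies on }\gamma(\cdot;y,v)\}$, $D_g(M)=\sup_{x\in M}D_g(x)$,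 and $$\mathcal E=\{(t,x)\in\mathcal M : D_g(x)<t<T-D_g(x)\}.$$ Light ray transforms. A maximal null geodesic is a curve $\beta(t)=(\tilde t+t,\gamma(t))$, $t\in I$, where $\tilde t\in\mathbb R$ and $\gamma:I\to M$ is a unit speed maximal geodesic in $M$. The functions/forms $q$, $\mathcal A$ are extended by zero to $\mathbb R\times M$, and $$\mathcal L_q(\beta)=\int_Iq(\beta(t))\,dt,\qquad \mathcal L_{\mathcal A}(\beta)=\int_\beta\mathcal A=\int_I\mathcal A(\beta(t))\dot\beta(t)\,dt.$$ $\bar d\psi=\partial_t\psi\,dt+d\psi$ is the exterior derivative on $\mathcal M$ ($d$ being the one on $M$). *)

(* Defs.v *)
From HB Require Import structures.
From mathcomp Require Import all_boot all_order all_algebra.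
From mathcomp Require Import all_classical all_reals all_analysis.
From mathcomp Require Import complex.

Set Implicit Arguments.
Unset Strict Implicit.
Unset Printing Implicit Defensive.
Import Order.TTheory GRing.Theory Num.Theory.
Import numFieldNormedType.Exports.

Local Open Scope classical_set_scope.
Local Open Scope ring_scope.

(** ** Calculus on subsets of R^d *)

Section Calculus.
Context {R : realType}.

(* The difference quotients are taken inside D, so that these are one-sided
   derivatives at the endpoints of an interval. *)
Definition diff_quotient (D : set R) (f : R -> R) (t : R) : set_system R :=
  (f s - f t) / (s - t) @[s --> within D t^'].

Definition derivable_in (D : set R) (f : R -> R) (t : R) : Prop :=
  cvg (diff_quotient D f t).

Definition derive_in (D : set R) (f : R -> R) (t : R) : R :=
  lim (diff_quotient D f t).

(* i-th partial derivative of f at z, taken inside S: one-sided where the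
   i-th coordinate line through z ends at z. *)
Definition line d (z : 'rV[R]_d) (i : 'I_d) (h : R) : 'rV[R]_d :=
  z + h *: delta_mx 0 i.

Definition pderivable d (S : set 'rV[R]_d) (f : 'rV[R]_d -> R) z i : Prop :=
  derivable_in [set h | S (line z i h)] (fun h => f (line z i h)) 0.

Definition pderive d (S : set 'rV[R]_d) (f : 'rV[R]_d -> R) z i : R :=
  derive_in [set h | S (line z i h)] (fun h => f (line z i h)) 0.

(* C^k up to the boundary. Only used when S is a relatively open subset of a
   product of closed half-lines, compact intervals and lines. *)
Fixpoint Ck d (k : nat) (S : set 'rV[R]_d) (f : 'rV[R]_d -> R) : Prop :=
  {within S, continuous f} /\
  if k is k'.+1 then
    forall i, (forall z, S z -> pderivable S f z i) /\
              Ck k' S (fun z => pderive S f z i)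
  else True.

(* Iterated Lebesgue integral over R^d; by Tonelli it is the integral against
   d-dimensional Lebesgue measure for nonnegative Borel functions. *)
Fixpoint iter_integral d : ('rV[R]_d -> \bar R) -> \bar R :=
  match d return ('rV[R]_d -> \bar R) -> \bar R with
  | 0%N => fun f => f 0
  | d'.+1 => fun f =>
      (\int[@lebesgue_measure R]_t
         iter_integral (fun z : 'rV[R]_d' => f (row_mx (t%:M : 'rV[R]_1) z)))%E
  end.

Definition cintegral d (T : measurableType d) (mu : {measure set T -> \bar R})
    (D : set T) (h : T -> R[i]) : R[i] :=
  Complex (Rintegral mu D (fun x => complex.Re (h x)))
          (Rintegral mu D (fun x => complex.Im (h x))).

Definition re_row d (a : 'rV[R[i]]_d) : 'rV[R]_d := map_mx (@complex.Re R) a.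
Definition im_row d (a : 'rV[R[i]]_d) : 'rV[R]_d := map_mx (@complex.Im R) a.

Definition pairing d (a : 'rV[R[i]]_d) (v : 'rV[R]_d) : R[i] :=
  \sum_i a 0 i * real_complex R (v 0 i).

End Calculus.

(** ** Atlases, and the calculus they carry *)

(* [chart_at x] is a preferred chart around x. A tangent vector or covector
   at x is encoded by its components in that chart. Consequently a one-form is
   a function X -> 'rV_d, and equality at x of the component vectors is equality
   of the covectors; its components in another chart are given by
   [covector_in] below. *)
Record atlas (R : realType) (d : nat) (X : topologicalType) := Atlas {
  chart : Type;
  cdom : chart -> set X;
  cmap : chart -> X -> 'rV[R]_d;
  cinv : chart -> 'rV[R]_d -> X;
  chart_at : X -> chart
}.

Section Atlas.
Context {R : realType} {d : nat} {X : topologicalType} (A : atlas R d X).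

Definition cimg (c : chart A) : set 'rV[R]_d := cmap c @` cdom c.

(* Row i, column j: derivative of the j-th coordinate of c' with respect to
   the i-th coordinate of c. *)
Definition jacobian (c c' : chart A) (x : X) : 'M[R]_d :=
  \matrix_(i, j) pderive (cimg c) (fun z => cmap c' (cinv c z) 0 j) (cmap c x) i.

Definition covector_in (c : chart A) (alpha : X -> 'rV[R]_d) (x : X) : 'rV[R]_d :=
  alpha x *m (jacobian c (chart_at A x) x)^T.

Definition Ck_fun (k : nat) (u : X -> R[i]) : Prop :=
  forall c : chart A,
    Ck k (cimg c) (fun z => complex.Re (u (cinv c z))) /\
    Ck k (cimg c) (fun z => complex.Im (u (cinv c z))).

Definition Ck_form (k : nat) (alpha : X -> 'rV[R[i]]_d) : Prop :=
  forall (c : chart A) i,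
    Ck k (cimg c)
      (fun z => covector_in c (fun x => re_row (alpha x)) (cinv c z) 0 i) /\
    Ck k (cimg c)
      (fun z => covector_in c (fun x => im_row (alpha x)) (cinv c z) 0 i).

Definition differential (u : X -> R[i]) (x : X) : 'rV[R[i]]_d :=
  let c := chart_at A x in
  \row_i Complex
    (pderive (cimg c) (fun z => complex.Re (u (cinv c z))) (cmap c x) i)
    (pderive (cimg c) (fun z => complex.Im (u (cinv c z))) (cmap c x) i).

Definition velocity (D : set R) (gamma : R -> X) (t : R) : 'rV[R]_d :=
  \row_i derive_in D (fun s => cmap (chart_at A (gamma t)) (gamma s) 0 i) t.

End Atlas.

(** ** Smooth manifolds with boundary *)

Definition half_space (R : realType) (n : nat) : set 'rV[R]_n :=
  [set z | forall i : 'I_n, i = 0%N :> nat -> 0 <= z 0 i].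

Record is_manifold_with_boundary (R : realType) (n : nat) (M : topologicalType)
    (A : atlas R n M) : Prop := {
  mfd_hausdorff : hausdorff_space M;
  mfd_second_countable : @second_countable M;
  mfd_chart_at : forall x, cdom (chart_at A x) x;
  mfd_cdom_open : forall c : chart A, open (cdom c);
  mfd_cimg_open : forall c : chart A,
    exists O, open O /\ cimg c = O `&` @half_space R n;
  mfd_cinvK : forall (c : chart A) x, cdom c x -> cinv c (cmap c x) = x;
  mfd_cmap_continuous : forall c : chart A,
    {within cdom c, continuous (cmap c)};
  mfd_cinv_continuous : forall c : chart A,
    {within cimg c, continuous (cinv c)};
  mfd_smooth : forall (c c' : chart A) (k : nat) j,
    Ck k (cmap c @` (cdom c `&` cdom c')) (fun z => cmap c' (cinv c z) 0 j)
}.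

Section Manifold.
Context {R : realType} {n : nat} {M : ptopologicalType} (A : atlas R n M).

Definition bdry : set M :=
  [set x | exists c : chart A,
     cdom c x /\ forall i : 'I_n, i = 0%N :> nat -> cmap c x 0 i = 0].

(* w is in T_x(bdry), for x in bdry *)
Definition tangent_bdry (x : M) (w : 'rV[R]_n) : Prop :=
  forall i : 'I_n, i = 0%N :> nat -> w 0 i = 0.

Section Metric.

(* A metric tensor, by its components at x in [chart_at A x]. *)
Variable g : M -> 'M[R]_n.

Definition metric_in (c : chart A) (x : M) : 'M[R]_n :=
  let J := jacobian c (chart_at A x) x in J *m g x *m J^T.

Record is_riemannian_metric (k : nat) : Prop := {
  metric_sym : forall x, (g x)^T = g x;
  metric_pos : forall x (v : 'rV[R]_n), v != 0 -> 0 < (v *m g x *m v^T) 0 0;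
  metric_Ck : forall (c : chart A) i j,
    Ck k (cimg c) (fun z => metric_in c (cinv c z) i j)
}.

Definition dot (x : M) (v w : 'rV[R]_n) : R := (v *m g x *m w^T) 0 0.

(* Hermitian extension of the dual metric to complex covectors. *)
Definition codot (x : M) (a b : 'rV[R[i]]_n) : R[i] :=
  (a *m map_mx (real_complex R) (invmx (g x)) *m (map_mx (@conjc R) b)^T) 0 0.

Definition outward_unit_normal (y : M) (nu : 'rV[R]_n) : Prop :=
  [/\ dot y nu nu = 1,
      forall w, tangent_bdry y w -> dot y nu w = 0 &
      forall i : 'I_n, i = 0%N :> nat -> nu 0 i < 0].

(** *** Geodesics *)

Definition christoffel (c : chart A) (x : M) (k i j : 'I_n) : R :=
  let dG l a b :=
    pderive (cimg c) (fun z => metric_in c (cinv c z) a b) (cmap c x) l in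
  2^-1 * \sum_l invmx (metric_in c x) k l * (dG i j l + dG j i l - dG l i j).

(* gamma restricted to [0, L] is a geodesic of M; its values elsewhere are
   irrelevant. *)
Definition geodesic (L : R) (gamma : R -> M) : Prop :=
  {within `[0, L], continuous gamma} /\
  forall (c : chart A) t, 0 <= t <= L -> cdom c (gamma t) ->
    let v s : 'rV[R]_n :=
      \row_i derive_in `[0, L] (fun r => cmap c (gamma r) 0 i) s in
    forall k,
    [/\ derivable_in `[0, L] (fun s => cmap c (gamma s) 0 k) t,
        derivable_in `[0, L] (fun s => v s 0 k) t &
        derive_in `[0, L] (fun s => v s 0 k) t =
        - \sum_i \sum_j christoffel c (gamma t) k i j * v t 0 i * v t 0 j].

Definition geodesic_from (y : M) (v : 'rV[R]_n) (L : R) (gamma : R -> M) : Prop :=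
  [/\ geodesic L gamma, gamma 0 = y & velocity A `[0, L] gamma 0 = v].

Definition exit_times (y : M) (v : 'rV[R]_n) : set R :=
  [set t | 0 < t /\ exists gamma, [/\ geodesic_from y v t gamma,
     bdry (gamma t) &
     ~ tangent_bdry (gamma t) (velocity A `[0, t] gamma t)]].

(* [ereal_inf set0 = +oo] *)
Definition tau_exit (y : M) (v : 'rV[R]_n) : \bar R :=
  ereal_inf [set t%:E | t in exit_times y v].

Definition inward_SM : set (M * 'rV[R]_n) :=
  [set yv | [/\ dot yv.1 yv.2 yv.2 = 1, bdry yv.1,
     exists nu, outward_unit_normal yv.1 nu /\ dot yv.1 yv.2 nu < 0 &
     (tau_exit yv.1 yv.2 < +oo)%E]].

(* gamma is, on [0, L], the geodesic issued from (y, v) in [inward_SM], and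
   L is its exit time. *)
Definition maximal_geodesic (L : R) (gamma : R -> M) : Prop :=
  exists y v, [/\ inward_SM (y, v), tau_exit y v = L%:E &
                  geodesic_from y v L gamma].

(* The supremum is taken in [0, +oo], so that it is 0 if no maximal geodesic
   goes through x. *)
Definition Dg (x : M) : \bar R :=
  ereal_sup (0%E |` [set l | exists L gamma, [/\ l = L%:E,
    maximal_geodesic L gamma & exists2 t, 0 < t < L & gamma t = x]]).

Definition DgM : \bar R := ereal_sup (range Dg).

Definition ray_transform (L : R) (gamma : R -> M)
    (f : M -> R[i]) (alpha : M -> 'rV[R[i]]_n) : R[i] :=
  cintegral (@lebesgue_measure R) `]0, L[
    (fun t => f (gamma t) + pairing (alpha (gamma t)) (velocity A `[0, L] gamma t)).

(** *** Solenoidal part *)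

Local Notation borelM := (g_sigma_algebraType (@open M)).

(* The Riemannian volume: |g|^(1/2) dx in each chart. *)
Definition is_volume_measure (mu : {measure set borelM -> \bar R}) : Prop :=
  forall (c : chart A) (B : set borelM), measurable B -> B `<=` cdom c ->
    mu B = iter_integral
      (patch (fun=> 0%E) (cmap c @` B)
        (fun z => (Num.sqrt (\det (metric_in c (cinv c z))))%:E)).

Variable mu : {measure set borelM -> \bar R}.

Definition measurable_cfun (psi : M -> R[i]) : Prop :=
  measurable_fun [set: borelM] (fun x : borelM => complex.Re (psi x)) /\
  measurable_fun [set: borelM] (fun x : borelM => complex.Im (psi x)).

Definition measurable_form (eta : M -> 'rV[R[i]]_n) : Prop :=
  forall (c : chart A) i,
    measurable_fun (cdom c : set borelM)
      (fun x : borelM => covector_in c (fun y => re_row (eta y)) x 0 i) /\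
    measurable_fun (cdom c : set borelM)
      (fun x : borelM => covector_in c (fun y => im_row (eta y)) x 0 i).

Definition L2sq_fun (psi : M -> R[i]) : \bar R :=
  (\int[mu]_x (complex.Re (psi x) ^+ 2 + complex.Im (psi x) ^+ 2)%:E)%E.

Definition L2sq_form (eta : M -> 'rV[R[i]]_n) : \bar R :=
  (\int[mu]_x (complex.Re (codot x (eta x) (eta x)))%:E)%E.

Definition test_function (phi : M -> R[i]) : Prop :=
  [/\ forall k, Ck_fun A k phi, compact (closure [set x | phi x != 0]) &
      closure [set x | phi x != 0] `<=` ~` bdry].

(* psi is in H^1_0(M), the H^1-closure of the test functions, and eta is its
   weak differential. *)
Definition H10 (psi : M -> R[i]) (eta : M -> 'rV[R[i]]_n) : Prop :=
  [/\ measurable_cfun psi, measurable_form eta &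
   exists phi : nat -> M -> R[i], [/\ forall k, test_function (phi k),
     L2sq_fun (fun x => phi k x - psi x) @[k --> \oo] --> 0%E &
     L2sq_form (fun x => differential A (phi k) x - eta x) @[k --> \oo] --> 0%E]].

(* beta = alpha - d psi almost everywhere, where psi in H^1_0(M) is the weak
   solution of Delta_g psi = delta alpha. Against a test function phi, the
   distribution delta alpha is - \int <alpha, d phi>, and Delta_g psi is
   - \int <d psi, d phi>. *)
Definition solenoidal_part (alpha beta : M -> 'rV[R[i]]_n) : Prop :=
  exists psi eta, [/\ H10 psi eta,
    forall phi, test_function phi ->
      cintegral mu [set: borelM] (fun x => codot x (eta x) (differential A phi x)) =
      cintegral mu [set: borelM] (fun x => codot x (alpha x) (differential A phi x)) &
    {ae mu, forall x, beta x = alpha x - eta x}].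

End Metric.

(** ** The space-time [0, T] x M *)

Section Spacetime.
Variable T : R.

Definition spacetime : set (R * M) := [set p | 0 <= p.1 <= T].

(* Coordinate 0 is the time, and the coordinates 1 + j are those of M. *)
Definition spacetime_atlas : atlas R (1 + n) (R * M)%type :=
  @Atlas R (1 + n) (R * M)%type (chart A)
    (fun c => [set p | spacetime p /\ cdom c p.2])
    (fun c p => row_mx (p.1%:M : 'rV[R]_1) (cmap c p.2))
    (fun c z => (lsubmx z 0 0, cinv c (rsubmx z)))
    (fun p => chart_at A p.2).

Definition bdry_spacetime : set (R * M) :=
  [set p | spacetime p /\ (p.1 = 0 \/ p.1 = T \/ bdry p.2)].

Definition calE (g : M -> 'M[R]_n) : set (R * M) :=
  [set p | spacetime p /\ (Dg g p.2 < p.1%:E < T%:E - Dg g p.2)%E].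

(* [spacetime] is closed, so the closure may be taken in R x M. *)
Definition supp (V : zmodType) (u : R * M -> V) : set (R * M) :=
  closure [set p | spacetime p /\ u p != 0].

Definition extend0 (V : zmodType) (u : R * M -> V) (p : R * M) : V :=
  if 0 <= p.1 <= T then u p else 0.

(* The null geodesic t |-> (t0 + t, gamma t). *)
Definition null_curve (t0 : R) (gamma : R -> M) (t : R) : R * M :=
  (t0 + t, gamma t).

Definition light_ray_fun (q : R * M -> R[i]) (L : R) (beta : R -> R * M) : R[i] :=
  cintegral (@lebesgue_measure R) `]0, L[ (fun t => extend0 q (beta t)).

Definition light_ray_form (F : R * M -> 'rV[R[i]]_(1 + n)) (L : R)
    (beta : R -> R * M) : R[i] :=
  cintegral (@lebesgue_measure R) `]0, L[
    (fun t => pairing (extend0 F (beta t))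
                      (velocity spacetime_atlas `[0, L] beta t)).

End Spacetime.

End Manifold.

(* Main.v *)
Require Import Defs.
From HB Require Import structures.
From mathcomp Require Import all_boot all_order all_algebra.
From mathcomp Require Import all_classical all_reals all_analysis.
From mathcomp Require Import measurable_realfun.
From mathcomp Require Import complex ring lra.
Import Order.TTheory GRing.Theory Num.Theory.
Import numFieldNormedType.Exports.
Local Open Scope classical_set_scope.
Local Open Scope ring_scope.

(* Let f_k and alpha_k be the moments of order k in time of the function (or time component)
   and of the spatial part. Integrating over t0 the vanishing light ray transform against the
   powers of t0 shows that sum_j C(k,j) (-t)^(k-j) (f_j + alpha_j) has zero integral along every
   maximal geodesic. By induction on k, alpha_j = d u_j for j < k with u_j = 0 on the boundary
   and f_j = - j u_(j-1); integrating the terms j < k by parts leaves the ray transform of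
   (f_k + k u_(k-1), alpha_k), which therefore vanishes, and injectivity gives
   f_k = - k u_(k-1) and alpha_k = d u_k. The primitive in time of the time component has the
   u_k as moments, and moments determine a continuous function on [0, T]; hence this primitive
   is the required potential.

   Injectivity only yields alpha_k = d u in the weak sense with u in H^1_0. In a coordinate box
   a function f is recovered from its averages along the coordinate lines and its differential,
   f = avg_i f + osc_i (d_i f), by operators that are bounded in L^1 and preserve continuity;
   applied to the test functions approximating u this shows that u is C^1 with continuous
   differential alpha_k, and that it vanishes on the boundary. *)

Set Implicit Arguments.
Unset Strict Implicit.
Unset Printing Implicit Defensive.

(** Moments in [t0] play the role of the Taylor coefficients at frequency 0 of the Fourier transform
    in time. The supports enter through [D_g >= 0]: a point of [calE] has [0 < t < T], so the fields
    extend by zero to continuous fields on [R x M], and every moment is a continuous pair on [M] to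
    which injectivity applies. The main obstacle is regularity. The integration by parts takes place
    along a single geodesic, where an element of [H^1_0] has no well-defined values; hence each
    potential must be made classical before the next moment can be treated. A second obstacle is the
    far end of a maximal geodesic: the exit time is an infimum, so that the vanishing of [u_j] there
    rests on the uniqueness of geodesics. Finally, the primitive in time is built from the time
    component alone, and nothing says beforehand that it is differentiable in space. Its increments
    along coordinate segments are therefore compared with the integrals of the spatial part, moment
    by moment, which involves no derivative of it. Real and imaginary parts are treated
    separately. *)

Local Notation jacobian := Defs.jacobian.

(** * One-variable calculus *)

Section Itg.
Context {R : realType}.
Implicit Types (f g : R -> R) (a b c : R).
Notation leb := (@lebesgue_measure R).

(** Not an oriented integral: it is 0 when [b < a], so additivity and translation need ordered end
    points. *)
Definition itg a b f : R := \int[leb]_(x in `[a, b]) f x.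

Lemma cont_integrable a b f : continuous f ->
  leb.-integrable `[a, b] (EFin \o f).
Proof.
move=> cf; apply: continuous_compact_integrable; first exact: segment_compact.
exact: continuous_subspaceT.
Qed.

Lemma eq_itg a b f g : (forall x, a <= x <= b -> f x = g x) ->
  itg a b f = itg a b g.
Proof. by move=> fg; apply: eq_Rintegral => x; rewrite inE/= in_itv/=; exact: fg. Qed.

Lemma itgD a b f g : continuous f -> continuous g ->
  itg a b (fun x => f x + g x) = itg a b f + itg a b g.
Proof. by move=> cf cg; apply: RintegralD => //; exact: cont_integrable. Qed.

Lemma itgB a b f g : continuous f -> continuous g ->
  itg a b (fun x => f x - g x) = itg a b f - itg a b g.
Proof. by move=> cf cg; apply: RintegralB => //; exact: cont_integrable. Qed.

Lemma itgZ a b k f : continuous f ->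
  itg a b (fun x => k * f x) = k * itg a b f.
Proof. by move=> cf; apply: RintegralZl => //; exact: cont_integrable. Qed.

Lemma itg_cst a b k : a <= b -> itg a b (fun=> k) = (b - a) * k.
Proof.
move=> ab; rewrite /itg Rintegral_cst//= lebesgue_measure_itv/= lte_fin.
case: ltrP => // ba; first by rewrite mulrC.
by have -> : a = b; [apply/le_anti; rewrite ab|rewrite /= subrr mul0r mulr0].
Qed.

Lemma le_itg a b f g : continuous f -> continuous g ->
  (forall x, a <= x <= b -> f x <= g x) -> itg a b f <= itg a b g.
Proof.
by move=> cf cg fg; apply: le_Rintegral => //; exact: cont_integrable.
Qed.

Lemma itg_ge0 a b f : (forall x, a <= x <= b -> 0 <= f x) -> 0 <= itg a b f.
Proof. by move=> f0; apply: Rintegral_ge0 => x /=; rewrite in_itv/=; exact: f0. Qed.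

Lemma itg_gt a b f : b < a -> itg a b f = 0.
Proof. by move=> ba; rewrite /itg set_itv_ge ?Rintegral_set0// bnd_simp -ltNge. Qed.

Lemma itgaa a f : itg a a f = 0.
Proof. by rewrite /itg set_itv1 Rintegral_set1. Qed.

Lemma abs_itg a b f : continuous f -> `|itg a b f| <= itg a b (fun x => `|f x|).
Proof. by move=> cf; apply: le_normr_Rintegral => //; exact: cont_integrable. Qed.

Lemma norm_itg_le a b f (k : R) : a <= b -> continuous f ->
  (forall x, a <= x <= b -> `|f x| <= k) -> `|itg a b f| <= (b - a) * k.
Proof.
move=> ab cf fk; apply: (le_trans (abs_itg a b cf)).
rewrite -itg_cst//; apply: le_itg => //.
- by move=> x; apply: continuous_comp; [exact: cf|exact: norm_continuous].
- by move=> x; exact: cvg_cst.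
Qed.

Lemma itg_split a b c f : continuous f -> a <= c -> c <= b ->
  itg a b f = itg a c f + itg c b f.
Proof.
move=> cf ac cb; rewrite /itg.
have := @Rintegral_itvB R f (BLeft a) (BRight b) c.
rewrite !bnd_simp => /(_ (cont_integrable a b cf) ac cb).
rewrite Rintegral_itv_obnd_cbnd => [<-|]; first by rewrite addrC subrK.
by apply: integrableS (cont_integrable c b cf) => //; apply: subset_itvr; rewrite bnd_simp.
Qed.

Lemma itg_oo a b f : continuous f -> \int[leb]_(x in `]a, b[) f x = itg a b f.
Proof.
move=> cf; rewrite Rintegral_itv_bndo_bndc; last first.
  by apply: integrableS (cont_integrable a b cf) => //; exact: subset_itv_oo_cc.
rewrite Rintegral_itv_obnd_cbnd//.
by apply: integrableS (cont_integrable a b cf) => //; apply: subset_itvr; rewrite bnd_simp.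
Qed.

Lemma FTC1_itg a f x : continuous f -> a < x -> is_derive x 1 (itg a ^~ f) (f x).
Proof.
move=> cf ax.
have xx1 : x < x + 1 by rewrite ltrDl.
have [d e] := continuous_FTC1_closed xx1 (cont_integrable a (x + 1) cf) ax (cf x).
by apply: DeriveDef => //; rewrite -derive1E.
Qed.

Lemma is_derive_cvg (F : R -> R) (x l : R) : is_derive x (1 : R) F l ->
  F y @[y --> x] --> F x.
Proof.
move=> dF; apply: (@differentiable_continuous R R R); apply/derivable1_diffP.
exact: ex_derive.
Qed.

Lemma FTC2_itg a b f (F : R -> R) : a <= b -> continuous f ->
  (forall x, a <= x <= b -> F y @[y --> within `[a, b] (nbhs x)] --> F x) ->
  (forall x, a < x < b -> is_derive x (1 : R) F (f x)) ->
  itg a b f = F b - F a.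
Proof.
rewrite le_eqVlt => /predU1P[<- _ _ _|ab]; first by rewrite itgaa subrr.
move=> cf cF dF.
rewrite /itg /Rintegral (@continuous_FTC2 R f F)//=.
- exact: continuous_subspaceT.
- have /(continuous_within_itvP _ ab)[_ Fa Fb] : {within `[a, b], continuous F}.
    by apply/subspace_continuousP => x /=; rewrite in_itv/=; exact: cF.
  by split=> // x; rewrite in_itv/= => /dF[].
- by move=> x; rewrite in_itv/= => /dF[_ <-]; rewrite derive1E.
Qed.

(** To the left of [a] the integral is constantly 0 and to the right it is differentiable. The
    estimate is needed at [a] itself, where [f] is bounded by [|f a| + 1] nearby. *)
Lemma continuous_itg_ub a f : continuous f -> continuous (itg a ^~ f).
Proof.
move=> cf x; have [xa|ax|<-] := ltgtP x a.
- rewrite /prop_for /continuous_at (itg_gt _ xa).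
  apply: cvg_near_cst; near=> y; rewrite itg_gt//; near: y; exact: lt_nbhsl.
- exact: is_derive_cvg (FTC1_itg cf ax).
- rewrite /prop_for /continuous_at itgaa.
  apply/cvgrPdist_le => e e0.
  have : \forall y \near x, `|f x - f y| < 1.
    by have /cvgrPdist_lt := cf x; apply.
  move=> /nbhs_ballP[d /= d0 dP].
  have M0 : 0 < `|f x| + 1 by rewrite ltr_wpDl.
  exists (Num.min (d / 2) (e / (`|f x| + 1))) => /=.
    by rewrite lt_min !divr_gt0.
  move=> y; rewrite /ball/= lt_min => /andP[yd ye].
  rewrite sub0r normrN; have [yx|xy] := ltrP y x; first by rewrite itg_gt// normr0 ltW.
  rewrite (@le_trans _ _ ((y - x) * (`|f x| + 1)))//; last first.
    rewrite -ler_pdivlMr//; apply: ltW; apply: le_lt_trans ye.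
    by rewrite distrC ler_norm.
  apply: norm_itg_le => // z /andP[xz zy].
  have /dP : ball x d z.
    rewrite /ball/= distrC ger0_norm ?subr_ge0//.
    apply: (@le_lt_trans _ _ (d / 2)); last by rewrite ltr_pdivrMr// mulr_natr mulr2n ltrDl.
    apply: ltW; apply: le_lt_trans yd; rewrite distrC ger0_norm ?subr_ge0//.
    by rewrite lerB.
  move=> /= fz; rewrite -[f z](subrK (f x)) (le_trans (ler_normD _ _))//.
  by rewrite addrC lerD2l distrC ltW.
Unshelve. all: by end_near. Qed.

Lemma itg_translate a b s f : a <= b -> continuous f ->
  itg a b (fun x => f (x + s)) = itg (a + s) (b + s) f.
Proof.
move=> ab cf.
have cfs : continuous (fun x => f (x + s)).
  move=> x; apply: (@continuous_comp _ _ _ (fun x => x + s) f); last exact: cf.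
  by apply: cvgD; [exact: cvg_id|exact: cvg_cst].
have lb x : a + s - 1 < x + s -> is_derive x (1 : R) (fun x => itg (a + s - 1) (x + s) f) (f (x + s)).
  move=> ax.
  have := @is_derive1_comp R (fun y => itg (a + s - 1) y f) (fun x => x + s) x (f (x + s)) 1.
  rewrite mulr1; apply; first exact: FTC1_itg.
  have : is_derive x (1 : R) ((id : R -> R) + cst s) (1 + 0) by apply: is_deriveD.
  by rewrite addr0.
have -> : itg a b (fun x => f (x + s)) =
          itg (a + s - 1) (b + s) f - itg (a + s - 1) (a + s) f.
  apply: (@FTC2_itg a b _ (fun x => itg (a + s - 1) (x + s) f) ab cfs).
- move=> x _; apply: cvg_within_filter.
  apply: (@continuous_comp _ _ _ (fun x => x + s) (itg (a + s - 1) ^~ f)).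
    by apply: cvgD; [exact: cvg_id|exact: cvg_cst].
  exact: continuous_itg_ub.
- move=> x /andP[ax _]; apply: lb.
  by rewrite -addrA [s - 1]addrC addrA ltrD2r (le_lt_trans _ ax)// gerBl.
rewrite (@itg_split (a + s - 1) (b + s) (a + s))//.
- by rewrite addrC addrA addNr add0r.
- by rewrite gerBl.
- by rewrite lerD2r.
Qed.

(** Every partial integral [itg a x f] lies between 0 and the total, hence vanishes; its derivative
    [f] vanishes inside the interval, and at the end points by continuity. *)
Lemma itg_eq0 a b f : continuous f -> a < b ->
  (forall x, a <= x <= b -> 0 <= f x) -> itg a b f = 0 ->
  forall x, a <= x <= b -> f x = 0.
Proof.
move=> cf ab f0 i0.
have F0 x : a <= x <= b -> itg a x f = 0.
  move=> /andP[ax xb]; apply/le_anti/andP; split.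
    rewrite -i0 (@itg_split a b x)// lerDl; apply: itg_ge0 => y /andP[xy yb].
    by rewrite f0// yb (le_trans ax xy).
  by apply: itg_ge0 => y /andP[ay yx]; rewrite f0// ay (le_trans yx xb).
have fo x : a < x < b -> f x = 0.
  move=> /andP[ax xb].
  have d1 := FTC1_itg cf ax.
  have : is_derive x (1 : R) (itg a ^~ f) 0.
    apply: (@near_eq_is_derive _ _ _ (fun=> 0)) => //.
    near=> y; rewrite F0//; apply/andP; split; apply: ltW; near: y.
    - exact: lt_nbhsr.
    - exact: lt_nbhsl.
  by case: d1 => _ <- [_ ->].
move=> x /andP[]; rewrite le_eqVlt => /predU1P[<- _|ax].
  apply: (@cvg_unique _ _ (f y @[y --> a^'+])) => //.
    exact/cvg_at_right_filter/cf.
  apply: (@cvg_trans _ ((fun=> 0) y @[y --> a^'+])); last exact: cvg_cst.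
  apply: near_eq_cvg; near=> y; rewrite fo//; apply/andP; split; near: y.
  - exact: nbhs_right_gt.
  - exact: nbhs_right_lt.
rewrite le_eqVlt => /predU1P[->|xb]; last by apply: fo; rewrite ax.
apply: (@cvg_unique _ _ (f y @[y --> b^'-])) => //.
  exact/cvg_at_left_filter/cf.
apply: (@cvg_trans _ ((fun=> 0) y @[y --> b^'-])); last exact: cvg_cst.
apply: near_eq_cvg; near=> y; rewrite fo//; apply/andP; split; near: y.
- exact: nbhs_left_gt.
- exact: nbhs_left_lt.
Unshelve. all: by end_near. Qed.

End Itg.

(** * One-sided derivatives on subsets of the line *)

Section Hasd.
Context {R : realType}.
Implicit Types (D : set R) (f g : R -> R) (t l : R).

(* Unlike [diff_quotient], this is also meaningful when [t] is isolated in [D]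
   (it is then vacuous). *)
Definition hasd D f t l := forall e, 0 < e ->
  \forall s \near t, D s -> `|f s - f t - l * (s - t)| <= e * `|s - t|.

Lemma hasdP D f t l : hasd D f t l <-> diff_quotient D f t --> l.
Proof.
rewrite /diff_quotient; split.
  move=> h; apply/cvgrPdist_le => e e0.
  have he := h _ e0.
  suff h2 : \forall s \near t, s != t -> D s -> `|l - (f s - f t) / (s - t)| <= e.
    exact: h2.
  near=> s => st Ds; rewrite distrC.
  have st0 : s - t != 0 by rewrite subr_eq0.
  rewrite -[l](mulfK st0) -mulrBl normrM normfV ler_pdivrMr ?normr_gt0//.
  by move: Ds; near: s.
move=> /cvgrPdist_le h e e0.
have he : \forall s \near t, s != t -> D s -> `|l - (f s - f t) / (s - t)| <= e.
  exact: (h e e0).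
near=> s => Ds; have [->|st] := eqVneq s t.
  by rewrite !subrr mulr0 subr0 normr0 mulr0.
have st0 : s - t != 0 by rewrite subr_eq0.
rewrite -ler_pdivrMr ?normr_gt0// -normfV -normrM mulrBl mulfK// distrC.
by move: st Ds; near: s.
Unshelve. all: by end_near. Qed.

Lemma derivable_in_hasd D f t : derivable_in D f t -> hasd D f t (derive_in D f t).
Proof. by move=> h; apply/hasdP. Qed.

Lemma hasd_derivable_in D f t l : hasd D f t l -> derivable_in D f t.
Proof. by move=> /hasdP h; apply/cvg_ex; exists l. Qed.

Lemma hasd_derive_in D f t l : ProperFilter (within D t^') ->
  hasd D f t l -> derive_in D f t = l.
Proof. by move=> pf /hasdP h; apply/cvg_lim. Qed.

Lemma hasd_unique D f t l l' : ProperFilter (within D t^') ->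
  hasd D f t l -> hasd D f t l' -> l = l'.
Proof. by move=> pf /(hasd_derive_in pf) <- /(hasd_derive_in pf). Qed.

Lemma hasd_near D D' f g t l : (\forall s \near t, D' s -> D s /\ f s = g s) ->
  f t = g t -> hasd D f t l -> hasd D' g t l.
Proof.
move=> h fgt hf e e0; have := hf e e0.
by apply: filterS2 h => s h1 h2 /h1[Ds fg]; rewrite -fg -fgt; exact: h2.
Qed.

Lemma hasdS D D' f t l : D' `<=` D -> hasd D f t l -> hasd D' f t l.
Proof. by move=> h; apply: hasd_near => //; near=> s => /h. Unshelve. all: by end_near. Qed.

Lemma hasd_cvg D f t l : hasd D f t l -> f s @[s --> within D (nbhs t)] --> f t.
Proof.
move=> h; apply/cvgrPdist_le => e e0.
have l0 : 0 < `|l| + 1 by rewrite ltr_wpDl.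
suff h2 : \forall s \near t, D s -> `|f t - f s| <= e by exact: h2.
near=> s => Ds.
have hs : `|f s - f t - l * (s - t)| <= 1 * `|s - t|.
  by move: Ds; near: s; exact: h.
rewrite distrC -[f s - f t](subrK (l * (s - t))).
rewrite (le_trans (ler_normD _ _))// normrM.
rewrite (@le_trans _ _ ((`|l| + 1) * `|s - t|))//.
  by rewrite mulrDl addrC lerD.
rewrite mulrC -ler_pdivlMr//; near: s.
have e'0 : 0 < e / (`|l| + 1) by rewrite divr_gt0.
apply/nbhs_ballP; exists (e / (`|l| + 1)) => //= x; rewrite /ball/= => /ltW.
by rewrite distrC.
Unshelve. all: by end_near. Qed.

Lemma hasd_cst D (k t : R) : hasd D (fun=> k) t 0.
Proof. by move=> e e0; near=> s => _; rewrite mul0r !subrr normr0 mulr_ge0// ltW.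
Unshelve. all: by end_near. Qed.

Lemma hasd_id D t : hasd D id t 1.
Proof. by move=> e e0; near=> s => _; rewrite mul1r subrr normr0 mulr_ge0// ltW.
Unshelve. all: by end_near. Qed.

Lemma hasdD D f g t l m : hasd D f t l -> hasd D g t m ->
  hasd D (fun s => f s + g s) t (l + m).
Proof.
move=> /hasdP hf /hasdP hg; apply/hasdP.
apply: cvg_trans (cvgD hf hg); apply: near_eq_cvg; near=> s.
by rewrite -[in LHS]mulrDl opprD addrACA.
Unshelve. all: by end_near. Qed.

Lemma hasdZ D f t l (k : R) : hasd D f t l -> hasd D (fun s => k * f s) t (k * l).
Proof.
move=> /hasdP hf; apply/hasdP.
apply: cvg_trans (cvgM (cvg_cst k) hf); apply: near_eq_cvg; near=> s.
by rewrite /= mulrA mulrBr.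
Unshelve. all: by end_near. Qed.

Lemma hasdN D f t l : hasd D f t l -> hasd D (fun s => - f s) t (- l).
Proof.
move=> /(hasdZ (-1)); rewrite mulN1r; apply: hasd_near; last by rewrite mulN1r.
by near=> s => Ds; rewrite mulN1r.
Unshelve. all: by end_near. Qed.

Lemma hasdB D f g t l m : hasd D f t l -> hasd D g t m ->
  hasd D (fun s => f s - g s) t (l - m).
Proof. by move=> hf /hasdN; exact: hasdD. Qed.

Lemma hasd_sum D I (r : seq I) (f : I -> R -> R) t (l : I -> R) :
  (forall i, hasd D (f i) t (l i)) ->
  hasd D (fun s => \sum_(i <- r) f i s) t (\sum_(i <- r) l i).
Proof.
move=> h; elim: r => [|i r IH].
  rewrite big_nil; apply: hasd_near (hasd_cst D 0 t); rewrite ?big_nil//.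
  by near=> s => Ds; rewrite big_nil.
rewrite big_cons; apply: hasd_near (hasdD (h i) IH); rewrite ?big_cons//.
by near=> s => Ds; rewrite big_cons.
Unshelve. all: by end_near. Qed.

Lemma hasdM D f g t l m : hasd D f t l -> hasd D g t m ->
  hasd D (fun s => f s * g s) t (l * g t + f t * m).
Proof.
move=> hf hg; have cg := hasd_cvg hg.
move: hf hg => /hasdP hf /hasdP hg; apply/hasdP.
have cg' : g s @[s --> within D t^'] --> g t.
  apply: cvg_trans cg; apply: cvg_app => P hP.
  have hP' : \forall s \near t, D s -> P s by exact: hP.
  suff h2 : \forall s \near t, s != t -> D s -> P s by exact: h2.
  by apply: filterS hP' => s h _ Ds; exact: h.
apply: cvg_trans (cvgD (cvgM hf cg') (cvgM (cvg_cst (f t)) hg)).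
apply: near_eq_cvg; near=> s.
rewrite -[LHS]/((f s - f t) / (s - t) * g s + f t * ((g s - g t) / (s - t))).
rewrite mulrAC mulrA -mulrDl.
by rewrite mulrBl mulrBr addrA subrK.
Unshelve. all: by end_near. Qed.

Lemma is_deriveE f t l : is_derive t (1 : R) f l <-> hasd setT f t l.
Proof.
have aux : (h^-1 *: ((f \o shift t) (h *: (1 : R)) - f t) @[h --> 0^'] --> l) <->
    hasd setT f t l.
  split.
    move=> /cvgrPdist_le h e e0.
    have /nbhs_ballP[d /= d0 hd] : \forall u \near (0 : R), u != 0 ->
      `|l - u^-1 *: (f (u *: (1 : R) + t) - f t)| <= e by exact: (h e e0).
    apply/nbhs_ballP; exists d => //= s std _; have [->|st] := eqVneq s t.
      by rewrite !subrr mulr0 subr0 normr0 mulr0.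
    have st0 : s - t != 0 by rewrite subr_eq0.
    have : `|l - (s - t)^-1 *: (f s - f t)| <= e.
      have := hd (s - t); rewrite scaler1 subrK; apply => //.
      by rewrite /ball/= sub0r normrN distrC.
    rewrite -ler_pdivrMr ?normr_gt0// -normfV -normrM mulrBl mulfK// distrC.
    by rewrite /GRing.scale/= mulrC.
  move=> h; apply/cvgrPdist_le => e e0.
  have /nbhs_ballP[d /= d0 hd] := h e e0.
  suff h2 : \forall u \near (0 : R), u != 0 ->
      `|l - u^-1 *: (f (u *: (1 : R) + t) - f t)| <= e by exact: h2.
  apply/nbhs_ballP; exists d => //= s std s0.
  have : `|f (s + t) - f t - l * s| <= e * `|s|.
    have := hd (s + t); rewrite addrK; apply => //.
    by move: std; rewrite /ball/= sub0r opprD addrC subrK.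
  rewrite -ler_pdivrMr ?normr_gt0// -normfV -normrM mulrBl mulfK// distrC.
  by rewrite /GRing.scale/= mulrC mulr1.
split.
  by case=> d e; apply/aux; rewrite -e; exact: d.
move=> /aux h; split; first by apply/cvg_ex; exists l.
exact/cvg_lim.
Qed.

Lemma FTC2_hasd a b f F : a <= b -> continuous f ->
  (forall x, a <= x <= b -> hasd `[a, b] F x (f x)) ->
  itg a b f = F b - F a.
Proof.
move=> ab cf h; apply: FTC2_itg => //.
  by move=> x /h; exact: hasd_cvg.
move=> x /andP[ax xb]; apply/is_deriveE.
have axb : a <= x <= b by rewrite !ltW.
apply: hasd_near (h x axb) => //; near=> s => _; split => //.
rewrite /= in_itv/=; apply/andP; split; apply: ltW; near: s.
- exact: lt_nbhsr.
- exact: lt_nbhsl.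
Unshelve. all: by end_near. Qed.

Lemma FTC1_hasd a b f x : continuous f -> a <= x <= b ->
  hasd `[a, b] (itg a ^~ f) x (f x).
Proof.
move=> cf /andP[ax xb].
(* The base point [a - 1] makes [x = a] an interior point; the two primitives differ by a constant
   on [[a, b]]. *)
have := FTC1_itg cf (_ : a - 1 < x); rewrite (lt_le_trans _ ax) ?gtrBl// => /(_ isT).
move=> /is_deriveE/(@hasdS _ `[a, b]) => /(_ (@subsetT _ _)).
move=> /hasdB/(_ (hasd_cst `[a, b] (itg (a - 1) a f) x)); rewrite subr0.
have e s : a <= s -> itg (a - 1) s f - itg (a - 1) a f = itg a s f.
  by move=> as'; rewrite (@itg_split _ (a - 1) s a)// ?gerBl// addrC addKr.
apply: hasd_near; last by rewrite e.
near=> s => sab; split => //.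
by move: sab; rewrite /= in_itv/= => /andP[as' _]; rewrite e.
Unshelve. all: by end_near. Qed.

Lemma hasd_norm_le a b F (F' : R -> R) (k : R) : 0 <= k ->
  (forall x, a <= x <= b -> hasd `[a, b] F x (F' x)) ->
  (forall x, a <= x <= b -> `|F' x| <= k) ->
  forall x y, a <= x -> x <= y -> y <= b -> `|F y - F x| <= k * (y - x).
Proof.
move=> k0 h hk x y ax; rewrite le_eqVlt => /predU1P[<- _|xy yb].
  by rewrite !subrr normr0 mulr0.
have [|||c] := @MVT R F F' x y _ _ _.
- exact: xy.
- move=> z; rewrite in_itv/= => /andP[xz zy].
  have azb : a <= z <= b.
    by rewrite (le_trans ax (ltW xz)) (le_trans (ltW zy) yb).
  apply/is_deriveE; apply: hasd_near (h z azb) => //; near=> s => _; split => //.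
  rewrite /= in_itv/=; apply/andP; split.
    by apply: (le_trans ax); apply: ltW; near: s; exact: lt_nbhsr.
  by apply: (le_trans _ yb); apply: ltW; near: s; exact: lt_nbhsl.
- apply/subspace_continuousP => z /=; rewrite in_itv/= => /andP[xz zy].
  have azb : a <= z <= b by rewrite (le_trans ax xz) (le_trans zy yb).
  have := hasd_cvg (h z azb); apply: cvg_trans; apply: cvg_app.
  apply: within_subset => s /=; rewrite !in_itv/= => /andP[xs sy].
  by rewrite (le_trans ax xs) (le_trans sy yb).
rewrite in_itv/= => /andP[xc cy] ->.
rewrite normrM [X in _ * X]ger0_norm ?subr_ge0 ?(ltW xy)//.
rewrite ler_wpM2r ?subr_ge0 ?(ltW xy)//; apply: hk.
by rewrite (le_trans ax (ltW xc)) (le_trans (ltW cy) yb).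
Unshelve. all: by end_near. Qed.

End Hasd.

(** * Integrals depending on a parameter *)

Section Param.
Context {R : realType}.

(** Joint convergence near each point [y] gives a uniform bound on a neighbourhood of [y];
    compactness of [[a, b]], in its near-covering form, makes it uniform on the whole interval. *)
Lemma near_uniform_itv (I : Type) (F : set_system I) {FF : Filter F}
    (f : I -> R -> R) (g : R -> R) a b :
  (forall y, a <= y <= b ->
     f p.1 p.2 @[p --> (F, nbhs y)] --> g y) ->
  continuous g -> forall e, 0 < e ->
  \forall i \near F, forall y, a <= y <= b -> `|f i y - g y| <= e.
Proof.
move=> h cg e e0.
have /compact_near_coveringP/(_ I F (fun i y => `|f i y - g y| <= e) FF) :=
  @segment_compact R a b.
rewrite /=; move=> H; have {H} : \near F, `[a, b] `<=` (fun y => `|f F y - g y| <= e).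
  apply: H => y; rewrite /= in_itv/= => yab.
  have e20 : 0 < e / 2 by rewrite divr_gt0.
  have /cvgrPdist_le/(_ _ e20)[[U V]/= [FU FV] UV] := h y yab.
  have /cvgrPdist_le/(_ _ e20) cgy := cg y.
  exists (V `&` [set y' | `|g y - g y'| <= e / 2], U).
    by split => //; apply: filterI.
  move=> [y' i] /= [[Vy' gy'] Ui].
  have := UV (i, y') (conj Ui Vy'); rewrite /= distrC => fi.
  rewrite -[f i y'](subrK (g y)) -addrA (le_trans (ler_normD _ _))//.
  by rewrite [e]splitr lerD.
by apply: filterS => i hi y yab; apply: hi; rewrite /= in_itv.
Qed.

Lemma cvg_itg (I : Type) (F : set_system I) {FF : Filter F}
    (f : I -> R -> R) (g : R -> R) a b : a <= b ->
  (forall i, continuous (f i)) ->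
  (forall y, a <= y <= b ->
     f p.1 p.2 @[p --> (F, nbhs y)] --> g y) ->
  continuous g -> itg a b (f i) @[i --> F] --> itg a b g.
Proof.
move=> ab cf h cg; apply/cvgrPdist_le => e e0.
have e'0 : 0 < e / (b - a + 1) by rewrite divr_gt0// ltr_wpDl// subr_ge0.
have H := near_uniform_itv h cg e'0; have {}H := H FF; near=> i.
have hi : forall y, a <= y <= b -> `|f i y - g y| <= e / (b - a + 1) by near: i.
rewrite -itgB//; apply: (@le_trans _ _ ((b - a) * (e / (b - a + 1)))).
  apply: norm_itg_le => //; first by move=> x; apply: cvgB; [exact: cg|exact: cf].
  by move=> y yab; rewrite distrC; exact: hi.
rewrite mulrCA ger_pMr// ler_pdivrMr ?mul1r ?lerDl//.
by rewrite ltr_wpDl// subr_ge0.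
Unshelve. all: by end_near. Qed.

Lemma continuous_curry1 (X : topologicalType) (Y : topologicalType) (Z : topologicalType)
  (f : X -> Y -> Z) : continuous (fun p => f p.1 p.2) -> forall x, continuous (f x).
Proof.
move=> cf x y; apply: (@continuous_comp _ _ _ (fun y => (x, y)) (fun p => f p.1 p.2)).
  by apply: cvg_pair => //=; exact: cvg_cst.
exact: cf.
Qed.

Lemma continuous_curry2 (X : topologicalType) (Y : topologicalType) (Z : topologicalType)
  (f : X -> Y -> Z) : continuous (fun p => f p.1 p.2) -> forall y, continuous (f ^~ y).
Proof.
move=> cf y x; apply: (@continuous_comp _ _ _ (fun x => (x, y)) (fun p => f p.1 p.2)).
  by apply: cvg_pair => //=; exact: cvg_cst.
exact: cf.
Qed.

Lemma continuous_itg_param (X : topologicalType) (f : X -> R -> R) a b : a <= b ->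
  continuous (fun p => f p.1 p.2) -> continuous (fun x => itg a b (f x)).
Proof.
move=> ab cf x; apply: cvg_itg => //.
- by move=> i; exact: continuous_curry1.
- by move=> y _; exact: (cf (x, y)).
- exact: continuous_curry1.
Qed.

(** The order of integration is exchanged through the fundamental theorem: [G], defined with the
    inner integral in [x], has derivative [itg c d (f x)], because [f s] is uniformly close to [f x]
    on [[c, d]] for [s] near [x]. *)
Lemma itg_Fubini (f : R -> R -> R) a b c d : a <= b -> c <= d ->
  continuous (fun p => f p.1 p.2) ->
  itg a b (fun x => itg c d (f x)) = itg c d (fun y => itg a b (f ^~ y)).
Proof.
move=> ab cd cf.
have cf1 := continuous_curry1 cf; have cf2 := continuous_curry2 cf.
have cfs : continuous (fun p => f p.2 p.1).
  move=> p; apply: (@continuous_comp _ _ _ (fun p => (p.2, p.1)) (fun p => f p.1 p.2)).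
    by apply: (@cvg_pair _ _ _ _ (nbhs p.2) (nbhs p.1)); [exact: cvg_snd|exact: cvg_fst].
  exact: cf.
pose G x := itg c d (fun y => itg (a - 1) x (f ^~ y)).
have cI x : a <= x -> continuous (fun y => itg (a - 1) x (f ^~ y)).
  move=> ax; apply: continuous_itg_param; last exact: cfs.
  by rewrite (le_trans _ ax)// gerBl.
have cJ x y : x <= y -> continuous (fun z => itg x y (f ^~ z)).
  by move=> xy; apply: continuous_itg_param.
rewrite (@FTC2_hasd _ a b _ G)//.
- rewrite /G -itgB; [|exact: cI|exact: cI].
  apply: eq_itg => y _.
  by rewrite (@itg_split _ (a - 1) b a)// ?gerBl// addrC addKr.
- exact: continuous_itg_param.
move=> x /andP[ax xb] e e0.
have e'0 : 0 < e / (d - c + 1) by rewrite divr_gt0// ltr_wpDl// subr_ge0.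
have := @near_uniform_itv R (nbhs x) _ f (f x) c d _ (cf1 x) _ e'0.
move=> /(_ _ (fun y _ => cf (x, y)))/nbhs_ballP[r /= r0 hr].
near=> s; rewrite /= in_itv/= => /andP[as' sb].
have sx : ball x r s by near: s; exact: nbhsx_ballx.
have dG u v : a <= u -> u <= v ->
    G v - G u = itg c d (fun y => itg u v (f ^~ y)).
  move=> au uv; rewrite /G -itgB; [|by apply: cI; exact: le_trans uv|exact: cI].
  apply: eq_itg => y _.
  have a1u : a - 1 <= u by rewrite (le_trans _ au)// gerBl.
  by rewrite (@itg_split _ (a - 1) v u)// addrC addKr.
(* Stated for any interval [[u, v]] near [x], so that it serves for [s] on either side of [x]. *)
have key u v : a <= u -> u <= v -> (forall z, u <= z <= v -> ball x r z) ->
    `|G v - G u - itg c d (f x) * (v - u)| <= e * `|v - u|.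
  move=> au uv uvr; rewrite dG// mulrC -itgZ// -itgB; last 2 first.
    exact: cJ.
    by move=> z; apply: cvgM; [exact: cvg_cst|exact: cf1].
  rewrite (@le_trans _ _ ((d - c) * (`|v - u| * (e / (d - c + 1)))))//; last first.
    rewrite mulrCA [leRHS]mulrC ler_wpM2l// mulrCA ger_pMr//.
    by rewrite ler_pdivrMr ?mul1r ?lerDl// ltr_wpDl// subr_ge0.
  apply: norm_itg_le => //.
    move=> z; apply: cvgB; first exact: cJ.
    by apply: cvgM; [exact: cvg_cst|exact: cf1].
  move=> y ycd; rewrite -itg_cst// -itgB//; last by move=> z; exact: cvg_cst.
  rewrite [`|v - u|]ger0_norm ?subr_ge0//; apply: norm_itg_le => //.
    by move=> z; apply: cvgB; [exact: cf2|exact: cvg_cst].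
  by move=> z zuv; apply: hr => //; exact: uvr.
have [xs|sx'] := leP x s.
  apply: key => // z /andP[xz zs]; apply: le_lt_trans sx.
  by rewrite distrC [leRHS]distrC !ger0_norm ?subr_ge0// lerB.
rewrite -normrN [X in _ <= _ * X]distrC opprD opprB -mulrN opprB.
apply: key => //; first exact: ltW.
move=> z /andP[sz zx]; apply: le_lt_trans sx.
by rewrite !ger0_norm ?subr_ge0// ?(ltW sx')// lerB.
Unshelve. all: by end_near. Qed.

End Param.

Section Cts.
Context {R : realType} {X : topologicalType}.
Implicit Types f g : X -> R.

Lemma cts_cst (k : R) : continuous (fun _ : X => k).
Proof. by move=> x; exact: cvg_cst. Qed.

Lemma ctsD f g : continuous f -> continuous g -> continuous (fun x => f x + g x).
Proof. by move=> cf cg x; apply: cvgD; [exact: cf|exact: cg]. Qed.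

Lemma ctsN f : continuous f -> continuous (fun x => - f x).
Proof. by move=> cf x; apply: cvgN; exact: cf. Qed.

Lemma ctsB f g : continuous f -> continuous g -> continuous (fun x => f x - g x).
Proof. by move=> cf cg; apply: ctsD => //; exact: ctsN. Qed.

Lemma ctsM f g : continuous f -> continuous g -> continuous (fun x => f x * g x).
Proof. by move=> cf cg x; apply: cvgM; [exact: cf|exact: cg]. Qed.

Lemma ctsX f k : continuous f -> continuous (fun x => f x ^+ k).
Proof.
move=> cf; elim: k => [|k IH]; first exact: cts_cst.
have -> : (fun x => f x ^+ k.+1) = (fun x => f x * f x ^+ k).
  by apply/funext => x; rewrite exprS.
exact: ctsM.
Qed.

Lemma cts_norm f : continuous f -> continuous (fun x => `|f x|).
Proof. by move=> cf x; apply: (@continuous_comp _ _ _ f); [exact: cf|exact: norm_continuous]. Qed.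

Lemma cts_sum I (r : seq I) (F : I -> X -> R) : (forall i, continuous (F i)) ->
  continuous (fun x => \sum_(i <- r) F i x).
Proof.
move=> cF; elim: r => [|i r IH].
  have -> : (fun x => \sum_(i <- [::]) F i x) = (fun=> 0) :> (X -> R).
    by apply/funext => x; rewrite big_nil.
  exact: cts_cst.
have -> : (fun x => \sum_(j <- i :: r) F j x) = (fun x => F i x + \sum_(j <- r) F j x).
  by apply/funext => x; rewrite big_cons.
by apply: ctsD => //; exact: cF.
Qed.

Lemma cts_max f g : continuous f -> continuous g ->
  continuous (fun x => Num.max (f x) (g x)).
Proof. by move=> cf cg x; apply: continuous_max; [exact: cf|exact: cg]. Qed.

Lemma cts_min f g : continuous f -> continuous g ->
  continuous (fun x => Num.min (f x) (g x)).
Proof. by move=> cf cg x; apply: continuous_min; [exact: cf|exact: cg]. Qed.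

End Cts.

Lemma cts_id (X : topologicalType) : continuous (@id X).
Proof. by move=> x; exact: cvg_id. Qed.

Lemma cts_comp (X Y Z : topologicalType) (f : X -> Y) (g : Y -> Z) :
  continuous f -> continuous g -> continuous (fun x => g (f x)).
Proof. by move=> cf cg x; apply: continuous_comp; [exact: cf|exact: cg]. Qed.

Lemma cts_fst (X Y : topologicalType) : continuous (@fst X Y).
Proof. by move=> [x y]; exact: cvg_fst. Qed.

Lemma cts_snd (X Y : topologicalType) : continuous (@snd X Y).
Proof. by move=> [x y]; exact: cvg_snd. Qed.

Lemma cts_comp2 (X Y Z W : topologicalType) (H : Y -> Z -> W) (u : X -> Y) (v : X -> Z) :
  continuous (fun p => H p.1 p.2) -> continuous u -> continuous v ->
  continuous (fun x => H (u x) (v x)).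
Proof.
move=> cH cu cv x.
apply: (@continuous_comp _ _ _ (fun x => (u x, v x)) (fun p => H p.1 p.2)).
  by apply: (@cvg_pair _ _ _ _ (nbhs (u x)) (nbhs (v x))); [exact: cu|exact: cv].
exact: cH.
Qed.

(** * Moments in time *)

Section Moments.
Context {R : realType}.

Lemma itg0 a b (f : R -> R) : (forall x, a <= x <= b -> f x = 0) -> itg a b f = 0.
Proof.
move=> f0; have [ba|ab] := ltP b a; first by rewrite itg_gt.
rewrite (@eq_itg _ a b _ (fun=> 0))//.
by rewrite itg_cst// mulr0.
Qed.

(** Integrate the hypothesis against [t0 ^+ k] over [[- L, T]], exchange the integrals and
    substitute [s = t0 + t]. For [0 <= t <= L] the variable [s] runs over an interval that contains
    [[0, T]], and [H] vanishes off [[0, T]]. *)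
Lemma moments_of_rays (H : R -> R -> R) (T L : R) : 0 <= T -> 0 <= L ->
  continuous (fun p => H p.1 p.2) ->
  (forall s t, s <= 0 \/ T <= s -> H s t = 0) ->
  (forall t0, itg 0 L (fun t => H (t0 + t) t) = 0) ->
  forall k, itg 0 L (fun t => itg 0 T (fun s => (s - t) ^+ k * H s t)) = 0.
Proof.
move=> T0 L0 cH H0 hH k.
have c1 : continuous (fun p : R * R => p.1 ^+ k * H (p.1 + p.2) p.2).
  apply: ctsM; first exact/ctsX/cts_fst.
  apply: (cts_comp2 cH); last exact: cts_snd.
  by apply: ctsD; [exact: cts_fst|exact: cts_snd].
have c2 t0 : continuous (fun t => H (t0 + t) t).
  apply: (cts_comp2 cH); last exact: cts_id.
  by apply: ctsD; [exact: cts_cst|exact: cts_id].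
have LT : - L <= T by rewrite (le_trans _ T0)// oppr_le0.
transitivity (itg (- L) T (fun t0 => itg 0 L (fun t => t0 ^+ k * H (t0 + t) t))); last first.
  by apply: itg0 => t0 _; rewrite itgZ// hH mulr0.
rewrite [RHS]itg_Fubini//; apply: eq_itg => t /andP[t0 tL].
pose g s := (s - t) ^+ k * H s t.
have cg : continuous g.
  apply: ctsM; last exact: (continuous_curry2 cH).
  by apply: ctsX; apply: ctsB; [exact: cts_id|exact: cts_cst].
rewrite -/g (@eq_itg _ (- L) T _ (fun x => g (x + t))); last first.
  by move=> x _; rewrite /g addrK.
rewrite itg_translate//.
have Lt : - L + t <= 0 by rewrite addrC subr_le0.
have Tt : T <= T + t by rewrite lerDl.
rewrite (@itg_split _ (- L + t) (T + t) 0)//; last by rewrite addr_ge0.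
rewrite [X in _ = X + _]itg0; last first.
  by move=> x /andP[_ x0]; rewrite /g H0 ?mulr0//; left.
rewrite add0r (@itg_split _ 0 (T + t) T)//.
rewrite [X in _ = _ + X]itg0 ?addr0//.
by move=> x /andP[Tx _]; rewrite /g H0 ?mulr0//; right.
Qed.

Lemma poly_continuous (p : {poly R}) : continuous (fun x => p.[x]).
Proof.
elim/poly_ind: p => [|p c IH].
  have -> : (fun x => (0 : {poly R}).[x]) = (fun=> 0) :> (R -> R).
    by apply/funext => x; rewrite horner0.
  exact: cts_cst.
have -> : (fun x => (p * 'X + c%:P).[x]) = (fun x => p.[x] * x + c).
  by apply/funext => x; rewrite hornerMXaddC.
apply: ctsD; last exact: cts_cst.
by apply: ctsM => //; exact: cts_id.
Qed.

Lemma itg_poly_eq0 (T : R) (f : R -> R) (p : {poly R}) : continuous f ->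
  (forall k, itg 0 T (fun t => t ^+ k * f t) = 0) ->
  itg 0 T (fun t => p.[t] * f t) = 0.
Proof.
elim/poly_ind: p f => [|p c IH] f cf h.
  by apply: itg0 => x _; rewrite horner0 mul0r.
have cp := @poly_continuous p.
have cXf : continuous (fun t : R => t * f t) by apply: ctsM => //; exact: cts_id.
rewrite (@eq_itg _ 0 T _ (fun t => p.[t] * (t * f t) + c * f t)); last first.
  by move=> x _; rewrite hornerMXaddC mulrDl mulrA.
rewrite itgD; [|exact: ctsM|by apply: ctsM => //; exact: cts_cst].
rewrite IH//; last first.
  by move=> k; rewrite -[RHS](h k.+1); apply: eq_itg => x _; rewrite exprSr mulrA.
rewrite add0r itgZ//; have := h 0%N.
rewrite (@eq_itg _ 0 T _ f) => [->|x _]; first by rewrite mulr0.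
by rewrite expr0 mul1r.
Qed.

(** If [f t0 > 0], the integral of [p ^+ m * f] near [t0] grows geometrically with [m], while the
    rest of [[0, T]] contributes at least a fixed negative constant. The total could then not be 0
    for every [m]. *)
Lemma moments_inj_pos (T : R) (f : R -> R) : 0 < T -> continuous f ->
  (forall k, itg 0 T (fun t => t ^+ k * f t) = 0) ->
  forall t0 : R, 0 <= t0 <= T -> f t0 <= 0.
Proof.
move=> T0 cf h t0 t0T; rewrite leNgt; apply/negP => ft0.
pose d := f t0 / 2.
have d0 : 0 < d by rewrite divr_gt0.
have /cvgrPdist_lt/(_ _ d0)/nbhs_ballP[eta /= eta0 heta] := cf t0.
have fd x : `|x - t0| < eta -> d <= f x.
  move=> xt; have := heta x; rewrite /ball/= distrC => /(_ xt) hx.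
  rewrite -[f x](subKr (f t0)) lerBrDr (le_trans (lerD (lexx d) (ler_norm _)))//.
  by rewrite [leRHS](splitr (f t0)) lerD2l ltW.
have T2 : 0 < T ^+ 2 by rewrite exprn_gt0.
(* p > 1 near t0 and |p| <= 1 elsewhere on [0, T], so that the powers of p concentrate at t0. *)
pose p : {poly R} := (1 + eta ^+ 2 / 2 / T ^+ 2)%:P - (T ^- 2) *: ('X - t0%:P) ^+ 2.
have pE x : p.[x] = 1 + (eta ^+ 2 / 2 - (x - t0) ^+ 2) / T ^+ 2.
  rewrite /p !(hornerE, horner_exp)/=; field.
  by rewrite gt_eqF.
(* [1 + a] is the value of [p] at distance [eta / 2] from [t0]. *)
pose a := eta ^+ 2 / 4 / T ^+ 2.
have a0 : 0 < a by rewrite !divr_gt0// exprn_gt0.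
have p_ge0 (x : R) : 0 <= x <= T -> 0 <= p.[x].
  move=> /andP[x0 xT]; rewrite pE.
  have : (x - t0) ^+ 2 <= T ^+ 2.
    move: t0T => /andP[t00 tT].
    have : 0 <= (T - (x - t0)) * (T + (x - t0)) by apply: mulr_ge0; lra.
    by rewrite -subr_sqr subr_ge0.
  move=> hx; rewrite mulrBl addrCA addr_ge0//.
    by rewrite !divr_ge0// ?exprn_ge0// ltW.
  by rewrite subr_ge0 ler_pdivrMr// mul1r.
have p_le1 (x : R) : 0 <= x <= T -> eta <= `|x - t0| -> p.[x] <= 1.
  move=> _ hx; rewrite pE gerDl pmulr_lle0 ?invr_gt0// subr_le0.
  have : eta ^+ 2 <= (x - t0) ^+ 2.
    by rewrite -[leRHS]real_normK ?num_real// ler_sqr ?nnegrE// ltW.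
  have := sqr_ge0 eta; lra.
have p_ge x : `|x - t0| <= eta / 2 -> 1 + a <= p.[x].
  move=> hx; rewrite pE lerD2l ler_pM2r ?invr_gt0//.
  have : (x - t0) ^+ 2 <= (eta / 2) ^+ 2.
    by rewrite -[leLHS]real_normK ?num_real// ler_sqr ?nnegrE// divr_ge0// ltW.
  rewrite expr_div_n; lra.
have cN : continuous (fun x => `|f x|) by exact: cts_norm.
have [c _ hc] := EVT_max (ltW T0) (continuous_subspaceT cN).
pose C : R := `|f c|.
have hC (x : R) : 0 <= x <= T -> `|f x| <= C by move=> xT; apply: hc; rewrite in_itv.
have C0 : 0 <= C by rewrite normr_ge0.
have lb m (x : R) : 0 <= x <= T -> - C <= (p ^+ m).[x] * f x.
  move=> xT; rewrite horner_exp; have [xe|xe] := ltP `|x - t0| eta.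
    apply: (@le_trans _ _ 0); first by rewrite oppr_le0.
    by rewrite mulr_ge0// ?exprn_ge0 ?p_ge0// (le_trans (ltW d0))// fd.
  have : `|p.[x] ^+ m * f x| <= C.
    rewrite normrM -[leRHS]mul1r ler_pM//; last exact: hC.
    rewrite normrX ger0_norm ?p_ge0// exprn_ile1//; first exact: p_ge0.
    exact: p_le1.
  by rewrite ler_norml => /andP[].
(* [[l, r]] is the part of [[0, T]] within [eta / 2] of [t0]; it is nondegenerate even when [t0] is
   0 or [T]. *)
pose l : R := Num.max 0 (t0 - eta / 2).
pose r := Num.min T (t0 + eta / 2).
have e2 : 0 < eta / 2 by rewrite divr_gt0.
have l0 : 0 <= l by rewrite le_max lexx.
have rT : r <= T by rewrite ge_min lexx.
move/andP: (t0T) => [t00 t0T'].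
have lr : l < r.
  by rewrite /l /r gt_max !lt_min; apply/andP; split; apply/andP; split; lra.
have lt0 : l <= T by exact: le_trans (ltW lr) rT.
have in_lr (x : R) : l <= x <= r -> 0 <= x <= T /\ `|x - t0| <= eta / 2.
  rewrite /l /r ge_max le_min => /andP[/andP[x0 xl] /andP[xT xr]].
  by rewrite x0 xT; split => //; rewrite ler_distl; apply/andP; split; lra.
(* The three integrals over [[0, l]], [[l, r]], [[r, T]] add up to 0, and by [lb] the outer ones are
   bounded below independently of [m]. *)
have key m : (r - l) * ((1 + a) ^+ m * d) <= 2 * T * C.
  have cpm : continuous (fun x => (p ^+ m).[x] * f x).
    by apply: ctsM => //; exact: poly_continuous.
  have lr' := ltW lr.
  have := itg_poly_eq0 (p ^+ m) cf h.
  rewrite (@itg_split _ 0 T l)// (@itg_split _ l T r)//.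
  have h1 : (l - 0) * - C <= itg 0 l (fun x => (p ^+ m).[x] * f x).
    rewrite -itg_cst//; apply: le_itg => //; first exact: cts_cst.
    by move=> x /andP[x0 xl]; apply: lb; rewrite x0 (le_trans xl).
  have h2 : (T - r) * - C <= itg r T (fun x => (p ^+ m).[x] * f x).
    rewrite -itg_cst//; apply: le_itg => //; first exact: cts_cst.
    move=> x /andP[rx xT]; apply: lb; rewrite xT andbT.
    by rewrite (le_trans l0)// (le_trans (ltW lr)).
  have h3 : (r - l) * ((1 + a) ^+ m * d) <= itg l r (fun x => (p ^+ m).[x] * f x).
    rewrite -itg_cst; last exact: ltW.
    apply: le_itg => //; first exact: cts_cst.
    move=> x /in_lr[xT xt]; rewrite horner_exp ler_pM//.
    - by rewrite exprn_ge0// addr_ge0// ltW.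
    - exact: ltW.
    - by rewrite lerXn2r ?nnegrE ?p_ge0 ?p_ge// addr_ge0// ltW.
    - by apply: fd; apply: (le_lt_trans xt); rewrite ltr_pdivrMr// ltr_pMr// ltr1n.
  have h4 : 0 <= r * C by rewrite mulr_ge0// (le_trans l0)// ltW.
  have h5 : l * C <= T * C by rewrite ler_wpM2r.
  move: h1 h2 h3 h4 h5; set I1 := itg 0 l _; set I2 := itg r T _; set I3 := itg l r _.
  set K := (r - l) * _; clearbody I1 I2 I3 K => h1 h2 h3 h4 h5 h6; lra.
have rld : 0 < (r - l) * d by rewrite mulr_gt0// subr_gt0.
(* Bernoulli's inequality makes the left side of [key] unbounded in [m]. *)
have bern m : 1 + m%:R * a <= (1 + a) ^+ m.
  elim: m => [|m IH]; first by rewrite mul0r addr0 expr0.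
  rewrite exprS (@le_trans _ _ ((1 + a) * (1 + m%:R * a)))//; last first.
    by rewrite ler_wpM2l// addr_ge0// ltW.
  have a0' := ltW a0.
  have : 0 <= a * (m%:R * a) by rewrite mulr_ge0// mulr_ge0.
  rewrite -natr1; clearbody a; move: (m%:R) => k hk; lra.
have [m hm] : exists m : nat, 2 * T * C / ((r - l) * d) / a < m%:R.
  exists (Num.truncn (2 * T * C / ((r - l) * d) / a)).+1.
  exact: truncnS_gt.
have := key m; apply/negP; rewrite -ltNge.
rewrite ltr_pdivrMr// ltr_pdivrMr// in hm.
apply: (lt_le_trans hm).
rewrite [leRHS]mulrCA ler_wpM2r ?(ltW rld)//.
by rewrite (le_trans _ (bern m))// lerDr.
Qed.

Lemma moments_inj (T : R) (f : R -> R) : 0 < T -> continuous f ->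
  (forall k, itg 0 T (fun t => t ^+ k * f t) = 0) ->
  forall t, 0 <= t <= T -> f t = 0.
Proof.
move=> T0 cf h t tT; apply/le_anti/andP; split; first exact: moments_inj_pos h t tT.
rewrite -oppr_le0; apply: (moments_inj_pos T0 (ctsN cf) _ tT) => k.
rewrite (@eq_itg _ 0 T _ (fun t => (-1) * (t ^+ k * f t))); last first.
  by move=> x _; rewrite mulrN mulN1r.
rewrite itgZ ?h ?mulr0//; apply: ctsM => //; exact/ctsX/cts_id.
Qed.

End Moments.

(** * Partial derivatives on subsets of R^d *)

Section RowVec.
Context {R : realType} {d : nat}.
Implicit Types (z y w : 'rV[R]_d) (i : 'I_d) (h r : R) (S : set 'rV[R]_d).

Lemma ball_rVP z r y : 0 < r -> ball z r y <-> forall i, `|z 0 i - y 0 i| < r.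
Proof.
move=> r0; split=> [h i|h]; first by case: h => _ /(_ 0 i).
by split => // i j; rewrite (ord1 i); exact: h.
Qed.

Lemma near_all (X : topologicalType) (I : finType) (t : X) (P : I -> X -> Prop) :
  (forall a, \forall s \near t, P a s) -> \forall s \near t, forall a, P a s.
Proof. by move=> h; exact: (filter_forall _ h). Qed.

Lemma cvg_rV T (F : set_system T) {FF : Filter F} (f : T -> 'rV[R]_d) z :
  (forall i, f x 0 i @[x --> F] --> z 0 i) -> f x @[x --> F] --> z.
Proof.
move=> h; apply/cvg_ballP => e e0.
have H : \forall x \near F, forall i, `|z 0 i - f x 0 i| < e.
  by apply: filter_forall => i; have /cvgrPdist_lt/(_ _ e0) := h i.
by apply: filterS H => x hx; apply/ball_rVP.
Qed.

Lemma cts_coord i : continuous (fun z => z 0 i).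
Proof. by move=> z; apply: coord_continuous. Qed.

Lemma cts_rV (X : topologicalType) (f : X -> 'rV[R]_d) :
  (forall i, continuous (fun x => f x 0 i)) -> continuous f.
Proof. by move=> h x; apply: cvg_rV => i; exact: h. Qed.

Lemma lineE z i h j : line z i h 0 j = if j == i then z 0 j + h else z 0 j.
Proof.
rewrite /line !mxE eqxx/=; case: eqP => [->|_]; first by rewrite mulr1.
by rewrite mulr0 addr0.
Qed.

Lemma line0 z i : line z i 0 = z.
Proof. by rewrite /line scale0r addr0. Qed.

Lemma lineD z i h r : line (line z i h) i r = line z i (h + r).
Proof. by rewrite /line -addrA -scalerDl. Qed.

Lemma cts_line (X : topologicalType) (f : X -> 'rV[R]_d) (g : X -> R) i :
  continuous f -> continuous g -> continuous (fun x => line (f x) i (g x)).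
Proof.
move=> cf cg; apply: cts_rV => j.
have cfj : continuous (fun x => f x 0 j) := cts_comp cf (@cts_coord j).
have -> : (fun x => line (f x) i (g x) 0 j) = (fun x => f x 0 j + (if j == i then g x else 0)).
  by apply/funext => x; rewrite lineE; case: ifP => _; rewrite ?addr0.
by apply: ctsD => //; case: (j == i) => //; exact: cts_cst.
Qed.

Definition pd S (f : 'rV[R]_d -> R) z i l :=
  hasd [set h | S (line z i h)] (fun h => f (line z i h)) 0 l.

Lemma pderivable_pd S f z i : pderivable S f z i -> pd S f z i (pderive S f z i).
Proof. exact: derivable_in_hasd. Qed.

Lemma pd_pderivable S f z i l : pd S f z i l -> pderivable S f z i.
Proof. exact: hasd_derivable_in. Qed.

(** No point of [S] is isolated on its coordinate lines inside [S], so that derivatives within [S]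
    are unique and the [lim] behind [pderive] takes the expected value. *)
Definition has_lines S := forall z i, S z ->
  ProperFilter (within [set h | S (line z i h)] (0 : R)^').

Lemma pd_pderive S f z i l : has_lines S -> S z -> pd S f z i l -> pderive S f z i = l.
Proof. by move=> hS Sz; apply: hasd_derive_in; exact: hS. Qed.

Lemma near_line z i (P : set 'rV[R]_d) : nbhs z P -> \forall h \near (0 : R), P (line z i h).
Proof.
move=> zP; have : continuous (fun h => line z i h).
  by apply: cts_line; [move=> x; exact: cvg_cst|exact: cts_id].
by move=> /(_ 0); rewrite /continuous_at line0; exact.
Qed.

Lemma pd_near S S' f g z i l : (\forall y \near z, S' y -> S y /\ f y = g y) ->
  S' z -> pd S f z i l -> pd S' g z i l.
Proof.
move=> h Sz; apply: hasd_near; first exact: (near_line i h).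
by rewrite line0; case: (nbhs_singleton h Sz).
Qed.

Lemma eq_pd S f g z i l : (forall y, S y -> f y = g y) -> S z -> pd S f z i l -> pd S g z i l.
Proof.
by move=> h Sz; apply: pd_near => //; near=> y => Sy; split => //; exact: h.
Unshelve. all: by end_near. Qed.

Lemma eq_Ck k S f g : has_lines S -> (forall y, S y -> f y = g y) -> Ck k S f -> Ck k S g.
Proof.
move=> hS; elim: k f g => [|k IH] f g fg /= [cf hf]; (split;
  first by apply: subspace_eq_continuous cf => y; rewrite inE => /fg).
  by [].
move=> i; have [hi Ci] := hf i; split.
  by move=> z Sz; apply: pd_pderivable (eq_pd fg Sz (pderivable_pd (hi z Sz))).
apply: IH Ci => z Sz; apply/esym; apply: pd_pderive => //.
exact: eq_pd fg Sz (pderivable_pd (hi z Sz)).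
Qed.

Lemma Ck_cvg k S f z : Ck k S f -> S z -> f y @[y --> within S (nbhs z)] --> f z.
Proof. by case: k => [|k] [/subspace_continuousP cf _] Sz; exact: cf. Qed.

Lemma Ck_pd k S f z i : Ck k.+1 S f -> S z -> pd S f z i (pderive S f z i).
Proof. by move=> [_ h] Sz; apply: pderivable_pd; apply (h i).1. Qed.

Lemma Ck_pderive k S f i : Ck k.+1 S f -> Ck k S (fun z => pderive S f z i).
Proof. by move=> [_ h]; apply (h i).2. Qed.

Lemma CkW k S f : Ck k.+1 S f -> Ck k S f.
Proof.
elim: k f => [|k IH] f; first by move=> [? _].
move=> [cf h]; split => // i; split; first by case: (h i).
by apply: IH; case: (h i).
Qed.

(** A substitute for openness that also holds at boundary points of a half-space: the coordinate box
    spanned by [z] and a nearby point of [S] stays in [S], hence so do the staircase paths between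
    them. *)
Definition locally_box S := forall z, S z -> exists2 r, 0 < r &
  forall y, S y -> ball z r y ->
  forall w, (forall i, Num.min (z 0 i) (y 0 i) <= w 0 i <= Num.max (z 0 i) (y 0 i)) -> S w.

(** The [k]-th vertex of the staircase that leads from [z] to [y] by changing one coordinate at a
    time. *)
Definition mix (k : nat) y z : 'rV[R]_d := \row_j (if (j < k)%N then y 0 j else z 0 j).

Lemma mix0 y z : mix 0 y z = z.
Proof. by apply/rowP => j; rewrite mxE ltn0. Qed.

Lemma mixd y z : mix d y z = y.
Proof. by apply/rowP => j; rewrite mxE ltn_ord. Qed.

Lemma mixS i y z : mix i.+1 y z = line (mix i y z) i (y 0 i - z 0 i).
Proof.
apply/rowP => j; rewrite lineE !mxE ltnS leq_eqVlt -val_eqE/=.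
by case: eqP => [e|//]; rewrite (val_inj e) ltnn/= addrC subrK.
Qed.

Lemma mix_between i y z h : 0 <= h <= 1 ->
  forall j, Num.min (z 0 j) (y 0 j) <= line (mix i y z) i (h * (y 0 i - z 0 i)) 0 j
    <= Num.max (z 0 j) (y 0 j).
Proof.
move=> /andP[h0 h1] j; rewrite lineE !mxE; case: eqP => [->|_].
  rewrite ltnn ge_min le_max.
  have [zy|yz] := leP (z 0 i) (y 0 i).
    have yz0 : 0 <= y 0 i - z 0 i by rewrite subr_ge0.
    apply/andP; split; apply/orP; [left|right]; nra.
  have yz0 : 0 <= z 0 i - y 0 i by rewrite subr_ge0 ltW.
  apply/andP; split; apply/orP; [right|left]; nra.
by case: ifP => _; rewrite ge_min le_max !lexx ?orbT.
Qed.

Lemma between_ball z y w r : 0 < r -> ball z r y ->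
  (forall i, Num.min (z 0 i) (y 0 i) <= w 0 i <= Num.max (z 0 i) (y 0 i)) -> ball z r w.
Proof.
move=> r0 /ball_rVP-/(_ r0) zy h; apply/ball_rVP => // i.
apply: le_lt_trans (zy i); have := h i.
rewrite ge_min le_max; case: (lerP (z 0 i) (y 0 i)) => yz.
  rewrite distrC => /andP[a b]; rewrite ler_norml; apply/andP.
  by split; move: a b => /orP[a|a] /orP[b|b]; lra.
rewrite distrC => /andP[a b]; rewrite ler_norml; apply/andP.
by split; move: a b => /orP[a|a] /orP[b|b]; lra.
Qed.

(* The mean value inequality along the edges of the staircase from [z] to [y]. *)
Lemma staircase_le S f (g : 'I_d -> 'rV[R]_d -> R) (l : 'I_d -> R) y z (e : R) :
  0 <= e ->
  (forall w i, S w -> pd S f w i (g i w)) ->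
  (forall w, (forall i, Num.min (z 0 i) (y 0 i) <= w 0 i <= Num.max (z 0 i) (y 0 i)) ->
     S w /\ forall i, `|g i w - l i| <= e) ->
  `|f y - f z - \sum_i l i * (y 0 i - z 0 i)| <= e * \sum_i `|y 0 i - z 0 i|.
Proof.
move=> e0 hf hbox.
have Sbox w hw := (hbox w hw).1.
have step (i : 'I_d) : `|f (mix i.+1 y z) - f (mix i y z) - l i * (y 0 i - z 0 i)|
    <= e * `|y 0 i - z 0 i|.
  pose a := y 0 i - z 0 i.
  pose F (h : R) := f (line (mix i y z) i (h * a)) - l i * (h * a).
  have Sline (h : R) : 0 <= h <= 1 -> S (line (mix i y z) i (h * a)).
    by move=> h01; apply: Sbox; exact: mix_between.
  have dF h : 0 <= h <= 1 ->
      hasd `[0, 1] F h ((g i (line (mix i y z) i (h * a)) - l i) * a).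
    move=> h01; rewrite mulrBl; apply: hasdB; last first.
      apply: hasdZ; have := hasdM (hasd_id `[0, 1] h) (hasd_cst `[0, 1] a h).
      by rewrite mul1r mulr0 addr0.
    have := hf _ i (Sline h h01); set w := line _ _ _ => hw.
    (* A degenerate edge cannot be rescaled by [1 / |a|]; along it the function is constant. *)
    have [a0|a0] := eqVneq a 0.
      rewrite a0 mulr0; apply: hasd_near (hasd_cst `[0, 1] (f w) h); rewrite ?a0.
        by near=> s => hs; split => //; rewrite /w a0 !mulr0.
      by rewrite /w a0 mulr0.
    move=> e1 e10; have e2 : 0 < e1 / `|a| by rewrite divr_gt0 ?normr_gt0.
    have /nbhs_ballP[rho /= rho0 hrho] := hw _ e2.
    apply/nbhs_ballP; exists (rho / `|a|); first by rewrite /= divr_gt0 ?normr_gt0.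
    move=> s /= hs; rewrite in_itv/= => s01.
    have e3 : line w i ((s - h) * a) = line (mix i y z) i (s * a).
      by rewrite /w lineD -mulrDl addrC subrK.
    have := hrho ((s - h) * a); rewrite /ball/= sub0r normrN normrM e3 line0 subr0.
    have -> : g i w * a * (s - h) = g i w * ((s - h) * a) by ring.
    have -> : e1 / `|a| * `|(s - h) * a| = e1 * `|s - h|.
      by rewrite normrM; field; rewrite normr_eq0.
    apply; last exact: Sline.
    by rewrite -ltr_pdivlMr ?normr_gt0// distrC.
  have b h : 0 <= h <= 1 -> `|(g i (line (mix i y z) i (h * a)) - l i) * a| <= e * `|a|.
    move=> h01; rewrite normrM ler_wpM2r//; apply: (hbox _ _).2; exact: mix_between.
  have k0 : 0 <= e * `|a| by rewrite mulr_ge0.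
  have := hasd_norm_le k0 dF b (lexx 0) ler01 (lexx 1).
  rewrite /F mul1r mul0r line0 mulr0 subr0 mixS subr0 mulr1.
  by rewrite [in X in X -> _]addrAC.
have -> : f y - f z = \sum_(i < d) (f (mix i.+1 y z) - f (mix i y z)).
  rewrite -(big_mkord xpredT (fun k : nat => f (mix k.+1 y z) - f (mix k y z))).
  by rewrite telescope_sumr// mix0 mixd.
rewrite -sumrB mulr_sumr (le_trans (ler_norm_sum _ _ _))//.
by apply: ler_sum => i _; exact: step.
Unshelve. all: by end_near. Qed.

(** By continuity the partial derivatives vary by at most [e] over a small box, so the staircase
    estimate becomes a first order expansion, including at boundary points. *)
Lemma frechet S f (g : 'I_d -> 'rV[R]_d -> R) z : locally_box S -> S z ->
  (forall w i, S w -> pd S f w i (g i w)) ->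
  (forall i, g i w @[w --> within S (nbhs z)] --> g i z) ->
  forall e, 0 < e -> \forall y \near z, S y ->
  `|f y - f z - \sum_i g i z * (y 0 i - z 0 i)| <= e * \sum_i `|y 0 i - z 0 i|.
Proof.
move=> lS Sz hf cg e e0; have [r r0 hr] := lS _ Sz.
have : \forall w \near z, S w -> forall i, `|g i z - g i w| <= e.
  have H : \forall w \near within S (nbhs z), forall i, `|g i z - g i w| <= e.
    by apply: filter_forall => i; have /cvgrPdist_le/(_ _ e0) := cg i.
  exact: H.
move=> /nbhs_ballP[r' /= r'0 hr'].
near=> y => Sy.
have zry : ball z r y by near: y; exact: nbhsx_ballx.
have zr'y : ball z r' y by near: y; exact: nbhsx_ballx.
apply: (staircase_le (ltW e0) hf) => w hw; have Sw := hr _ Sy zry _ hw; split => // i.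
by rewrite distrC; apply: hr' => //; exact: between_ball zr'y hw.
Unshelve. all: by end_near. Qed.

Lemma chain_rule S f (g : 'I_d -> 'rV[R]_d -> R) (D : set R) (c : R -> 'rV[R]_d)
    (t : R) (v : 'I_d -> R) :
  locally_box S -> S (c t) ->
  (forall w i, S w -> pd S f w i (g i w)) ->
  (forall i, g i w @[w --> within S (nbhs (c t))] --> g i (c t)) ->
  (forall i, hasd D (fun s => c s 0 i) t (v i)) ->
  (\forall s \near t, D s -> S (c s)) ->
  hasd D (fun s => f (c s)) t (\sum_i g i (c t) * v i).
Proof.
move=> lS Sz hf cg hc hS.
have cc : c s @[s --> within D (nbhs t)] --> c t.
  by apply: cvg_rV => i; exact: hasd_cvg (hc i).
move=> e e0.
pose G := \sum_i `|g i (c t)|.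
pose V := \sum_i (`|v i| + 1).
have G0 : 0 <= G by apply: sumr_ge0.
have V0 : 0 <= V by apply: sumr_ge0 => i _; rewrite addr_ge0.
(* Half of [e] pays for the expansion of [f], divided by the bound [V] on the speed; the other half
   pays for the expansion of the curve, divided by the bound [G] on the gradient. The minimum with 1
   in [e2] is what yields the speed bound [|v i| + 1]. *)
have e1 : 0 < e / 2 / (V + 1) by rewrite !divr_gt0// ltr_wpDl.
pose e2 := Num.min 1 (e / 2 / (G + 1)).
have e20 : 0 < e2 by rewrite lt_min ltr01 !divr_gt0// ltr_wpDl.
have H1 : \forall s \near t, D s -> S (c s) ->
  `|f (c s) - f (c t) - \sum_i g i (c t) * (c s 0 i - c t 0 i)| <=
  e / 2 / (V + 1) * \sum_i `|c s 0 i - c t 0 i|.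
  exact: (cc _ (frechet lS Sz hf cg e1)).
have H2 : \forall s \near t, forall i, D s ->
    `|c s 0 i - c t 0 i - v i * (s - t)| <= e2 * `|s - t|.
  by exact: (near_all (fun i => hc i e2 e20)).
near=> s => Ds.
have h1 : D s -> S (c s) ->
  `|f (c s) - f (c t) - \sum_i g i (c t) * (c s 0 i - c t 0 i)| <=
  e / 2 / (V + 1) * \sum_i `|c s 0 i - c t 0 i| by near: s.
have {h1} := h1 Ds; have Scs : D s -> S (c s) by near: s.
move=> /(_ (Scs Ds)) h1.
have h2 : forall i, D s -> `|c s 0 i - c t 0 i - v i * (s - t)| <= e2 * `|s - t|.
  by near: s.
have h3 i : `|c s 0 i - c t 0 i| <= (`|v i| + 1) * `|s - t|.
  rewrite -[c s 0 i - c t 0 i](subrK (v i * (s - t))) (le_trans (ler_normD _ _))//.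
  rewrite normrM mulrDl addrC lerD2l (le_trans (h2 i Ds))// ler_wpM2r//.
  by rewrite ge_min lexx.
have h4 : \sum_i `|c s 0 i - c t 0 i| <= V * `|s - t|.
  by rewrite mulr_suml; apply: ler_sum => i _; exact: h3.
have h5 : `|\sum_i g i (c t) * (c s 0 i - c t 0 i) - (\sum_i g i (c t) * v i) * (s - t)|
   <= G * (e2 * `|s - t|).
  rewrite mulr_suml -sumrB mulr_suml (le_trans (ler_norm_sum _ _ _))//.
  apply: ler_sum => i _; rewrite -mulrA -mulrBr normrM ler_wpM2l//.
  exact: h2.
have h6 : G * (e2 * `|s - t|) <= e / 2 * `|s - t|.
  rewrite mulrA ler_wpM2r// (@le_trans _ _ (G * (e / 2 / (G + 1))))//.
    by rewrite ler_wpM2l// ge_min lexx orbT.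
  rewrite mulrCA ger_pMr ?divr_gt0// ler_pdivrMr ?ltr_wpDl// mul1r.
  by rewrite lerDl.
have h7 : e / 2 / (V + 1) * \sum_i `|c s 0 i - c t 0 i| <= e / 2 * `|s - t|.
  rewrite (@le_trans _ _ (e / 2 / (V + 1) * (V * `|s - t|)))//.
    by rewrite ler_wpM2l// ltW.
  rewrite mulrA ler_wpM2r// -mulrA ger_pMr ?divr_gt0// mulrC ler_pdivrMr ?ltr_wpDl//.
  by rewrite mul1r lerDl.
rewrite -[f (c s) - f (c t)](subrK (\sum_i g i (c t) * (c s 0 i - c t 0 i))) -addrA.
rewrite (le_trans (ler_normD _ _))// [e]splitr mulrDl lerD//.
  exact: le_trans h7.
exact: le_trans h6.
Unshelve. all: by end_near. Qed.

End RowVec.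

Section Proper.
Context {R : realType}.

Lemma within_dnbhs_proper (D : set R) (t : R) :
  (forall e, 0 < e -> exists s, [/\ s != t, `|t - s| < e & D s]) ->
  ProperFilter (within D t^').
Proof.
move=> h; apply: Build_ProperFilter_ex => P hP.
have /nbhs_ballP[e /= e0 he] : \forall s \near t, s != t -> D s -> P s by exact: hP.
by have [s [st ts Ds]] := h e e0; exists s; exact: he.
Qed.

Lemma itv_proper (L t : R) : 0 < L -> 0 <= t <= L -> ProperFilter (within `[0, L] t^').
Proof.
move=> L0 /andP[t0 tL]; apply: within_dnbhs_proper => e e0.
have [tl|lt] := ltP t L.
  exists (Num.min L (t + e / 2)); split.
  - by rewrite gt_eqF// lt_min tl ltrDl divr_gt0.
  - rewrite distrC ger0_norm ?subr_ge0 ?le_min ?tL ?lerDl ?divr_ge0 ?(ltW e0)//.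
    by rewrite ltrBlDl gt_min ltrD2l ltr_pdivrMr// ltr_pMr// ltr1n orbT.
  - rewrite /= in_itv/= ge_min lexx/= andbT le_min (ltW L0)/=.
    by rewrite addr_ge0// divr_ge0// ltW.
have tE : t = L by apply/le_anti; rewrite tL.
exists (Num.max 0 (t - e / 2)); split.
- by rewrite lt_eqF// gt_max tE L0 ltrBlDr ltrDl divr_gt0.
- rewrite ger0_norm ?subr_ge0 ?ge_max ?t0 ?lerBlDr ?lerDl ?divr_ge0 ?(ltW e0)//.
  by rewrite ltrBlDl -ltrBlDr lt_max ler_ltB ?orbT// ltr_pdivrMr// ltr_pMr// ltr1n.
- rewrite /= in_itv/= le_max lexx/= ge_max (ltW L0)/= tE lerBlDr lerDl.
  by rewrite divr_ge0// ltW.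
Qed.

End Proper.

Section RelOpen.
Context {R : realType} {n : nat}.
Implicit Types (S : set 'rV[R]_n) (z : 'rV[R]_n).
Notation half := (@half_space R n).

Definition relopen S := S `<=` half /\
  forall z, S z -> \forall y \near z, half y -> S y.

(** A positive increment of any coordinate stays in the half-space, even from its boundary. *)
Lemma relopen_lines S : relopen S -> has_lines S.
Proof.
move=> [Sh hS] z i Sz; apply: within_dnbhs_proper => e e0.
have /nbhs_ballP[r /= r0 hr] := near_line i (hS z Sz).
pose h := Num.min (e / 2) (r / 2).
have h0 : 0 < h by rewrite lt_min !divr_gt0.
exists h; split; first by rewrite gt_eqF.
  rewrite sub0r normrN gtr0_norm// gt_min ltr_pdivrMr// ltr_pMr ?ltr1n//.
apply: hr.
  rewrite /ball/= sub0r normrN gtr0_norm// gt_min [r / 2 < r]ltr_pdivrMr// ltr_pMr ?ltr1n// orbT//.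
move=> j j0; rewrite lineE; case: ifP => _; last exact: Sh Sz _ j0.
by rewrite addr_ge0 ?(Sh _ Sz _ j0)// ltW.
Qed.

Lemma relopen_box S : relopen S -> locally_box S.
Proof.
move=> [Sh hS] z Sz; have /nbhs_ballP[r /= r0 hr] := hS z Sz.
exists r => // y Sy zy w zwy; apply: hr.
  exact: between_ball zy zwy.
move=> i i0; have /andP[+ _] := zwy i; apply: le_trans.
by rewrite le_min (Sh _ Sz _ i0) (Sh _ Sy _ i0).
Qed.

End RelOpen.

(** * Calculus in charts *)

Section AtlasLemmas.
Context {R : realType} {n : nat} {M : ptopologicalType} (A : atlas R n M).
Hypothesis hM : is_manifold_with_boundary A.
Implicit Types (c : chart A) (x : M) (z : 'rV[R]_n).
Notation half := (@half_space R n).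

Lemma cimgP c z : cimg c z <-> cdom c (cinv c z) /\ cmap c (cinv c z) = z.
Proof.
split; first by move=> [x cx <-]; rewrite (mfd_cinvK hM).
by move=> [cx <-]; exists (cinv c z).
Qed.

Lemma cimg_cmap c x : cdom c x -> cimg c (cmap c x).
Proof. by exists x. Qed.

Lemma cimg_relopen c : relopen (cimg c).
Proof.
have [U [oU ->]] := mfd_cimg_open hM c; split; first by move=> z [].
move=> z [Uz _]; have : nbhs z U by exact: open_nbhs_nbhs.
by apply: filterS => y Oy hy; split.
Qed.

Lemma near_cinv c z (P : M -> Prop) : cimg c z -> (\forall x \near cinv c z, P x) ->
  \forall y \near z, cimg c y -> P (cinv c y).
Proof.
move=> cz hP; have /subspace_continuousP/(_ z cz) := mfd_cinv_continuous hM (c := c).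
by move=> /(_ _ hP).
Qed.

Lemma near_cmap c x (P : 'rV[R]_n -> Prop) : cdom c x -> (\forall y \near cmap c x, P y) ->
  \forall y \near x, cdom c y /\ P (cmap c y).
Proof.
move=> cx hP; have /subspace_continuousP/(_ x cx) := mfd_cmap_continuous hM (c := c).
move=> /(_ _ hP) h.
have h' : \forall y \near x, cdom c y -> P (cmap c y) by exact: h.
have : \forall y \near x, cdom c y.
  by apply: open_nbhs_nbhs; split => //; exact: mfd_cdom_open hM c.
by apply: filterS2 h' => y h1 h2; split => //; exact: h1.
Qed.

Definition overlap c c' := cmap c @` (cdom c `&` cdom c').

Lemma overlapP c c' z : overlap c c' z <-> cimg c z /\ cdom c' (cinv c z).
Proof.
split; first by move=> [x [cx c'x] <-]; rewrite (mfd_cinvK hM)//; split => //; exists x.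
move=> [/cimgP[cx cK] c'x]; exists (cinv c z) => //.
Qed.

Lemma overlap_cmap c c' x : cdom c x -> cdom c' x -> overlap c c' (cmap c x).
Proof. by move=> cx c'x; exists x. Qed.

Lemma near_overlap c c' z : overlap c c' z -> \forall y \near z, cimg c y -> overlap c c' y.
Proof.
move=> /overlapP[cz c'z].
have : \forall x \near cinv c z, cdom c' x.
  by apply: open_nbhs_nbhs; split => //; exact: mfd_cdom_open hM c'.
by move=> /(near_cinv cz); apply: filterS => y hy cy; apply/overlapP; split => //; exact: hy.
Qed.

Lemma overlap_relopen c c' : relopen (overlap c c').
Proof.
have [ch co] := cimg_relopen c; split.
  by move=> z /overlapP[/ch].
move=> z zcc'; have /overlapP[cz c'z] := zcc'.
by apply: filterS2 (co z cz) (near_overlap zcc') => y h1 h2 hy; apply/h2/h1.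
Qed.

Definition trans c c' (j : 'I_n) z := cmap c' (cinv c z) 0 j.

Lemma trans_pd_overlap c c' j z i : overlap c c' z ->
  pd (overlap c c') (trans c c' j) z i (pderive (overlap c c') (trans c c' j) z i).
Proof. by move=> zcc'; apply: (@Ck_pd _ _ 0) => //; exact: mfd_smooth hM c c' 1 j. Qed.

Lemma pd_overlap c c' (f : 'rV[R]_n -> R) z i l : overlap c c' z ->
  pd (overlap c c') f z i l -> pd (cimg c) f z i l.
Proof.
move=> zcc'; apply: pd_near; last by case/overlapP: zcc'.
by apply: filterS (near_overlap zcc') => y hy cy; split => //; exact: hy.
Qed.

(** Transition maps are known to be smooth on the overlap, whereas [jacobian] differentiates inside
    the whole image of [c]. The overlap is relatively open there, so both derivatives see the same
    germ. *)
Lemma pderive_overlap c c' j z i : overlap c c' z ->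
  pderive (overlap c c') (trans c c' j) z i = pderive (cimg c) (trans c c' j) z i.
Proof.
move=> zcc'; apply/esym/pd_pderive.
- exact: relopen_lines (cimg_relopen c).
- by case/overlapP: zcc'.
- exact: pd_overlap (trans_pd_overlap j i zcc').
Qed.

Lemma trans_pderive_cvg c c' j z i : overlap c c' z ->
  pderive (overlap c c') (trans c c' j) w i @[w --> within (overlap c c') (nbhs z)]
  --> pderive (overlap c c') (trans c c' j) z i.
Proof.
move=> zcc'; apply: (@Ck_cvg _ _ 0) => //.
by apply: Ck_pderive; exact: mfd_smooth hM c c' 1 j.
Qed.

Lemma jacobianE c c' x i j : cdom c x -> cdom c' x ->
  jacobian c c' x i j = pderive (overlap c c') (trans c c' j) (cmap c x) i.
Proof. by move=> cx c'x; rewrite mxE pderive_overlap//; exact: overlap_cmap. Qed.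

Lemma jacobian_pd c c' x i j : cdom c x -> cdom c' x ->
  pd (cimg c) (trans c c' j) (cmap c x) i (jacobian c c' x i j).
Proof.
move=> cx c'x; have h := overlap_cmap cx c'x.
by rewrite jacobianE//; apply: pd_overlap (trans_pd_overlap j i h).
Qed.

Lemma hasd_chart c c' (D : set R) (gamma : R -> M) (t : R) (v : 'I_n -> R) j :
  cdom c (gamma t) -> cdom c' (gamma t) ->
  (\forall s \near t, D s -> cdom c (gamma s) /\ cdom c' (gamma s)) ->
  (forall i, hasd D (fun s => cmap c (gamma s) 0 i) t (v i)) ->
  hasd D (fun s => cmap c' (gamma s) 0 j) t
    (\sum_i v i * jacobian c c' (gamma t) i j).
Proof.
move=> cx c'x hD hv; have zov := overlap_cmap cx c'x.
have := @chain_rule R n (overlap c c') (trans c c' j)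
  (fun i w => pderive (overlap c c') (trans c c' j) w i) D (fun s => cmap c (gamma s)) t v.
move=> /(_ (relopen_box (overlap_relopen c c')) zov (fun w i => @trans_pd_overlap c c' j w i)).
move=> /(_ (fun i => @trans_pderive_cvg c c' j _ i zov) hv).
move=> H; have {}H := H (_ : \near t, D t -> overlap c c' (cmap c (gamma t))).
have -> : \sum_i v i * jacobian c c' (gamma t) i j =
  \sum_i pderive (overlap c c') (trans c c' j) (cmap c (gamma t)) i * v i.
  by apply: eq_bigr => i _; rewrite jacobianE// mulrC.
apply: hasd_near (H _).
- near=> s => Ds; split=> //; rewrite /trans (mfd_cinvK hM)//.
  have /(_ Ds)[] // : D s -> cdom c (gamma s) /\ cdom c' (gamma s) by near: s.
- by rewrite /trans (mfd_cinvK hM).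
- by apply: filterS hD => s hs Ds; have [? ?] := hs Ds; exact: overlap_cmap.
Unshelve. all: by end_near. Qed.

Lemma line_curve c x i (P : set M) : cdom c x -> open P -> P x ->
  \forall h \near (0 : R), cimg c (line (cmap c x) i h) -> P (cinv c (line (cmap c x) i h)).
Proof.
move=> cx oP Px; have zc := cimg_cmap cx.
have hP : \forall y \near cinv c (cmap c x), P y.
  by rewrite (mfd_cinvK hM)//; exact: open_nbhs_nbhs.
exact: (near_line i (near_cinv zc hP)).
Qed.

Lemma cmap_pd c x i j : cdom c x ->
  pd (cimg c) (fun z => z 0 j) (cmap c x) i ((i == j)%:R).
Proof.
move=> cx; rewrite /pd; have [->|ij] := eqVneq i j.
  have h1 : hasd setT (fun h : R => cmap c x 0 j + h) 0 (0 + 1).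
    by apply: hasdD; [exact: hasd_cst|exact: hasd_id].
  rewrite add0r in h1; apply: hasd_near h1; last by rewrite lineE eqxx.
  by near=> h => _; rewrite lineE eqxx.
have h1 : hasd setT (fun h : R => cmap c x 0 j) 0 0 by exact: hasd_cst.
apply: hasd_near h1; last by rewrite line0.
by near=> h => _; rewrite lineE eq_sym (negbTE ij).
Unshelve. all: by end_near. Qed.

Lemma jacobian_id c x : cdom c x -> jacobian c c x = 1%:M.
Proof.
move=> cx; apply/matrixP => i j; rewrite !mxE; apply: pd_pderive.
- exact: relopen_lines (cimg_relopen c).
- exact: cimg_cmap.
apply: eq_pd (cmap_pd i j cx); last exact: cimg_cmap.
by move=> y /cimgP[_ e]; rewrite /trans e.
Qed.

(** The cocycle rule is [hasd_chart] applied to a coordinate line of [c], regarded as a curve in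
    [M]. *)
Lemma jacobian_mul c c' c'' x : cdom c x -> cdom c' x -> cdom c'' x ->
  jacobian c c'' x = jacobian c c' x *m jacobian c' c'' x.
Proof.
move=> cx c'x c''x; apply/matrixP => i j; rewrite [LHS]mxE; apply: pd_pderive.
- exact: relopen_lines (cimg_relopen c).
- exact: cimg_cmap.
rewrite mxE.
have := @hasd_chart c' c'' [set h | cimg c (line (cmap c x) i h)]
  (fun h => cinv c (line (cmap c x) i h)) 0 (fun k => jacobian c c' x i k) j.
rewrite line0 (mfd_cinvK hM)//; apply => //.
- have h1 := line_curve i cx (mfd_cdom_open hM c') c'x.
  have h2 := line_curve i cx (mfd_cdom_open hM c'') c''x.
  by apply: filterS2 h1 h2 => h h1 h2 ch; split; [exact: h1|exact: h2].
- by move=> k; exact: jacobian_pd.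
Qed.

Lemma jacobian_unit c c' x : cdom c x -> cdom c' x -> jacobian c c' x \in unitmx.
Proof.
move=> cx c'x; have := jacobian_mul cx c'x cx.
by rewrite jacobian_id// => /esym/mulmx1_unit[].
Qed.

Lemma covector_in_id (alpha : M -> 'rV[R]_n) x :
  covector_in (chart_at A x) alpha x = alpha x.
Proof.
by rewrite /covector_in jacobian_id ?trmx1 ?mulmx1//; exact: mfd_chart_at hM x.
Qed.

Definition has_differential (u : M -> R) (alpha : M -> 'rV[R]_n) :=
  forall c z i, cimg c z -> pd (cimg c) (fun z => u (cinv c z)) z i
    (covector_in c alpha (cinv c z) 0 i).

Definition continuous_form (alpha : M -> 'rV[R]_n) :=
  forall c i z, cimg c z -> covector_in c alpha (cinv c y) 0 i @[y --> within (cimg c) (nbhs z)]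
    --> covector_in c alpha (cinv c z) 0 i.

Lemma differential_chain (u : M -> R) alpha c (D : set R) (gamma : R -> M) (t : R)
    (v : 'I_n -> R) :
  has_differential u alpha -> continuous_form alpha -> cdom c (gamma t) ->
  (\forall s \near t, D s -> cdom c (gamma s)) ->
  (forall i, hasd D (fun s => cmap c (gamma s) 0 i) t (v i)) ->
  hasd D (fun s => u (gamma s)) t (\sum_i covector_in c alpha (gamma t) 0 i * v i).
Proof.
move=> hu ca cx hD hv; have zc := cimg_cmap cx.
have := @chain_rule R n (cimg c) (fun z => u (cinv c z))
  (fun i w => covector_in c alpha (cinv c w) 0 i) D (fun s => cmap c (gamma s)) t v.
move=> /(_ (relopen_box (cimg_relopen c)) zc (fun w i => @hu c w i)).
move=> /(_ (fun i => ca c i _ zc) hv).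
move=> H; have {}H := H (_ : \near t, D t -> cimg c (cmap c (gamma t))).
rewrite (mfd_cinvK hM) // in H.
apply: hasd_near (H _).
- near=> s => Ds; split=> //; rewrite (mfd_cinvK hM)//.
  by move: Ds; near: s.
- by rewrite (mfd_cinvK hM).
- by apply: filterS hD => s hs Ds; apply: cimg_cmap; exact: hs.
Unshelve. all: by end_near. Qed.

(** [alpha] is prescribed at each [x] in the preferred chart of [x] alone; the chain rule along
    coordinate lines of [c] carries it to an arbitrary chart. *)
Lemma C1_has_differential (u : M -> R) (alpha : M -> 'rV[R]_n) :
  (forall c, Ck 1 (cimg c) (fun z => u (cinv c z))) ->
  (forall x, alpha x = \row_i pderive (cimg (chart_at A x))
     (fun z => u (cinv (chart_at A x) z)) (cmap (chart_at A x) x) i) ->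
  has_differential u alpha.
Proof.
move=> hu ha c z i cz.
have /cimgP[cx cK] := cz; set x := cinv c z in cx cK *.
pose c' := chart_at A x; have c'x : cdom c' x := mfd_chart_at hM x.
have zc' := cimg_cmap c'x.
have := @chain_rule R n (cimg c') (fun z => u (cinv c' z))
  (fun i w => pderive (cimg c') (fun z => u (cinv c' z)) w i)
  [set h | cimg c (line z i h)] (fun h => cmap c' (cinv c (line z i h))) 0
  (fun j => jacobian c c' x i j).
rewrite line0 -/x.
move=> /(_ (relopen_box (cimg_relopen c')) zc' (fun w i => @Ck_pd _ _ 0 _ _ w i (hu c'))).
move=> /(_ (fun i => @Ck_cvg _ _ 0 _ _ _ (Ck_pderive i (hu c')) zc')) H.
have hc' : \forall h \near (0 : R), cimg c (line z i h) -> cdom c' (cinv c (line z i h)).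
  by have := line_curve i cx (mfd_cdom_open hM c') c'x; rewrite cK.
have {}H := H (_ : _) (_ : _).
rewrite /pd; have -> : covector_in c alpha x 0 i =
  \sum_j pderive (cimg c') (fun z0 => u (cinv c' z0)) (cmap c' x) j * jacobian c c' x i j.
  by rewrite mxE; apply: eq_bigr => j _; rewrite [in RHS]mulrC [_^T _ _]mxE ha !mxE mulrC.
apply: hasd_near (H _ _).
- near=> h => ch; split => //; rewrite (mfd_cinvK hM)//.
  by move: ch; near: h.
- by rewrite line0 (mfd_cinvK hM).
- by move=> j; have := jacobian_pd i j cx c'x; rewrite cK.
- by apply: filterS hc' => h hh ch; apply: cimg_cmap; exact: hh.
Unshelve. all: by end_near. Qed.

End AtlasLemmas.

(** * Uniqueness of geodesics *)

Section NearPair.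
Context {X Y : topologicalType}.

Lemma near_swap (x : X) (y : Y) (P : X * Y -> Prop) : (\forall p \near (x, y), P p) ->
  \forall p \near (y, x), P (p.2, p.1).
Proof.
move=> [[U V]/= [hU hV] UV]; exists (V, U) => //= -[a b] [/= Va Ub].
exact: (UV (b, a) (conj Ub Va)).
Qed.

Lemma near_pair_snd (x : X) (y : Y) (P : X * Y -> Prop) : (\forall p \near (x, y), P p) ->
  \forall b \near y, P (x, b).
Proof.
move=> [[U V]/= [hU hV] UV]; apply: filterS hV => b Vb.
exact: (UV (x, b) (conj (nbhs_singleton hU) Vb)).
Qed.

Lemma near_pair1 (x : X) (y : Y) (P : X -> Prop) : (\forall a \near x, P a) ->
  \forall p \near (x, y), P p.1.
Proof. by move=> h; exists (P, setT) => /=; [split => //; exact: filterT|move=> p []]. Qed.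

Lemma near_pair2 (x : X) (y : Y) (P : Y -> Prop) : (\forall a \near y, P a) ->
  \forall p \near (x, y), P p.2.
Proof. by move=> h; exists (setT, P) => /=; [split => //; exact: filterT|move=> p []]. Qed.

End NearPair.

Lemma cvg_sumR (R : realType) T (F : set_system T) {FF : Filter F} I (r : seq I)
    (f : I -> T -> R) (l : I -> R) : (forall i, f i x @[x --> F] --> l i) ->
  \sum_(i <- r) f i x @[x --> F] --> \sum_(i <- r) l i.
Proof.
move=> h; elim: r => [|i r IH].
  under eq_fun do rewrite big_nil; rewrite big_nil; exact: cvg_cst.
under eq_fun do rewrite big_cons; rewrite big_cons; apply: cvgD => //; exact: h.
Qed.

Section Gronwall.
Context {R : realType}.

(** A short-interval version without exponentials: at a maximum point of [Phi], the mean value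
    inequality bounds [Phi] by [C * #|J| * (b - a)] times itself, a factor below 1. *)
Lemma gronwall0 (J : finType) (p p' : J -> R -> R) (a b C : R) : a <= b -> 0 <= C ->
  (forall j t, a <= t <= b -> hasd `[a, b] (p j) t (p' j t)) ->
  (forall j t, a <= t <= b -> `|p' j t| <= C * \sum_i `|p i t|) ->
  (forall j, p j a = 0) -> C * #|J|%:R * (b - a) < 1 ->
  forall t, a <= t <= b -> forall j, p j t = 0.
Proof.
move=> ab C0 dp hp p0 small.
pose Phi t := \sum_i `|p i t|.
have cPhi : {within `[a, b], continuous Phi}.
  apply/subspace_continuousP => t /=; rewrite in_itv/= => tab.
  apply: (@cvg_sumR R _ _ _ _ _ (fun i t => `|p i t|)) => i.
  by apply: cvg_norm; exact: hasd_cvg (dp i t tab).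
have [t0 t0ab ht0] := EVT_max ab cPhi.
have {}ht0 (t : R) : a <= t <= b -> Phi t <= Phi t0 by move=> tab; apply: ht0; rewrite in_itv.
rewrite in_itv/= in t0ab; have /andP[at0 t0b] := t0ab.
have P0 t : 0 <= Phi t by apply: sumr_ge0.
have bd j : `|p j t0| <= C * Phi t0 * (b - a).
  have := hasd_norm_le (mulr_ge0 C0 (P0 t0)) (dp j) _ (lexx a) at0 t0b.
  rewrite p0 subr0 => H; apply: (le_trans (H _)).
    by move=> x xab; apply: (le_trans (hp j x xab)); rewrite ler_wpM2l// ht0.
  by rewrite ler_wpM2l ?mulr_ge0// lerB.
have : Phi t0 <= C * #|J|%:R * (b - a) * Phi t0.
  rewrite {1}/Phi (@le_trans _ _ (\sum_(j : J) C * Phi t0 * (b - a)))//.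
    by apply: ler_sum => j _.
  rewrite sumr_const -[_ *+ _]mulr_natr [leLHS](_ : _ = C * #|J|%:R * (b - a) * Phi t0)//.
  by ring.
have [Pt0|] := ltrP 0 (Phi t0).
  by rewrite ler_pMl// leNgt small.
move=> Pt0 _ t tab j; apply/eqP; rewrite -normr_le0 (le_trans _ Pt0)// (le_trans _ (ht0 t tab))//.
by rewrite /Phi (bigD1 j)//= lerDl sumr_ge0.
Qed.

End Gronwall.

Lemma between_dist (R : realDomainType) (a b c w r : R) : `|c - a| < r -> `|c - b| < r ->
  Num.min a b <= w <= Num.max a b -> `|c - w| < r.
Proof.
rewrite ge_min le_max !ltr_distl => /andP[a1 a2] /andP[c1 c2] /andP[/orP[u|u] /orP[v|v]];
by apply/andP; split; lra.
Qed.

(** * Locally Lipschitz functions *)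

Section Lipschitz.
Context {R : realType} {d : nat}.
Implicit Types (S : set 'rV[R]_d) (f g : 'rV[R]_d -> R) (z y w : 'rV[R]_d).

Definition dist1 y w : R := \sum_i `|y 0 i - w 0 i|.

(** The local bound on [|f|] is part of the notion so that it is stable under products. *)
Definition llip S f z := exists2 K, 0 <= K &
  \forall p \near (z, z), S p.1 -> S p.2 ->
    `|f p.1| <= K /\ `|f p.1 - f p.2| <= K * dist1 p.1 p.2.

Lemma dist1_ge0 y w : 0 <= dist1 y w.
Proof. exact: sumr_ge0. Qed.

Lemma eq_llip S f g z : (forall y, S y -> f y = g y) -> llip S f z -> llip S g z.
Proof.
move=> fg [K K0 h]; exists K => //.
by apply: filterS h => p h S1 S2; rewrite -!fg//; exact: h.
Qed.

Lemma llip_cst S (k : R) z : llip S (fun=> k) z.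
Proof.
exists `|k| => //; near=> p => _ _; rewrite subrr normr0 lexx; split => //.
by rewrite mulr_ge0// dist1_ge0.
Unshelve. all: by end_near. Qed.

Lemma llipD S f g z : llip S f z -> llip S g z -> llip S (fun y => f y + g y) z.
Proof.
move=> [K K0 h] [K' K'0 h']; exists (K + K'); first exact: addr_ge0.
apply: filterS2 h h' => p h h' S1 S2; have [a b] := h S1 S2; have [a' b'] := h' S1 S2.
split; first by rewrite (le_trans (ler_normD _ _))// lerD.
by rewrite opprD addrACA (le_trans (ler_normD _ _))// mulrDl lerD.
Qed.

Lemma llipM S f g z : llip S f z -> llip S g z -> llip S (fun y => f y * g y) z.
Proof.
move=> [K K0 h] [K' K'0 h']; exists (K * K' + K * K').
  by rewrite addr_ge0// mulr_ge0.
have hs : \forall p \near (z, z), S p.1 -> S p.2 ->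
    `|g p.2| <= K'.
  by apply: filterS (near_swap h') => p /= hp S1 S2; have [] := hp S2 S1.
apply: filterS3 hs h h' => p hs hp hp' S1 S2.
have [a b] := hp S1 S2; have [a' b'] := hp' S1 S2; have c := hs S1 S2.
split.
  rewrite normrM (@le_trans _ _ (K * K'))// ?ler_pM// lerDl mulr_ge0//.
have -> : f p.1 * g p.1 - f p.2 * g p.2 =
  f p.1 * (g p.1 - g p.2) + (f p.1 - f p.2) * g p.2 by ring.
rewrite (le_trans (ler_normD _ _))// !normrM mulrDl lerD//.
  by rewrite -mulrA ler_pM.
by rewrite mulrAC ler_pM// mulr_ge0// dist1_ge0.
Qed.

Lemma llipZ S (k : R) f z : llip S f z -> llip S (fun y => k * f y) z.
Proof. by apply: llipM; exact: llip_cst. Qed.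

Lemma llipB S f g z : llip S f z -> llip S g z -> llip S (fun y => f y - g y) z.
Proof.
move=> hf /(llipZ (-1)) hg; apply: eq_llip (llipD hf hg) => y _.
by rewrite mulN1r.
Qed.

Lemma llip_sum S I (r : seq I) (P : pred I) (f : I -> 'rV[R]_d -> R) z :
  (forall i, llip S (f i) z) -> llip S (fun y => \sum_(i <- r | P i) f i y) z.
Proof.
move=> h; elim: r => [|i r IH].
  by apply: eq_llip (llip_cst S 0 z) => y _; rewrite big_nil.
case Pi: (P i).
  by apply: eq_llip (llipD (h i) IH) => y _; rewrite big_cons Pi.
by apply: eq_llip IH => y _; rewrite big_cons Pi.
Qed.

Lemma llip_prod S I (r : seq I) (P : pred I) (f : I -> 'rV[R]_d -> R) z :
  (forall i, llip S (f i) z) -> llip S (fun y => \prod_(i <- r | P i) f i y) z.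
Proof.
move=> h; elim: r => [|i r IH].
  by apply: eq_llip (llip_cst S 1 z) => y _; rewrite big_nil.
case Pi: (P i).
  by apply: eq_llip (llipM (h i) IH) => y _; rewrite big_cons Pi.
by apply: eq_llip IH => y _; rewrite big_cons Pi.
Qed.

Lemma llip_cvg S f z : S z -> llip S f z -> f y @[y --> within S (nbhs z)] --> f z.
Proof.
move=> Sz [K K0 h]; apply/cvgrPdist_le => e e0.
have hz : \forall y \near z, S y -> `|f z - f y| <= K * dist1 z y.
  by apply: filterS (near_pair_snd h) => y /= hy Sy; have [] := hy Sz Sy.
have e'0 : 0 < e / ((K + 1) * (d%:R + 1)).
  by rewrite divr_gt0// mulr_gt0// ltr_wpDl.
suff H : \forall y \near z, S y -> `|f z - f y| <= e by exact: H.
near=> y => Sy.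
have h1 : S y -> `|f z - f y| <= K * dist1 z y by near: y.
apply: (le_trans (h1 Sy)).
have zy : ball z (e / ((K + 1) * (d%:R + 1))) y by near: y; exact: nbhsx_ballx.
rewrite (@le_trans _ _ ((K + 1) * (d%:R * (e / ((K + 1) * (d%:R + 1))))))//.
  apply: ler_pM => //; [exact: dist1_ge0|by rewrite lerDl|].
  rewrite /dist1 (@le_trans _ _ (\sum_(i < d) (e / ((K + 1) * (d%:R + 1)))))//.
    by apply: ler_sum => i _; apply: ltW; move/ball_rVP : zy; exact.
  by rewrite sumr_const card_ord -[_ *+ _]mulr_natl.
have K1 : 0 < K + 1 by rewrite ltr_wpDl.
have d1 : 0 < d%:R + 1 :> R by rewrite ltr_wpDl.
have -> : (K + 1) * (d%:R * (e / ((K + 1) * (d%:R + 1)))) = e * (d%:R / (d%:R + 1)).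
  by field; rewrite !gt_eqF.
by rewrite ger_pMr// ler_pdivrMr// mul1r lerDl.
Unshelve. all: by end_near. Qed.

Lemma llipV S f z : S z -> f z != 0 -> llip S f z -> llip S (fun y => (f y)^-1) z.
Proof.
move=> Sz fz0 hf; have fc := llip_cvg Sz hf; have [K K0 h] := hf.
have fz : 0 < `|f z| by rewrite normr_gt0.
pose m := `|f z| / 2.
have m0 : 0 < m by rewrite divr_gt0.
have hm : \forall y \near z, S y -> m <= `|f y|.
  have /cvgrPdist_le/(_ _ m0) H := fc.
  have {}H : \forall y \near z, S y -> `|f z - f y| <= m by exact: H.
  apply: filterS H => y H Sy; have {}H := H Sy.
  have := lerB_dist (f z) (f y); rewrite {1}(splitr `|f z|) -/m => H2.
  lra.
have hm1 := near_pair1 z hm; have hm2 := near_pair2 z hm.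
exists (m^-1 + K / m ^+ 2); first by rewrite addr_ge0 ?divr_ge0 ?invr_ge0 ?exprn_ge0// ltW.
apply: filterS3 h hm1 hm2 => p hp h1 h2 S1 S2.
have [a b] := hp S1 S2; have {}h1 := h1 S1; have {}h2 := h2 S2.
have f1 : 0 < `|f p.1| by exact: lt_le_trans h1.
have f2 : 0 < `|f p.2| by exact: lt_le_trans h2.
split.
  rewrite normfV (@le_trans _ _ m^-1)//; first by rewrite lef_pV2.
  by rewrite lerDl divr_ge0// ?exprn_ge0// ltW.
have -> : (f p.1)^-1 - (f p.2)^-1 = - (f p.1 - f p.2) / (f p.1 * f p.2).
  by field; rewrite -!normr_gt0 f1 f2.
rewrite normrM normrN normfV mulrDl.
rewrite (@le_trans _ _ (K / m ^+ 2 * dist1 p.1 p.2))//; last first.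
  by rewrite lerDr mulr_ge0// ?dist1_ge0// invr_ge0 ltW.
rewrite mulrAC ler_pM// ?invr_ge0//.
rewrite normrM lef_pV2 ?posrE ?mulr_gt0// ?exprn_gt0// expr2.
by rewrite ler_pM// ltW.
Qed.

Lemma llip_det S m (G : 'rV[R]_d -> 'M[R]_m) z :
  (forall i j, llip S (fun y => G y i j) z) -> llip S (fun y => \det (G y)) z.
Proof.
move=> h; rewrite /determinant; apply: llip_sum => s; apply: llipZ.
exact: llip_prod.
Qed.

(** By the cofactor formula the entries are polynomials in those of [G], divided by the nonvanishing
    determinant. *)
Lemma llip_invmx S m (G : 'rV[R]_d -> 'M[R]_m) z : S z ->
  (forall y, S y -> G y \in unitmx) ->
  (forall i j, llip S (fun y => G y i j) z) ->
  forall i j, llip S (fun y => invmx (G y) i j) z.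
Proof.
move=> Sz hu h i j.
have h1 : llip S (fun y => (\det (G y))^-1) z.
  apply: llipV => //; last exact: llip_det.
  by have := hu z Sz; rewrite unitmxE unitfE.
have h2 : llip S (fun y => \adj (G y) i j) z.
  have h3 : llip S (fun y => (-1) ^+ (j + i) * \det (row' j (col' i (G y)))) z.
    apply: llipZ; apply: llip_det => a b.
    by apply: eq_llip (h (lift j a) (lift i b)) => y _; rewrite !mxE.
  by apply: eq_llip h3 => y _; rewrite !mxE.
by apply: eq_llip (llipM h1 h2) => y Sy; rewrite /invmx (hu y Sy) !mxE.
Qed.

(** The staircase estimate with [l = 0] and [e] a local bound on the gradient. *)
Lemma llip_C1 S f z : relopen S -> S z -> Ck 1 S f -> llip S f z.
Proof.
move=> [Sh So] Sz hf.
pose K := \sum_i (`|pderive S f z i| + 1).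
have K0 : 0 <= K by apply: sumr_ge0 => i _; rewrite addr_ge0.
have H : \forall y \near z, @half_space R d y ->
    S y /\ forall i, `|pderive S f y i| <= K.
  have H1 : \forall y \near z, forall i, S y -> `|pderive S f z i - pderive S f y i| <= 1.
    apply: near_all => i; have := Ck_cvg (Ck_pderive i hf) Sz.
    by move=> /cvgrPdist_le/(_ _ ltr01).
  apply: filterS2 H1 (So z Sz) => y h1 h2 hy; have Sy := h2 hy; split => // i.
  rewrite (@le_trans _ _ (`|pderive S f z i| + 1))//; last first.
    by rewrite /K (bigD1 i)//= lerDl sumr_ge0// => j _; rewrite addr_ge0.
  rewrite -[pderive S f y i](subKr (pderive S f z i)).
  by rewrite (le_trans (ler_normB _ _))// lerD2l h1.
have Hb : \forall y \near z, S y -> `|f y| <= `|f z| + 1.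
  have := Ck_cvg hf Sz; move=> /cvgrPdist_le/(_ _ ltr01) H1.
  have {}H1 : \forall y \near z, S y -> `|f z - f y| <= 1 by exact: H1.
  apply: filterS H1 => y h Sy; rewrite -[f y](subKr (f z)).
  by rewrite (le_trans (ler_normB _ _))// lerD2l h.
have /nbhs_ballP[r /= r0 hr] := H.
exists (K + (`|f z| + 1)); first by rewrite !addr_ge0.
have B1 := near_pair1 z (nbhsx_ballx z r r0 : \forall p \near z, ball z r p).
have B2 := near_pair2 z (nbhsx_ballx z r r0 : \forall p \near z, ball z r p).
have Hb1 := near_pair1 z Hb.
apply: filterS3 Hb1 B1 B2 => p hb b1 b2 S1 S2; split.
  by rewrite (le_trans (hb S1))// lerDr.
have := @staircase_le R d S f (fun i w => pderive S f w i) (fun=> 0) p.1 p.2 K K0.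
rewrite big1 ?subr0; last by move=> i _; rewrite mul0r.
move=> HH; apply: le_trans (HH _ _) _.
- by move=> w i Sw; exact: (@Ck_pd _ _ 0).
- move=> w hw.
  have wb : ball z r w.
    apply/ball_rVP => // i; apply: between_dist (hw i).
      by move/ball_rVP : b2; exact.
    by move/ball_rVP : b1; exact.
  have hw' : @half_space R d w.
    move=> i i0; have /andP[+ _] := hw i; apply: le_trans.
    by rewrite le_min (Sh _ S1 _ i0) (Sh _ S2 _ i0).
  have [Sw hw2] := hr w wb hw'; split => // i; rewrite subr0; exact: hw2.
by rewrite ler_wpM2r ?dist1_ge0// lerDl addr_ge0.
Qed.

End Lipschitz.

(** * Geodesics and their exit points *)

Section Geodesics.
Context {R : realType} {n : nat} {M : ptopologicalType} (A : atlas R n M).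
Hypothesis hM : is_manifold_with_boundary A.
Variable g : M -> 'M[R]_n.
Hypothesis hg : is_riemannian_metric A g 6.
Implicit Types (c : chart A) (x : M) (z : 'rV[R]_n) (gamma : R -> M) (L t : R).

Lemma metric_unit x : g x \in unitmx.
Proof.
rewrite -row_free_unit -kermx_eq0; apply/eqP/row_matrixP => i.
rewrite row0; apply/eqP; apply: contraT => v0.
have := metric_pos hg x v0.
have -> : row i (kermx (g x)) *m g x = 0 by apply/sub_kermxP; exact: row_sub.
by rewrite mul0mx mxE ltxx.
Qed.

Lemma metric_in_unit c x : cdom c x -> metric_in g c x \in unitmx.
Proof.
move=> cx; have cx' := mfd_chart_at hM x.
by rewrite /metric_in !unitmx_mul unitmx_tr metric_unit jacobian_unit.
Qed.

Lemma metric_C1 c i j : Ck 1 (cimg c) (fun z => metric_in g c (cinv c z) i j).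
Proof. by do 5!apply: CkW; exact: metric_Ck hg c i j. Qed.

Lemma metric_llip c z i j : cimg c z ->
  llip (cimg c) (fun z => metric_in g c (cinv c z) i j) z.
Proof. by move=> cz; apply: llip_C1 => //; [exact: cimg_relopen|exact: metric_C1]. Qed.

Lemma christoffel_llip c z k i j : cimg c z ->
  llip (cimg c) (fun z => christoffel g c (cinv c z) k i j) z.
Proof.
move=> cz; rewrite /christoffel.
have hD l a b : llip (cimg c)
    (fun z => pderive (cimg c) (fun z => metric_in g c (cinv c z) a b) (cmap c (cinv c z)) l) z.
  have h : Ck 1 (cimg c) (fun z => pderive (cimg c) (fun z => metric_in g c (cinv c z) a b) z l).
    do 4!apply: CkW; apply: Ck_pderive; exact: metric_Ck hg c a b.
  apply: eq_llip (llip_C1 (cimg_relopen hM c) cz h) => y /(cimgP hM)[_ e].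
  by rewrite e.
apply: llipZ; apply: llip_sum => l; apply: llipM.
  apply: (llip_invmx cz) => [y /(cimgP hM)[cy _]|a b]; first exact: metric_in_unit.
  exact: metric_llip.
by apply: llipB => //; apply: llipD.
Qed.

Definition vel c L gamma i t := derive_in `[0, L] (fun r => cmap c (gamma r) 0 i) t.

Lemma geodesic_near c L gamma t : geodesic A g L gamma -> 0 <= t <= L -> cdom c (gamma t) ->
  \forall s \near t, `[0, L]%classic s -> cdom c (gamma s).
Proof.
move=> [/subspace_continuousP cg _] tL ct.
have := cg t; rewrite /= in_itv/= => /(_ tL)/(_ (cdom c)); apply.
by apply: open_nbhs_nbhs; split => //; exact: mfd_cdom_open hM c.
Qed.

Lemma geodesic_pos c L gamma t i : geodesic A g L gamma -> 0 <= t <= L -> cdom c (gamma t) ->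
  hasd `[0, L] (fun s => cmap c (gamma s) 0 i) t (vel c L gamma i t).
Proof. by move=> [_ h] tL ct; have [d _ _] := h c t tL ct i; exact: derivable_in_hasd. Qed.

Definition acc c L gamma k t := - \sum_i \sum_j
  christoffel g c (gamma t) k i j * vel c L gamma i t * vel c L gamma j t.

Lemma geodesic_vel c L gamma t i : geodesic A g L gamma -> 0 <= t <= L -> cdom c (gamma t) ->
  hasd `[0, L] (vel c L gamma i) t (acc c L gamma i t).
Proof.
move=> [_ h] tL ct; have [_ d e] := h c t tL ct i.
have -> : vel c L gamma i = fun s => (\row_i0 derive_in `[0, L]
    (fun r => cmap c (gamma r) 0 i0) s) 0 i by apply/funext => s; rewrite mxE.
have -> : acc c L gamma i t = derive_in `[0, L] (fun s => (\row_i0 derive_in `[0, L]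
    (fun r => cmap c (gamma r) 0 i0) s) 0 i) t.
  rewrite e; congr (- _); apply: eq_bigr => a _; apply: eq_bigr => b _.
  by rewrite !mxE.
exact: derivable_in_hasd.
Qed.

Lemma vel_cvg c L gamma t i : geodesic A g L gamma -> 0 <= t <= L -> cdom c (gamma t) ->
  vel c L gamma i s @[s --> within `[0, L] (nbhs t)] --> vel c L gamma i t.
Proof. by move=> hgeo tL ct; apply: hasd_cvg; exact: geodesic_vel. Qed.

Lemma subitv (L' L : R) : L' <= L -> `[0, L']%classic `<=` `[0, L]%classic.
Proof.
by move=> LL s /=; rewrite !in_itv/= => /andP[-> sL]; rewrite (le_trans sL).
Qed.

(** What matters is [t = L'], where the derivative within [[0, L']] is only a left derivative. *)
Lemma vel_restrict c L' L gamma t i : geodesic A g L gamma -> 0 < L' -> L' <= L ->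
  0 <= t <= L' -> cdom c (gamma t) -> vel c L' gamma i t = vel c L gamma i t.
Proof.
move=> hgeo L0 LL tL' ct; apply: hasd_derive_in; first exact: itv_proper.
apply: hasdS (subitv LL) _; apply: geodesic_pos => //.
by move: tL' => /andP[-> tl]; rewrite (le_trans tl).
Qed.

Lemma geodesic_restrict L' L gamma : geodesic A g L gamma -> 0 < L' -> L' <= L ->
  geodesic A g L' gamma.
Proof.
move=> hgeo L0 LL; split.
  apply/subspace_continuousP => t tL'; case: hgeo => /subspace_continuousP ch _.
  have := ch t (subitv LL tL'); apply: cvg_trans; apply: cvg_app.
  by apply: within_subset => s; exact: subitv.
move=> c t tL' ct v k.
have tL : 0 <= t <= L by move: tL' => /andP[-> tl]; rewrite (le_trans tl).
have hp i : hasd `[0, L'] (fun s => cmap c (gamma s) 0 i) t (vel c L gamma i t).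
  by apply: hasdS (subitv LL) _; exact: geodesic_pos.
have vE i : v t 0 i = vel c L gamma i t.
  by rewrite /v mxE; apply: vel_restrict.
have hv : hasd `[0, L'] (fun s => v s 0 k) t (acc c L gamma k t).
  apply: hasd_near (geodesic_vel k hgeo tL ct); last by rewrite vE.
  apply: filterS (geodesic_near hgeo tL ct) => s hs sL'; split; first exact: subitv sL'.
  by rewrite /v mxE; apply/esym/vel_restrict => //; exact: hs (subitv LL sL').
split.
- exact: hasd_derivable_in (hp k).
- exact: hasd_derivable_in hv.
- rewrite (hasd_derive_in (itv_proper L0 tL') hv); congr (- _).
  by apply: eq_bigr => a _; apply: eq_bigr => b _; rewrite !vE.
Qed.

Lemma christoffel_bound c z : cimg c z -> exists2 K, 0 <= K &
  \forall p \near (z, z), forall k i j, cimg c p.1 -> cimg c p.2 ->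
    `|christoffel g c (cinv c p.2) k i j| <= K /\
    `|christoffel g c (cinv c p.1) k i j - christoffel g c (cinv c p.2) k i j|
      <= K * dist1 p.1 p.2.
Proof.
move=> cz; have := fun (a : 'I_n * 'I_n * 'I_n) => christoffel_llip a.1.1 a.1.2 a.2 cz.
move=> /(_ _)/cid2 => Kf; pose K a := s2val (Kf a).
have K0 a : 0 <= K a := s2valP (Kf a).
have hK a := s2valP' (Kf a).
exists (\sum_a K a); first by apply: sumr_ge0 => a _.
have KK a : K a <= \sum_a K a by rewrite (bigD1 a)//= lerDl sumr_ge0.
have H := near_all hK; have H' := near_swap H.
apply: filterS2 H H' => p h h' k i j S1 S2.
have [h1 _] := h' (k, i, j) S2 S1; have [_ h2] := h (k, i, j) S1 S2.
split; first exact: le_trans h1 (KK _).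
by apply: (le_trans h2); rewrite ler_wpM2r ?dist1_ge0// KK.
Qed.

(** In the chart [c] the differences of positions and velocities satisfy a linear differential
    inequality, since the Christoffel symbols are locally Lipschitz; [gronwall0] applies on a short
    interval after [s]. *)
Lemma geodesic_unique_local L gamma1 gamma2 c s :
  geodesic A g L gamma1 -> geodesic A g L gamma2 -> 0 <= s -> s < L ->
  cdom c (gamma1 s) -> gamma1 s = gamma2 s ->
  (forall i, vel c L gamma1 i s = vel c L gamma2 i s) ->
  exists2 d, 0 < d & forall t, s <= t <= L -> t <= s + d -> gamma1 t = gamma2 t.
Proof.
move=> geo1 geo2 s0 sL cs1 gs vs; have cs2 := cs1; rewrite gs in cs2.
have ss : 0 <= s <= L by rewrite s0 ltW.
set z := cmap c (gamma1 s).
have cz : cimg c z by exact: cimg_cmap.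
have [K K0 hK] := christoffel_bound cz.
have near1 := geodesic_near geo1 ss cs1.
have near2 := geodesic_near geo2 ss cs2.
have cc1 : cmap c (gamma1 t) @[t --> within `[0, L] (nbhs s)] --> z.
  by apply: cvg_rV => i; exact: hasd_cvg (geodesic_pos i geo1 ss cs1).
have cc2 : cmap c (gamma2 t) @[t --> within `[0, L] (nbhs s)] --> z.
  by rewrite /z gs; apply: cvg_rV => i; exact: hasd_cvg (geodesic_pos i geo2 ss cs2).
have nearK : \forall t \near s, `[0, L]%classic t -> forall k i j,
    cimg c (cmap c (gamma1 t)) -> cimg c (cmap c (gamma2 t)) ->
    `|christoffel g c (cinv c (cmap c (gamma2 t))) k i j| <= K /\
    `|christoffel g c (cinv c (cmap c (gamma1 t))) k i j -
      christoffel g c (cinv c (cmap c (gamma2 t))) k i j|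
      <= K * dist1 (cmap c (gamma1 t)) (cmap c (gamma2 t)).
  by exact: (cvg_pair cc1 cc2 hK).
pose V := \sum_i `|vel c L gamma1 i s| + 1.
have V0 : 0 <= V by rewrite addr_ge0// sumr_ge0.
have velV i : `|vel c L gamma1 i s| + 1 <= V.
  by rewrite lerD2r (bigD1 i)//= lerDl sumr_ge0.
have nearV gam : geodesic A g L gam -> cdom c (gam s) ->
    (forall i, vel c L gam i s = vel c L gamma1 i s) ->
    \forall t \near s, forall i, `[0, L]%classic t -> `|vel c L gam i t| <= V.
  move=> geo cs hv; apply: near_all => i.
  have /cvgrPdist_le H := hasd_cvg (geodesic_vel i geo ss cs).
  have {}H := H 1 ltr01; have {}H : \forall t \near s, `[0, L]%classic t -> `|vel c L gam i s - vel c L gam i t| <= 1.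
    exact: H.
  apply: filterS H => t H tL; rewrite (le_trans _ (velV i))//.
  rewrite -[vel c L gam i t](subKr (vel c L gam i s)) (le_trans (ler_normB _ _))//.
  by rewrite hv lerD2l -hv H.
have nV1 := nearV gamma1 geo1 cs1 (fun i => erefl).
have nV2 := nearV gamma2 geo2 cs2 (fun i => esym (vs i)).
have [d d0 hd] : exists2 d, 0 < d & forall t, `|s - t| < d -> `[0, L]%classic t ->
  [/\ cdom c (gamma1 t), cdom c (gamma2 t),
   forall k i j, `|christoffel g c (gamma2 t) k i j| <= K /\
    `|christoffel g c (gamma1 t) k i j - christoffel g c (gamma2 t) k i j|
      <= K * dist1 (cmap c (gamma1 t)) (cmap c (gamma2 t)),
   forall i, `|vel c L gamma1 i t| <= V & forall i, `|vel c L gamma2 i t| <= V].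
  have Fs : Filter (nbhs s) by exact: nbhs_filter.
  have := @filterI _ _ Fs _ _ (@filterI _ _ Fs _ _ near1 near2)
    (@filterI _ _ Fs _ _ nearK (@filterI _ _ Fs _ _ nV1 nV2)).
  move=> /nbhs_ballP[d /= d0 hd]; exists d => // t st tL.
  have [[h1 h2] [h3 [h4 h5]]] := hd t st.
  split; [exact: h1|exact: h2| |by move=> i; exact: h4|by move=> i; exact: h5].
  move=> k i j; have c1 := h1 tL; have c2 := h2 tL.
  have := h3 tL k i j (cimg_cmap c1) (cimg_cmap c2).
  by rewrite !(mfd_cinvK hM).
(* [C] sums the bounds for the [n * n] terms of the geodesic equation; [1 <= C] serves for the
   position components, whose derivatives are the velocity differences. *)
have [C C1 hC2] : exists2 C : R, 1 <= C & forall Phi : R, 0 <= Phi ->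
    \sum_(a < n) \sum_(b < n) ((K * V ^+ 2 + 2 * K * V) * Phi) <= C * Phi.
  have KV0 : 0 <= K * V ^+ 2 + 2 * K * V.
    by rewrite addr_ge0// ?mulr_ge0// exprn_ge0.
  move: (K * V ^+ 2 + 2 * K * V) KV0 => X KV0.
  exists (n%:R * (n%:R * X) + 1).
    by rewrite lerDr mulr_ge0// mulr_ge0.
  have sumE (Y : R) : \sum_(b < n) Y = n%:R * Y by rewrite sumr_const card_ord mulr_natl.
  by move=> Phi Phi0; rewrite !sumE mulrDl mul1r -!mulrA lerDl.
have C0 : 0 <= C by rewrite (le_trans _ C1).
pose J : finType := ('I_n + 'I_n)%type.
have [N N0 NJ] : exists2 N : R, 0 <= N & #|J|%:R = N by exists #|J|%:R.
have CN : 0 <= C * N by exact: mulr_ge0.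
have CN1 : 0 < C * N + 1 by exact: ltr_wpDl.
(* The first bound keeps both curves where the estimates hold, the second makes the factor in
   [gronwall0] smaller than 1. *)
have [e e0 [ed eN]] : exists2 e : R, 0 < e & e <= d / 2 /\ e <= 1 / (C * N + 1).
  exists (Num.min (d / 2) (1 / (C * N + 1))).
    by rewrite lt_min !divr_gt0.
  by rewrite !ge_min !lexx orbT.
exists e => //.
move=> t /andP[st tL] te.
have t0 : 0 <= t by exact: le_trans st.
have sub r : s <= r <= t -> `[0, L]%classic r /\ `|s - r| < d.
  move=> /andP[sr rt]; split.
    by rewrite /= in_itv/= (le_trans s0 sr) (le_trans rt tL).
  rewrite distrC ger0_norm ?subr_ge0// ltrBlDl (le_lt_trans rt)// (le_lt_trans te)//.
  by rewrite ltrD2l (le_lt_trans ed)// ltr_pdivrMr// ltr_pMr// ltr1n.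
pose p (j : J) r := match j with
  | inl i => cmap c (gamma1 r) 0 i - cmap c (gamma2 r) 0 i
  | inr i => vel c L gamma1 i r - vel c L gamma2 i r end.
pose p' (j : J) r := match j with
  | inl i => vel c L gamma1 i r - vel c L gamma2 i r
  | inr i => acc c L gamma1 i r - acc c L gamma2 i r end.
have subL : `[s, t]%classic `<=` `[0, L]%classic.
  by move=> r /=; rewrite !in_itv/= => /andP[sr rt]; rewrite (le_trans s0 sr) (le_trans rt).
have PhiE r : \sum_j `|p j r| = dist1 (cmap c (gamma1 r)) (cmap c (gamma2 r)) +
    \sum_i `|vel c L gamma1 i r - vel c L gamma2 i r|.
  by rewrite big_sumType.
have dp j r : s <= r <= t -> hasd `[s, t] (p j) r (p' j r).
  move=> srt; have [rL rd] := sub r srt; have [c1 c2 _ _ _] := hd r rd rL.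
  have rL' : 0 <= r <= L by move: rL; rewrite /= in_itv.
  apply: hasdS subL _; case: j => i; apply: hasdB; try exact: geodesic_pos;
  exact: geodesic_vel.
have hp j r : s <= r <= t -> `|p' j r| <= C * \sum_i `|p i r|.
  move=> srt; have [rL rd] := sub r srt; have [c1 c2 hC hV1 hV2] := hd r rd rL.
  have Phi0 : 0 <= \sum_i `|p i r| by apply: sumr_ge0.
  case: j => i /=.
    rewrite (@le_trans _ _ (1 * \sum_i `|p i r|))//; last by rewrite ler_wpM2r.
    by rewrite mul1r (bigD1 (inr i))//= lerDl sumr_ge0.
  set Phi := \sum_i `|p i r| in Phi0 *.
  have D1 : dist1 (cmap c (gamma1 r)) (cmap c (gamma2 r)) <= Phi.
    by rewrite /Phi PhiE lerDl sumr_ge0.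
  have D2 a : `|vel c L gamma1 a r - vel c L gamma2 a r| <= Phi.
    by rewrite /Phi (bigD1 (inr a))//= lerDl sumr_ge0.
  rewrite /acc opprK addrC -sumrB (le_trans (ler_norm_sum _ _ _))//.
  apply: le_trans (hC2 Phi Phi0).
    apply: ler_sum => a _; rewrite -sumrB (le_trans (ler_norm_sum _ _ _))//.
    apply: ler_sum => b _; rewrite distrC.
    have [k1 k2] := hC i a b.
    move: (christoffel g c (gamma1 r) i a b) (christoffel g c (gamma2 r) i a b) k1 k2.
    move=> G1 G2 k1 k2.
    move: (vel c L gamma1 a r) (vel c L gamma2 a r) (hV1 a) (hV2 a) (D2 a).
    move: (vel c L gamma1 b r) (vel c L gamma2 b r) (hV1 b) (hV2 b) (D2 b).
    move=> b1 b2 B1 B2 DB a1 a2 A1 A2 DA.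
    have -> : G1 * a1 * b1 - G2 * a2 * b2 = (G1 - G2) * (a1 * b1) +
      (G2 * b1 * (a1 - a2) + G2 * a2 * (b1 - b2)) by ring.
    have -> : (K * V ^+ 2 + 2 * K * V) * Phi = K * Phi * (V * V) +
      (K * V * Phi + K * V * Phi) by ring.
    rewrite (le_trans (ler_normD _ _))// lerD//.
      rewrite normrM [`|a1 * b1|]normrM ler_pM// ?mulr_ge0//; last by rewrite ler_pM.
      by apply: (le_trans k2); rewrite ler_wpM2l.
    by rewrite (le_trans (ler_normD _ _))// lerD// !normrM ler_pM ?mulr_ge0// ler_pM.
have small : C * #|J|%:R * (t - s) < 1.
  rewrite NJ.
  have ts : t - s <= 1 / (C * N + 1) by rewrite lerBlDl (le_trans te)// lerD2l.
  apply: (@le_lt_trans _ _ (C * N * (1 / (C * N + 1)))); first exact: ler_wpM2l.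
  by rewrite mulrA mulr1 ltr_pdivrMr// mul1r ltrDl.
have p0 j : p j s = 0 by case: j => i /=; rewrite ?gs ?vs subrr.
have H := gronwall0 st C0 dp hp p0 small.
have tt : s <= t <= t by rewrite st lexx.
have [tL' td] := sub t tt; have [c1 c2 _ _ _] := hd t td tL'.
rewrite -(mfd_cinvK hM c1) -(mfd_cinvK hM c2); congr cinv.
by apply/rowP => i; apply/eqP; rewrite -subr_eq0; apply/eqP; exact: H t tt (inl i).
Qed.

(** Let [s] be the supremum of the times up to which the geodesics agree. At [s] the positions agree
    because [M] is Hausdorff, and the velocities because both are the left derivative of the same
    curve, or the initial velocity if [s = 0]. If [s < L], local uniqueness continues the agreement
    past [s]. *)
Lemma geodesic_unique L gamma1 gamma2 y v : 0 < L ->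
  geodesic_from A g y v L gamma1 -> geodesic_from A g y v L gamma2 ->
  forall t, 0 <= t <= L -> gamma1 t = gamma2 t.
Proof.
move=> L0 [geo1 g10 v1] [geo2 g20 v2].
pose E := [set t | 0 <= t <= L /\ forall s, 0 <= s <= t -> gamma1 s = gamma2 s].
have E0 : E 0.
  split; first by rewrite lexx ltW.
  move=> s /andP[s0 s0']; have -> : s = 0 by apply/le_anti; rewrite s0 s0'.
  by rewrite g10.
have hE : has_sup E.
  by split; [exists 0|exists L => t [/andP[_ tL] _]].
pose s := sup E.
have s0 : 0 <= s by apply: ub_le_sup => //; case: hE.
have sL : s <= L by apply: ge_sup; [exists 0|move=> t [/andP[_ tL] _]].
have slt t : 0 <= t -> t < s -> gamma1 t = gamma2 t.
  move=> t0 ts; have := sup_adherent (_ : 0 < s - t) hE.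
  rewrite subr_gt0 => /(_ ts)[r [rL hr]]; rewrite subKr => tr.
  by apply: hr; rewrite t0 ltW.
have ss : 0 <= s <= L by rewrite s0 sL.
have cont gam : geodesic A g L gam -> gam t @[t --> within `[0, L] (nbhs s)] --> gam s.
  by move=> [/subspace_continuousP h _]; apply: h; rewrite /= in_itv.
have gs : gamma1 s = gamma2 s.
  move: s0; rewrite le_eqVlt => /predU1P[<-|s0]; first by rewrite g10.
  have pf : ProperFilter (within `[0, s] s^').
    by apply: itv_proper => //; rewrite lexx ltW.
  have sub : within `[0, s] s^' `=>` within `[0, L] (nbhs s).
    move=> P hP; have hP' : \forall t \near s, `[0, L]%classic t -> P t by exact: hP.
    suff h2 : \forall t \near s, t != s -> `[0, s]%classic t -> P t by exact: h2.
    by apply: filterS hP' => t h _ ts; apply: h; exact: subitv ts.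
  have c1 : gamma1 t @[t --> within `[0, s] s^'] --> gamma1 s.
    by apply: cvg_trans (cont _ geo1); apply: cvg_app.
  have c2 : gamma1 t @[t --> within `[0, s] s^'] --> gamma2 s.
    have : gamma2 t @[t --> within `[0, s] s^'] --> gamma2 s.
      by apply: cvg_trans (cont _ geo2); apply: cvg_app.
    apply: cvg_trans; apply: near_eq_cvg.
    suff h2 : \forall t \near s, t != s -> `[0, s]%classic t -> gamma2 t = gamma1 t by exact: h2.
    near=> t => ts; rewrite /= in_itv/= => /andP[t0 ts'].
    by apply/esym/slt => //; rewrite lt_neqAle ts.
  apply: cvg_unique c1 c2; exact: mfd_hausdorff hM.
have eq_s t : 0 <= t <= s -> gamma1 t = gamma2 t.
  move=> /andP[t0]; rewrite le_eqVlt => /predU1P[->//|ts]; exact: slt.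
have [sltL|Ls] := ltP s L; last first.
  by move=> t /andP[t0 tL]; apply: eq_s; rewrite t0 (le_trans tL).
pose c := chart_at A (gamma1 s).
have cs1 : cdom c (gamma1 s) by exact: mfd_chart_at.
have cs2 : cdom c (gamma2 s) by rewrite -gs.
have vs i : vel c L gamma1 i s = vel c L gamma2 i s.
  move: s0; rewrite le_eqVlt => /predU1P[s0|s0].
    have : velocity A `[0, L] gamma1 0 0 i = velocity A `[0, L] gamma2 0 0 i by rewrite v1 v2.
    by rewrite !mxE g20 -g10 /vel /c -s0.
  have pf : ProperFilter (within `[0, s] s^').
    by apply: itv_proper => //; rewrite lexx ltW.
  apply: (@hasd_unique R `[0, s] (fun r => cmap c (gamma2 r) 0 i) s) => //.
    apply: hasd_near (hasdS (subitv sL) (geodesic_pos i geo1 ss cs1)); last by rewrite gs.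
    by near=> t => ts; split => //; rewrite eq_s//; move: ts; rewrite /= in_itv.
  exact: hasdS (subitv sL) (geodesic_pos i geo2 ss cs2).
have [d d0 hd] := geodesic_unique_local geo1 geo2 s0 sltL cs1 gs vs.
pose r := Num.min L (s + d).
have sr : s < r by rewrite lt_min sltL ltrDl.
have rE : E r.
  split; first by rewrite (le_trans s0 (ltW sr)) ge_min lexx.
  move=> t /andP[t0 tr]; have [ts|st] := leP t s; first by apply: eq_s; rewrite t0.
  by move: tr; rewrite le_min => /andP[tL td]; apply: hd => //; rewrite (ltW st).
have : r <= s by apply: ub_le_sup => //; case: hE.
by rewrite leNgt sr.
Unshelve. all: by end_near. Qed.

Lemma maximal_geodesicP L gamma : maximal_geodesic A g L gamma -> 0 < L ->
  geodesic A g L gamma.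
Proof. by move=> [y [v [_ _ [geo _ _]]]]. Qed.

Lemma maximal_geodesic_end0 L gamma (u : M -> R) : maximal_geodesic A g L gamma ->
  (forall x, bdry A x -> u x = 0) -> u (gamma 0) = 0.
Proof. by move=> [y [v [[_ by_ _ _] _ [_ -> _]]]]; exact. Qed.

(* The infimum L of the exit times need not be attained; but exit times decrease to L, the
   geodesics realizing them coincide by uniqueness, and u vanishes at their end points. *)
Lemma maximal_geodesic_endL L gamma (u : M -> R) : maximal_geodesic A g L gamma -> 0 < L ->
  continuous u -> (forall x, bdry A x -> u x = 0) -> u (gamma L) = 0.
Proof.
move=> [y [v [_ tauL gfrom]]] L0 cu hu.
have Lle t : exit_times A g y v t -> L <= t.
  move=> ht; rewrite -lee_fin -tauL; apply: ereal_inf_lbound; by exists t.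
have exL e : 0 < e -> exists2 t, exit_times A g y v t & t < L + e.
  move=> e0; have : (ereal_inf [set t%:E | t in exit_times A g y v] < (L + e)%:E)%E.
    by rewrite -[ereal_inf _]/(tau_exit A g y v) tauL lte_fin ltrDl.
  by move=> /ereal_inf_lt[_ [t ht <-]]; rewrite lte_fin => tl; exists t.
have restrict_from L' L'' gam : geodesic_from A g y v L'' gam -> 0 < L' -> L' <= L'' ->
    geodesic_from A g y v L' gam.
  move=> [geo h0 hv] L'0 LL; split => //; first exact: geodesic_restrict geo _ _.
  rewrite -hv; apply/rowP => i; rewrite !mxE.
  apply: (vel_restrict i geo) => //; first by rewrite lexx ltW.
  exact: mfd_chart_at.
(* [gam1] serves as reference: it lives up to [t1 >= L], so the exit points at times slightly above
   [L] lie on it and converge to [gam1 L]. *)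
have [t1 ht1 _] := exL 1 ltr01.
have [t10 [gam1 [gf1 _ _]]] := ht1.
have e1 t : 0 <= t <= L -> gam1 t = gamma t.
  exact: (geodesic_unique L0 (restrict_from _ _ _ gf1 L0 (Lle _ ht1)) gfrom).
rewrite -e1 ?lexx ?ltW//.
have cgam : u (gam1 t) @[t --> within `[0, t1] (nbhs L)] --> u (gam1 L).
  have [[/subspace_continuousP h _] _ _] := gf1.
  apply: (@cvg_comp _ _ _ gam1 u _ (nbhs (gam1 L))); last exact: cu.
  by apply: h; rewrite /= in_itv/= ltW//= Lle.
apply/eqP; rewrite -normr_le0; apply/ler_addgt0Pl => e e0; rewrite addr0.
have /cvgrPdist_le/(_ _ e0) H := cgam.
have {}H : \forall t \near L, `[0, t1]%classic t -> `|u (gam1 L) - u (gam1 t)| <= e by exact: H.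
move/nbhs_ballP : H => [r /= r0 hr].
have [t2 ht2 t2r] := exL _ r0.
(* The earlier of the two exit times lies within [r] of [L] and in the domain of [gam1]. *)
have [t1t2|t2t1] := leP t1 t2.
  have [_ [gam [gf bt _]]] := ht1.
  have := hr t1; rewrite /ball/= distrC ger0_norm ?subr_ge0 ?Lle// ltrBlDl.
  rewrite (le_lt_trans t1t2)// => /(_ isT); rewrite in_itv/= (ltW t10) lexx => /(_ isT).
  have -> : gam1 t1 = gam t1.
    by apply: (geodesic_unique t10 gf1 gf); rewrite lexx ltW.
  by rewrite (hu _ bt) subr0.
have [t20 [gam2 [gf2 bt2 _]]] := ht2.
have := hr t2; rewrite /ball/= distrC ger0_norm ?subr_ge0 ?Lle// ltrBlDl t2r => /(_ isT).
rewrite in_itv/= (ltW t20) (ltW t2t1) => /(_ isT).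
have -> : gam1 t2 = gam2 t2.
  apply: (geodesic_unique t20 (restrict_from _ _ _ gf1 t20 (ltW t2t1)) gf2).
  by rewrite lexx ltW.
by rewrite (hu _ bt2) subr0.
Qed.

End Geodesics.

(** * Iterated integrals *)

Section SigmaFiniteOf.
Context {R : realType} {d : measure_display} {T : measurableType d}.

(** An alias of [m] that carries the proof [h], so that the sigma-finite structure can be declared
    on it. *)
Definition sigma_finite_of (m : {measure set T -> \bar R}) (h : sigma_finite setT m) :
  set T -> \bar R := m.

Variables (m : {measure set T -> \bar R}) (h : sigma_finite setT m).

HB.instance Definition _ := Measure.copy (sigma_finite_of h) m.
HB.instance Definition _ := @Measure_isSigmaFinite.Build _ _ _ (sigma_finite_of h) h.

End SigmaFiniteOf.

Section BorelRowVec.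
Context {R : realType}.
Notation leb := (@lebesgue_measure R).
Notation borel d := (g_sigma_algebraType (@open 'rV[R]_d)).

Definition ratball d (p : 'rV[rat]_d * nat) : set 'rV[R]_d :=
  ball (map_mx ratr p.1 : 'rV[R]_d) (p.2.+1%:R^-1).

(** Countability is the point: the preimage of a ball under [rowcons] is a rectangle, so the
    preimage of an open set becomes a countable union of measurable rectangles. *)
Lemma open_ratballs d (U : set 'rV[R]_d) : open U ->
  U = \bigcup_(p : 'rV[rat]_d * nat) (if `[< ratball p `<=` U >] then ratball p else set0).
Proof.
move=> oU; apply/seteqP; split; last by move=> x [p _]; case: asboolP => // h; exact: h.
move=> x Ux; have /nbhs_ballP[r /= r0 hr] : nbhs x U by exact: open_nbhs_nbhs.
pose k := Num.truncn (2 / r).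
have k0 : 0 < k.+1%:R^-1 :> R by rewrite invr_gt0 ltr0n.
have kr : k.+1%:R^-1 < r / 2.
  rewrite -[r / 2]invrK ltf_pV2 ?posrE ?invr_gt0 ?divr_gt0// invf_div.
  exact: truncnS_gt.
have /choice[q hq] : forall i : 'I_d, exists q : rat, `|ratr q - x 0 i| < k.+1%:R^-1.
  move=> i; have [|q] := @rat_in_itvoo R (x 0 i - k.+1%:R^-1) (x 0 i + k.+1%:R^-1).
    by rewrite ltrBlDr -addrA ltrDl addr_gt0.
  by rewrite in_itv/= => hq; exists q; rewrite ltr_distl.
exists (\row_i q i, k) => //; case: asboolP => [_|[]].
  by apply/ball_rVP => // i; rewrite !mxE; exact: hq.
move=> y; rewrite /ratball/= => /ball_rVP-/(_ k0) hy; apply: hr; apply/ball_rVP => // i.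
have := hy i; rewrite !mxE => hy'; rewrite (splitr r).
rewrite -(subrK (ratr (q i)) (x 0 i)) -addrA (le_lt_trans (ler_normD _ _))// ltrD//.
  by rewrite distrC (lt_trans (hq i)).
exact: lt_trans kr.
Qed.

Lemma measurable_open d (U : set 'rV[R]_d) : open U -> measurable (U : set (borel d)).
Proof. by move=> oU; exact: sub_sigma_algebra. Qed.

Definition rowcons d (p : R * 'rV[R]_d) : 'rV[R]_(d.+1) := row_mx (p.1%:M : 'rV[R]_1) p.2.

Lemma rowcons0 d p : @rowcons d p 0 ord0 = p.1.
Proof.
rewrite /rowcons; have -> : ord0 = lshift d (ord0 : 'I_1) by apply/val_inj.
by rewrite (row_mxEl (p.1%:M : 'rV[R]_1)) mxE.
Qed.

Lemma rowconsS d p (i : 'I_d) : @rowcons d p 0 (lift ord0 i) = p.2 0 i.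
Proof.
rewrite /rowcons; have -> : lift ord0 i = rshift 1 i by apply/val_inj.
by rewrite (row_mxEr (p.1%:M : 'rV[R]_1)).
Qed.

Lemma ball_rowcons d (q : 'rV[R]_(d.+1)) r : 0 < r ->
  @rowcons d @^-1` ball q r = ball (q 0 ord0) r `*` ball (\row_i q 0 (lift ord0 i)) r.
Proof.
move=> r0; apply/seteqP; split => -[t z] /=.
  move/ball_rVP => /(_ r0) h; split; first by have := h ord0; rewrite rowcons0.
  by apply/ball_rVP => // i; have := h (lift ord0 i); rewrite rowconsS mxE.
move=> [h0 /ball_rVP-/(_ r0) h]; apply/ball_rVP => // i.
case: (unliftP ord0 i) => [j ->|->]; last by rewrite rowcons0.
by rewrite rowconsS; have := h j; rewrite mxE.
Qed.

Lemma measurable_rowcons d :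
  measurable_fun setT (@rowcons d : (measurableTypeR R * borel d)%type -> borel d.+1).
Proof.
have H : @measurable _ (borel d.+1) = <<s (@open 'rV[R]_(d.+1) : set (set (borel d.+1))) >>.
  by [].
have := @measurability _ _ (measurableTypeR R * borel d)%type (borel d.+1) setT (@rowcons d) _ H.
apply.
move=> _ [U oU <-]; rewrite setTI (open_ratballs oU) preimage_bigcup.
apply: countable_bigcupT_measurable; first exact: countableP.
move=> p; case: asboolP => _; last by rewrite preimage_set0.
rewrite /ratball ball_rowcons ?invr_gt0//; apply: measurableX.
  exact: measurable_ball.
by apply: measurable_open; exact: ball_open.
Qed.

(** Realizes [iter_integral] as integration against a measure: the product of the measure on the
    line with that of dimension [d] is pushed forward by [rowcons]. Finiteness on balls is carried
    along because it gives the sigma-finiteness that Tonelli's theorem requires at the next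
    dimension. *)
Lemma lebesgue_rowvec d : exists lam : {sigma_finite_measure set (borel d) -> \bar R},
  (forall r : R, (lam (ball (0%R : 'rV[R]_d) r) < +oo)%E) /\
  forall f : borel d -> \bar R, measurable_fun setT f -> (forall x, 0 <= f x)%E ->
    (\int[lam]_x f x)%E = iter_integral (f : 'rV[R]_d -> \bar R).
Proof.
elim: d => [|d [lam [lamfin IH]]].
  exists (dirac (0 : borel 0)); split.
    by move=> r; rewrite /dirac ltry.
  move=> f mf f0; rewrite integral_dirac// diracT mul1e.
  by [].
pose m := measure_function_pushforward__canonical__measure_function_Measure
  (product_measure1 leb lam : {measure set (measurableTypeR R * borel d)%type -> \bar R}) (@measurable_rowcons d).
have mfin (r : R) : (m (ball (0%R : 'rV[R]_d.+1) r) < +oo)%E.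
  rewrite /m/= /pushforward; have [r0|r0] := ltP 0 r; last first.
    have -> : ball (0 : 'rV[R]_d.+1) r = set0.
      by apply/seteqP; split => // x; move=> [r0' _]; move: r0'; rewrite ltNge r0.
    by rewrite preimage_set0 measure0.
  rewrite ball_rowcons// product_measure1E//; last 2 first.
    exact: measurable_ball.
    by apply: measurable_open; exact: ball_open.
  have hb := @lebesgue_measure_ball R ((0 : 'rV[R]_d.+1) 0 ord0) r (ltW r0).
  have -> : (\row_i (0 : 'rV[R]_d.+1) 0 (lift ord0 i)) = 0 :> 'rV[R]_d.
    by apply/rowP => i; rewrite !mxE.
  apply: lte_mul_pinfty; last exact: lamfin.
    exact: measure_ge0.
  have : ((r *+ 2)%:E : \bar R) \is a fin_num by [].
  by rewrite -hb.
have msf : sigma_finite setT m.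
  exists (fun k => ball (0 : 'rV[R]_d.+1) k.+1%:R).
    apply/seteqP; split => // x _; exists (Num.truncn (\sum_i `|(x : 'rV[R]_d.+1) 0 i|)) => //.
    apply/ball_rVP => // i; rewrite mxE sub0r normrN (le_lt_trans _ (truncnS_gt _))//.
    by rewrite (bigD1 i)//= lerDl sumr_ge0.
  by move=> k; split; [apply: measurable_open; exact: ball_open|exact: mfin].
pose m' : {sigma_finite_measure set (borel d.+1) -> \bar R} := sigma_finite_of msf.
exists m'; split; first exact: mfin.
move=> f mf f0.
have mfr : measurable_fun setT (f \o @rowcons d : (measurableTypeR R * borel d)%type -> \bar R).
  exact: measurableT_comp mf (@measurable_rowcons d).
pose pm : {measure set (measurableTypeR R * borel d)%type -> \bar R} := product_measure1 leb lam.
have e1 := @ge0_integral_pushforward _ _ _ _ _ _ (@measurable_rowcons d) pm setT f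
  measurableT mf (fun x _ => f0 x).
rewrite preimage_setT in e1.
have e2 := @fubini_tonelli1 _ _ _ _ R leb lam (f \o @rowcons d) mfr (fun x => f0 _).
apply: (etrans e1); apply: (etrans e2) => /=.
apply: eq_integral => t _; rewrite /fubini_F IH//.
  by apply: measurableT_comp mfr _; exact: pair1_measurable.
by move=> x; exact: f0.
Qed.

End BorelRowVec.

(** * Iterated integrals of continuous functions over boxes *)

Section IteratedItg.
Context {R : realType}.

Lemma near_uniform_itv_top (X : topologicalType) (f : X -> R -> R) a b :
  continuous (fun p => f p.1 p.2) -> forall x e, 0 < e ->
  \forall x' \near x, forall y, a <= y <= b -> `|f x' y - f x y| <= e.
Proof.
move=> cf x e e0; apply: near_uniform_itv => //.
- by move=> y _; exact: (cf (x, y)).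
- exact: continuous_curry1.
Qed.

Lemma cts_itg_ub2 (X : topologicalType) (f : X -> R -> R) (u : X -> R) a :
  continuous (fun p => f p.1 p.2) -> continuous u ->
  continuous (fun x => itg a (u x) (f x)).
Proof.
move=> cf cu x; apply/cvgrPdist_le => e e0.
have e2 : 0 < e / 2 by rewrite divr_gt0.
have c1 := continuous_curry1 cf.
have H1 : \forall x' \near x, `|itg a (u x) (f x) - itg a (u x') (f x)| <= e / 2.
  have H : continuous (fun y => itg a (u y) (f x)).
    exact: (cts_comp cu (continuous_itg_ub (a := a) (c1 x))).
  by have /cvgrPdist_le/(_ _ e2) := H x.
pose b := Num.max a (u x + 1).
have ab : a <= b by rewrite le_max lexx.
have H2 : \forall x' \near x, u x' <= b.
  have /cvgrPdist_le/(_ _ ltr01) := cu x; apply: filterS => y.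
  rewrite ler_distl => /andP[h _]; rewrite le_max; apply/orP; right.
  by rewrite -lerBlDr.
have e3 : 0 < e / 2 / (b - a + 1) by rewrite !divr_gt0// ltr_wpDl// subr_ge0.
have H3 := @near_uniform_itv_top X f a b cf x _ e3.
apply: filterS3 H1 H2 H3 => y h1 h2 h3.
have -> : itg a (u x) (f x) - itg a (u y) (f y) =
  (itg a (u x) (f x) - itg a (u y) (f x)) + (itg a (u y) (f x) - itg a (u y) (f y)) by ring.
rewrite (le_trans (ler_normD _ _))// [leRHS]splitr lerD//.
have [ya|ay] := ltP (u y) a; first by rewrite !itg_gt// subrr normr0 ltW.
rewrite -itgB//; apply: (@le_trans _ _ ((u y - a) * (e / 2 / (b - a + 1)))).
  apply: norm_itg_le => //; first exact: ctsB.
  by move=> t /andP[at' ty]; rewrite distrC h3// at' (le_trans ty).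
rewrite mulrCA ger_pMr// ler_pdivrMr ?ltr_wpDl ?subr_ge0// mul1r.
by rewrite ler_wpDr// lerD2r.
Qed.

Definition rtail d (a : 'rV[R]_d.+1) : 'rV[R]_d := \row_i a 0 (lift ord0 i).

Definition in_box d (a b z : 'rV[R]_d) := forall i, a 0 i <= z 0 i <= b 0 i.

Lemma in_box_rowcons d (a b : 'rV[R]_d.+1) t z :
  in_box a b (rowcons (t, z)) <-> (a 0 ord0 <= t <= b 0 ord0) /\ in_box (rtail a) (rtail b) z.
Proof.
split=> [h|[h0 h] i]; first split.
- by have := h ord0; rewrite rowcons0.
- by move=> i; have := h (lift ord0 i); rewrite rowconsS !mxE.
- case: (unliftP ord0 i) => [j ->|->]; last by rewrite rowcons0.
  by rewrite rowconsS; have := h j; rewrite !mxE.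
Qed.

Lemma rowconsK d (z : 'rV[R]_d.+1) : rowcons (z 0 ord0, rtail z) = z.
Proof.
apply/rowP => i; case: (unliftP ord0 i) => [j ->|->]; last by rewrite rowcons0.
by rewrite rowconsS mxE.
Qed.

Lemma cts_rowcons d (X : topologicalType) (u : X -> R) (v : X -> 'rV[R]_d) :
  continuous u -> continuous v -> continuous (fun x => rowcons (u x, v x)).
Proof.
move=> cu cv; apply: cts_rV => i; case: (unliftP ord0 i) => [j ->|->].
  under eq_fun do rewrite rowconsS.
  exact: (cts_comp cv (@cts_coord R d j)).
by under eq_fun do rewrite rowcons0.
Qed.

(** The real-valued counterpart of [iter_integral] on a box: for continuous integrands, linearity,
    monotonicity and exchange of integrals follow from the one-variable case without measure theory
    on [R^d]. *)
Fixpoint ritg d : 'rV[R]_d -> 'rV[R]_d -> ('rV[R]_d -> R) -> R :=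
  match d return 'rV[R]_d -> 'rV[R]_d -> ('rV[R]_d -> R) -> R with
  | 0%N => fun _ _ h => h 0
  | d'.+1 => fun a b h => itg (a 0 ord0) (b 0 ord0)
      (fun t => ritg (rtail a) (rtail b) (fun z => h (rowcons (t, z))))
  end.

Definition box d (a b : 'rV[R]_d) := forall i, a 0 i < b 0 i.

Lemma box_tail d (a b : 'rV[R]_d.+1) : box a b -> box (rtail a) (rtail b).
Proof. by move=> h i; rewrite !mxE. Qed.

Lemma cts_ritg d (a b : 'rV[R]_d) (X : topologicalType) (h : X -> 'rV[R]_d -> R) :
  box a b -> continuous (fun p => h p.1 p.2) -> continuous (fun x => ritg a b (h x)).
Proof.
elim: d a b X h => [|d IH] a b X h ab ch /=; first exact: (continuous_curry2 ch).
apply: continuous_itg_param; first exact/ltW.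
apply: (IH _ _ (X * R)%type (fun p z => h p.1 (rowcons (p.2, z))) (box_tail ab)).
apply: (cts_comp2 ch); first exact: (cts_comp (@cts_fst _ _) (@cts_fst _ _)).
by apply: cts_rowcons; [exact: (cts_comp (@cts_fst _ _) (@cts_snd _ _))|exact: cts_snd].
Qed.

Lemma cts_ritg_section d (a b : 'rV[R]_d.+1) (h : 'rV[R]_d.+1 -> R) :
  box a b -> continuous h ->
  continuous (fun t => ritg (rtail a) (rtail b) (fun z => h (rowcons (t, z)))).
Proof.
move=> ab ch; apply: cts_ritg; first exact: box_tail.
by apply: (cts_comp _ ch); apply: cts_rowcons; [exact: cts_fst|exact: cts_snd].
Qed.

Lemma cts_section d (h : 'rV[R]_d.+1 -> R) t : continuous h ->
  continuous (fun z => h (rowcons (t, z))).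
Proof.
by move=> ch; apply: (cts_comp _ ch); apply: cts_rowcons; [exact: cts_cst|exact: cts_id].
Qed.

Lemma eq_ritg d (a b : 'rV[R]_d) h k : (forall z, in_box a b z -> h z = k z) ->
  ritg a b h = ritg a b k.
Proof.
elim: d a b h k => [|d IH] a b h k hk /=; first by apply: hk => -[].
apply: eq_itg => t tab; apply: IH => z zab; apply: hk.
exact/in_box_rowcons.
Qed.

Lemma ritgD d (a b : 'rV[R]_d) h k : box a b -> continuous h -> continuous k ->
  ritg a b (fun z => h z + k z) = ritg a b h + ritg a b k.
Proof.
elim: d a b h k => [//|d IH] a b h k ab ch ck /=.
rewrite -itgD; [|exact: cts_ritg_section|exact: cts_ritg_section].
by apply: eq_itg => t _; apply: IH; [exact: box_tail|exact: cts_section|exact: cts_section].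
Qed.

Lemma ritgZ d (a b : 'rV[R]_d) h (k : R) : box a b -> continuous h ->
  ritg a b (fun z => k * h z) = k * ritg a b h.
Proof.
elim: d a b h => [//|d IH] a b h ab ch /=.
rewrite -itgZ; last exact: cts_ritg_section.
by apply: eq_itg => t _; apply: IH; [exact: box_tail|exact: cts_section].
Qed.

Lemma le_ritg d (a b : 'rV[R]_d) h k : box a b -> continuous h -> continuous k ->
  (forall z, in_box a b z -> h z <= k z) -> ritg a b h <= ritg a b k.
Proof.
elim: d a b h k => [|d IH] a b h k ab ch ck hk /=; first by apply: hk => -[].
apply: le_itg; [exact: cts_ritg_section|exact: cts_ritg_section|].
move=> t tab; apply: IH; [exact: box_tail|exact: cts_section|exact: cts_section|].
by move=> z zab; apply: hk; exact/in_box_rowcons.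
Qed.

Lemma ritg_ge0 d (a b : 'rV[R]_d) h : (forall z, in_box a b z -> 0 <= h z) ->
  0 <= ritg a b h.
Proof.
elim: d a b h => [|d IH] a b h h0 /=; first by apply: h0 => -[].
apply: itg_ge0 => t tab; apply: IH => z zab; apply: h0.
exact/in_box_rowcons.
Qed.

Lemma ritg_cst d (a b : 'rV[R]_d) (k : R) : box a b ->
  ritg a b (fun=> k) = ritg a b (fun=> 1) * k.
Proof.
move=> ab; rewrite mulrC -ritgZ//; last exact: cts_cst.
by apply: eq_ritg => z _; rewrite mulr1.
Qed.

Lemma ritg1_gt0 d (a b : 'rV[R]_d) : box a b -> 0 < ritg a b (fun=> 1).
Proof.
elim: d a b => [//|d IH] a b ab /=; rewrite itg_cst; last exact/ltW.
by rewrite mulr_gt0// ?subr_gt0// IH//; exact: box_tail.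
Qed.

Lemma ritg_eq0 d (a b : 'rV[R]_d) (h : 'rV[R]_d -> R) : box a b -> continuous h ->
  (forall z, in_box a b z -> 0 <= h z) -> ritg a b h = 0 ->
  forall z, in_box a b z -> h z = 0.
Proof.
elim: d a b h => [|d IH] a b h ab ch h0 /=.
  by move=> hz z _; rewrite (_ : z = 0)//; apply/rowP => -[].
move=> e z; rewrite -(rowconsK z) => /in_box_rowcons[tab zab].
apply: (IH _ _ _ (box_tail ab) (cts_section (t := z 0 ord0) ch)) zab.
  by move=> y yab; apply: h0; exact/in_box_rowcons.
apply: (itg_eq0 _ (ab ord0) _ e tab); first exact: cts_ritg_section.
move=> t t'ab; apply: ritg_ge0 => y yab; apply: h0; exact/in_box_rowcons.
Qed.

Lemma ritg_itg_swap d (a b : 'rV[R]_d) (u v : R) (h : R -> 'rV[R]_d -> R) :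
  box a b -> u <= v -> continuous (fun p => h p.1 p.2) ->
  ritg a b (fun z => itg u v (h ^~ z)) = itg u v (fun s => ritg a b (h s)).
Proof.
elim: d a b h => [//|d IH] a b h ab uv ch /=.
have ch3 : continuous (fun p : (R * R) * 'rV[R]_d => h p.1.1 (rowcons (p.1.2, p.2))).
  apply: (cts_comp2 ch); first exact: (cts_comp (@cts_fst _ _) (@cts_fst _ _)).
  apply: cts_rowcons; [exact: (cts_comp (@cts_fst _ _) (@cts_snd _ _))|exact: cts_snd].
transitivity (itg (a 0 ord0) (b 0 ord0) (fun t => itg u v (fun s =>
    ritg (rtail a) (rtail b) (fun z => h s (rowcons (t, z)))))).
  apply: eq_itg => t _; apply: IH => //; first exact: box_tail.
  apply: (cts_comp2 ch); first exact: cts_fst.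
  by apply: cts_rowcons; [exact: cts_cst|exact: cts_snd].
apply: itg_Fubini => //; first exact/ltW.
apply: (cts_ritg (X := (R * R)%type)
  (h := fun p z => h p.2 (rowcons (p.1, z))) (box_tail ab)).
apply: (cts_comp2 ch); first exact: (cts_comp (@cts_fst _ _) (@cts_snd _ _)).
by apply: cts_rowcons; [exact: (cts_comp (@cts_fst _ _) (@cts_fst _ _))|exact: cts_snd].
Qed.

Definition upd d (z : 'rV[R]_d) i s := line z i (s - z 0 i).

Lemma updE d (z : 'rV[R]_d) i s j : upd z i s 0 j = if j == i then s else z 0 j.
Proof. by rewrite /upd lineE; case: eqP => [->|//]; rewrite addrC subrK. Qed.

Lemma upd_upd d (z : 'rV[R]_d) i s t : upd (upd z i s) i t = upd z i t.
Proof. by apply/rowP => j; rewrite !updE; case: eqP. Qed.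

Lemma updC d (z : 'rV[R]_d) i j s t : i != j -> upd (upd z i s) j t = upd (upd z j t) i s.
Proof.
move=> ij; apply/rowP => k; rewrite !updE; case: (eqVneq k j) => [->|//].
by rewrite eq_sym (negbTE ij).
Qed.

Lemma upd_id d (z : 'rV[R]_d) i : upd z i (z 0 i) = z.
Proof. by apply/rowP => j; rewrite updE; case: eqP => [->|]. Qed.

Lemma upd_box d (a b z : 'rV[R]_d) i s : in_box a b z -> a 0 i <= s <= b 0 i ->
  in_box a b (upd z i s).
Proof. by move=> zab sab j; rewrite updE; case: eqP => [->|]. Qed.

Lemma cts_upd d (X : topologicalType) (f : X -> 'rV[R]_d) (g : X -> R) i :
  continuous f -> continuous g -> continuous (fun x => upd (f x) i (g x)).
Proof.
move=> cf cg; apply: cts_line => //; apply: ctsB => //.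
exact: (cts_comp cf (@cts_coord R d i)).
Qed.

Lemma cts_upd2 d (h : 'rV[R]_d -> R) i : continuous h ->
  continuous (fun p => h (upd p.1 i p.2)).
Proof. by move=> ch; apply: (cts_comp _ ch); apply: cts_upd; [exact: cts_fst|exact: cts_snd]. Qed.

Definition avg d (a b : 'rV[R]_d) i (h : 'rV[R]_d -> R) z :=
  (b 0 i - a 0 i)^-1 * itg (a 0 i) (b 0 i) (fun s => h (upd z i s)).

Definition prim d (a : 'rV[R]_d) i (h : 'rV[R]_d -> R) (z : 'rV[R]_d) :=
  itg (a 0 i) (z 0 i) (fun s => h (upd z i s)).

Lemma cts_avg d (a b : 'rV[R]_d) i h : box a b -> continuous h -> continuous (avg a b i h).
Proof.
move=> ab ch; apply: ctsM; first exact: cts_cst.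
by apply: continuous_itg_param; [exact/ltW|exact: cts_upd2].
Qed.

Lemma cts_prim d (a : 'rV[R]_d) i h : continuous h -> continuous (prim a i h).
Proof. by move=> ch; apply: cts_itg_ub2; [exact: cts_upd2|exact: cts_coord]. Qed.

(** This makes averaging a contraction of the [L^1] norm. When [i] is the first coordinate it
    amounts to exchanging integrals; otherwise one descends to the remaining coordinates. *)
Lemma ritg_avg d (a b : 'rV[R]_d) i h : box a b -> continuous h ->
  ritg a b (avg a b i h) = ritg a b h.
Proof.
elim: d a b i h => [|d IH] a b i h ab ch /=; first by case: i.
have l0 : b 0 i - a 0 i != 0 by rewrite subr_eq0 gt_eqF.
have ch2 : continuous (fun p => h (rowcons (p.1, p.2))).
  by apply: (cts_comp _ ch); apply: cts_rowcons; [exact: cts_fst|exact: cts_snd].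
case: (unliftP ord0 i) => [j ij|i0].
  apply: eq_itg => t _.
  rewrite -(IH _ _ j _ (box_tail ab) (cts_section (t := t) ch)).
  apply: eq_ritg => z _; rewrite /avg !mxE -ij; congr (_ * _).
  apply: eq_itg => s _; congr h; apply/rowP => k.
  case: (unliftP ord0 k) => [k' ->|->]; rewrite updE.
    by rewrite ij (inj_eq lift_inj) !rowconsS updE.
  by rewrite ij (negbTE (neq_lift _ _)) !rowcons0.
rewrite i0 in l0 *.
have e t : ritg (rtail a) (rtail b) (fun z => avg a b ord0 h (rowcons (t, z))) =
  (b 0 ord0 - a 0 ord0)^-1 * itg (a 0 ord0) (b 0 ord0)
    (fun s => ritg (rtail a) (rtail b) (fun z => h (rowcons (s, z)))).
  rewrite -ritg_itg_swap//; [|exact: box_tail|exact/ltW].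
  rewrite -ritgZ; [|exact: box_tail|]; last first.
    apply: continuous_itg_param; first exact/ltW.
    by apply: (cts_comp _ ch); apply: cts_rowcons; [exact: cts_snd|exact: cts_fst].
  apply: eq_ritg => z _; rewrite /avg; congr (_ * _); apply: eq_itg => s _.
  congr h; apply/rowP => k; rewrite updE.
  case: (unliftP ord0 k) => [k' ->|->]; last by rewrite eqxx rowcons0.
  by rewrite eq_sym (negbTE (neq_lift _ _)) !rowconsS.
under eq_fun do rewrite e.
by rewrite itg_cst ?mulrA ?mulfV ?mul1r//; exact/ltW.
Qed.

End IteratedItg.

(** * Potentials on a box *)

Section LocalPotential.
Context {R : realType} {d : nat}.
Variables (a b : 'rV[R]_d).
Hypothesis ab : box a b.
Implicit Types (h : 'rV[R]_d -> R) (z : 'rV[R]_d) (i j : 'I_d).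

Definition norm1 h := ritg a b (fun z => `|h z|).

Lemma norm1_ge0 h : 0 <= norm1 h.
Proof. by apply: ritg_ge0 => z _. Qed.

Lemma eq_norm1 h (k : 'rV[R]_d -> R) : (forall z, in_box a b z -> h z = k z) -> norm1 h = norm1 k.
Proof. by move=> hk; apply: eq_ritg => z zab; rewrite hk. Qed.

Lemma norm1D h (k : 'rV[R]_d -> R) : continuous h -> continuous k ->
  norm1 (fun z => h z + k z) <= norm1 h + norm1 k.
Proof.
move=> ch ck; rewrite -ritgD//; [|exact: cts_norm|exact: cts_norm].
apply: le_ritg => //; first by apply: cts_norm; exact: ctsD.
  by apply: ctsD; exact: cts_norm.
by move=> z _; exact: ler_normD.
Qed.

Lemma norm1N h : norm1 (fun z => - h z) = norm1 h.
Proof. by apply: eq_ritg => z _; rewrite normrN. Qed.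

Lemma norm1B h (k : 'rV[R]_d -> R) : continuous h -> continuous k ->
  norm1 (fun z => h z - k z) <= norm1 h + norm1 k.
Proof. by move=> ch ck; rewrite -(norm1N k) norm1D//; exact: ctsN. Qed.

Lemma norm1_eq0 h : continuous h -> norm1 h = 0 -> forall z, in_box a b z -> h z = 0.
Proof.
move=> ch h0 z zab; apply/eqP; rewrite -normr_eq0; apply/eqP.
by apply: (ritg_eq0 ab (cts_norm ch)) zab => // y _.
Qed.

Definition len i := b 0 i - a 0 i.

Lemma len_gt0 i : 0 < len i. Proof. by rewrite subr_gt0. Qed.

Local Notation avg := (avg a b).
Local Notation prim := (prim a).

Lemma cts_updz h i z : continuous h -> continuous (fun s : R => h (upd z i s)).
Proof.
move=> ch; apply: (cts_comp _ ch); apply: cts_upd; last exact: cts_id.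
by move=> s; exact: cvg_cst.
Qed.

Lemma eq_avg i h (k : 'rV[R]_d -> R) z : in_box a b z -> (forall z, in_box a b z -> h z = k z) ->
  avg i h z = avg i k z.
Proof.
by move=> zab hk; congr (_ * _); apply: eq_itg => s sab; apply: hk; exact: upd_box.
Qed.

Lemma avgD i h (k : 'rV[R]_d -> R) z : continuous h -> continuous k ->
  avg i (fun z => h z + k z) z = avg i h z + avg i k z.
Proof. by move=> ch ck; rewrite /avg itgD ?mulrDr//; exact: cts_updz. Qed.

Lemma avgB i h (k : 'rV[R]_d -> R) z : continuous h -> continuous k ->
  avg i (fun z => h z - k z) z = avg i h z - avg i k z.
Proof. by move=> ch ck; rewrite /avg itgB ?mulrBr//; exact: cts_updz. Qed.

Lemma primB i h (k : 'rV[R]_d -> R) z : continuous h -> continuous k ->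
  prim i (fun z => h z - k z) z = prim i h z - prim i k z.
Proof. by move=> ch ck; rewrite /prim itgB//; exact: cts_updz. Qed.

Lemma avg_upd i h z s : avg i h (upd z i s) = avg i h z.
Proof. by congr (_ * _); apply: eq_itg => t _; rewrite upd_upd. Qed.

Lemma prim_upda i h z : prim i h (upd z i (a 0 i)) = 0.
Proof. by rewrite /prim updE eqxx itgaa. Qed.

Lemma norm_avg_le i h z : continuous h -> `|avg i h z| <= avg i (fun z => `|h z|) z.
Proof.
move=> ch; rewrite normrM ger0_norm ?invr_ge0 ?(ltW (len_gt0 i))//.
rewrite ler_wpM2l ?invr_ge0 ?(ltW (len_gt0 i))//; apply: abs_itg; exact: cts_updz.
Qed.

Lemma norm_prim_le i h z : continuous h -> in_box a b z ->
  `|prim i h z| <= len i * avg i (fun z => `|h z|) z.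
Proof.
move=> ch zab; rewrite /avg mulrA mulfV ?gt_eqF ?len_gt0// mul1r.
have /andP[az zb] := zab i.
have cn : continuous (fun s => `|h (upd z i s)|) by apply: cts_norm; exact: cts_updz.
rewrite (le_trans (abs_itg _ _ (@cts_updz h i z ch)))//.
rewrite [leRHS](@itg_split _ _ _ (z 0 i))// lerDl; exact: itg_ge0.
Qed.

Lemma norm1_avg i h : continuous h -> norm1 (avg i h) <= norm1 h.
Proof.
move=> ch; rewrite /norm1 -(ritg_avg i ab (cts_norm ch)); apply: le_ritg => //.
- by apply: cts_norm; exact: cts_avg.
- by apply: cts_avg => //; exact: cts_norm.
- by move=> z _; exact: norm_avg_le.
Qed.

Lemma norm1_prim i h : continuous h -> norm1 (prim i h) <= len i * norm1 h.
Proof.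
move=> ch; rewrite /norm1 -(ritg_avg i ab (cts_norm ch)).
have ca : continuous (avg i (fun z => `|h z|)) by apply: cts_avg => //; exact: cts_norm.
rewrite -ritgZ//; apply: le_ritg => //.
- by apply: cts_norm; exact: cts_prim.
- by apply: ctsM => //; exact: cts_cst.
- by move=> z zab; exact: norm_prim_le.
Qed.

(* If h is the i-th partial derivative of f, then f = avg i f + osc i h; both operators are
   bounded in L^1. *)
Definition osc i h z := prim i h z - avg i (prim i h) z.

Lemma cts_osc i h : continuous h -> continuous (osc i h).
Proof. by move=> ch; apply: ctsB; [exact: cts_prim|apply: cts_avg => //; exact: cts_prim]. Qed.

Lemma oscB i h (k : 'rV[R]_d -> R) z : continuous h -> continuous k ->
  osc i (fun z => h z - k z) z = osc i h z - osc i k z.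
Proof.
move=> ch ck; rewrite /osc primB//.
have -> : avg i (prim i (fun z => h z - k z)) z = avg i (prim i h) z - avg i (prim i k) z.
  rewrite -avgB; [|exact: cts_prim|exact: cts_prim].
  by congr (_ * _); apply: eq_itg => s _; rewrite primB.
by ring.
Qed.

Lemma norm1_osc i h : continuous h -> norm1 (osc i h) <= 2 * len i * norm1 h.
Proof.
move=> ch; have cp := @cts_prim R d a i h ch.
rewrite (le_trans (norm1B cp (@cts_avg _ _ a b i _ ab cp)))//.
have := norm1_avg i cp; have := norm1_prim i ch.
set x := norm1 (prim i h); set y := norm1 (avg i _); set w := norm1 h => h1 h2.
have -> : 2 * len i * w = len i * w + len i * w by ring.
by rewrite lerD// (le_trans h2).
Qed.

Fixpoint avgs (l : seq 'I_d) h := if l is i :: l' then avg i (avgs l' h) else h.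

(** Iterating [f = avg i f + osc i (D i)] over the directions in [l] gives
    [f = avgs l f + remainder l D]. The remainder depends on the derivatives only. *)
Fixpoint remainder (l : seq 'I_d) (D : 'I_d -> 'rV[R]_d -> R) : 'rV[R]_d -> R :=
  if l is i :: l' then fun z => avg i (remainder l' D) z + osc i (D i) z else fun=> 0.

Lemma cts_avgs l h : continuous h -> continuous (avgs l h).
Proof. by move=> ch; elim: l => [//|i l IH]; exact: cts_avg. Qed.

Lemma cts_remainder l D : (forall i, continuous (D i)) -> continuous (remainder l D).
Proof.
move=> cD; elim: l => [|i l IH]; first exact: cts_cst.
by apply: ctsD; [exact: cts_avg|exact: cts_osc].
Qed.

Lemma norm1_avgs l h : continuous h -> norm1 (avgs l h) <= norm1 h.
Proof.
move=> ch; elim: l => [//|i l IH]; apply: le_trans IH.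
by apply: norm1_avg; exact: cts_avgs.
Qed.

Lemma avgsB l h (k : 'rV[R]_d -> R) z : continuous h -> continuous k ->
  avgs l (fun z => h z - k z) z = avgs l h z - avgs l k z.
Proof.
move=> ch ck; elim: l z => [//|i l IH] z /=.
rewrite -avgB; [|exact: cts_avgs|exact: cts_avgs].
by congr (_ * _); apply: eq_itg => s _; rewrite IH.
Qed.

Lemma avgs_upd l h i z s : i \in l -> avgs l h (upd z i s) = avgs l h z.
Proof.
elim: l z => [//|j l IH] z; rewrite inE => /orP[/eqP ->|il] /=; first exact: avg_upd.
have [->|ij] := eqVneq i j; first exact: avg_upd.
by congr (_ * _); apply: eq_itg => t _; rewrite updC// IH.
Qed.

(** Averaging in direction [i] removes the dependence on coordinate [i], and later averages do not
    restore it; [z] is joined to [y] by a staircase. *)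
Lemma avgs_enum_cst h z y : avgs (enum 'I_d) h y = avgs (enum 'I_d) h z.
Proof.
have H k : (k <= d)%N -> avgs (enum 'I_d) h (mix k y z) = avgs (enum 'I_d) h z.
  elim: k => [|k IH] kd; first by rewrite mix0.
  rewrite -(IH (ltnW kd)) (mixS (Ordinal kd)).
  have -> : line (mix k y z) (Ordinal kd) (y 0 (Ordinal kd) - z 0 (Ordinal kd)) =
            upd (mix k y z) (Ordinal kd) (y 0 (Ordinal kd)).
    by rewrite /upd !mxE ltnn.
  by rewrite avgs_upd// mem_enum.
by rewrite -(H d (leqnn d)) mixd.
Qed.

Variables (alpha : 'I_d -> 'rV[R]_d -> R) (f : nat -> 'rV[R]_d -> R)
  (D : nat -> 'I_d -> 'rV[R]_d -> R).
Hypothesis (calpha : forall i, continuous (alpha i)) (cf : forall k, continuous (f k))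
  (cD : forall k i, continuous (D k i)).
Hypothesis fD : forall k i z, in_box a b z ->
  f k z = f k (upd z i (a 0 i)) + prim i (D k i) z.
Hypothesis Dalpha : forall i, norm1 (fun z => D k i z - alpha i z) @[k --> \oo] --> 0.
Hypothesis fcauchy : forall e, 0 < e -> exists N, forall k l, (N <= k)%N -> (N <= l)%N ->
  norm1 (fun z => f k z - f l z) <= e.

Lemma avg_osc k i z : in_box a b z -> f k z = avg i (f k) z + osc i (D k i) z.
Proof.
move=> zab.
have e : avg i (f k) z = f k (upd z i (a 0 i)) + avg i (prim i (D k i)) z.
  rewrite (@eq_avg i _ (fun y => f k (upd y i (a 0 i)) + prim i (D k i) y))//; last first.
    by move=> y yab; exact: fD.
  have cfu : continuous (fun y => f k (upd y i (a 0 i))).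
    by apply: (cts_comp _ (@cf k)); apply: cts_upd; [exact: cts_id|exact: cts_cst].
  have cpr : continuous (prim i (D k i)) by exact: cts_prim.
  rewrite avgD//.
  congr (_ + _); rewrite /avg (@eq_itg _ _ _ _ (fun=> f k (upd z i (a 0 i)))).
    by rewrite itg_cst ?(ltW (ab i))// mulrA mulVf ?mul1r// gt_eqF// len_gt0.
  by move=> s _; rewrite upd_upd.
by rewrite {1}(fD k i zab) e /osc; ring.
Qed.

Lemma avgs_remainder k l z : in_box a b z -> f k z = avgs l (f k) z + remainder l (D k) z.
Proof.
elim: l z => [|i l IH] z zab /=; first by rewrite addr0.
have c1 : continuous (avgs l (f k)) := cts_avgs (l := l) (@cf k).
have c2 : continuous (remainder l (D k)) := cts_remainder (l := l) (@cD k).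
have e : avg i (f k) z = avg i (avgs l (f k)) z + avg i (remainder l (D k)) z.
  by rewrite -avgD//; exact: eq_avg.
by rewrite addrA -e; exact: avg_osc.
Qed.

Lemma squeeze0 (u v : nat -> R) : (forall k, 0 <= u k) -> (forall k, u k <= v k) ->
  v k @[k --> \oo] --> 0 -> u k @[k --> \oo] --> 0.
Proof.
move=> u0 uv v0; apply: (@squeeze_cvgr _ _ _ _ (fun=> 0) v) => //.
  by apply: nearW => k; rewrite u0 uv.
exact: cvg_cst.
Qed.

Lemma norm1_remainder l :
  norm1 (fun z => remainder l (D k) z - remainder l alpha z) @[k --> \oo] --> 0.
Proof.
elim: l => [|i l IH] /=.
  apply: (@cvg_trans _ ((fun=> 0) k @[k --> \oo])); last exact: cvg_cst.
  apply: near_eq_cvg; apply: nearW => k /=.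
  rewrite -(mulr0 (ritg a b (fun=> 1))) -ritg_cst//; apply: eq_ritg => z _.
  by rewrite subrr normr0.
apply: (@squeeze0 _ (fun k =>
    norm1 (fun z => remainder l (D k) z - remainder l alpha z) +
    2 * len i * norm1 (fun z => D k i z - alpha i z))).
- by move=> k; exact: norm1_ge0.
- move=> k; have cR : continuous (remainder l (D k)) := cts_remainder (l := l) (@cD k).
  have ca : continuous (remainder l alpha) := cts_remainder (l := l) calpha.
  rewrite (@eq_norm1 _ (fun z => avg i (fun z => remainder l (D k) z - remainder l alpha z) z +
     osc i (fun z => D k i z - alpha i z) z)); last first.
    by move=> z _; rewrite avgB// oscB//; ring.
  rewrite (le_trans (norm1D _ _))//.
  + by apply: cts_avg => //; exact: ctsB.
  + by apply: cts_osc; exact: ctsB.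
  + by rewrite lerD//; [apply: norm1_avg; exact: ctsB|apply: norm1_osc; exact: ctsB].
- rewrite -[X in _ --> X](addr0 0); apply: cvgD => //.
  rewrite -[X in _ --> X](mulr0 (2 * len i)); apply: cvgM; first exact: cvg_cst.
  exact: Dalpha.
Qed.

(** [f k] is a constant [c k] plus [remainder l (D k)]. The constants form a Cauchy sequence because
    averaging contracts the [L^1] norm, and the remainders tend in [L^1] to the continuous function
    [remainder l alpha]; hence the limit [w] is continuous. Its identities are those of [f k] passed
    to the limit in [L^1], then read pointwise by continuity. *)
Lemma local_potential : exists w : 'rV[R]_d -> R,
  [/\ continuous w, norm1 (fun z => f k z - w z) @[k --> \oo] --> 0,
      forall i z, in_box a b z -> w z = w (upd z i (a 0 i)) + prim i (alpha i) z &
      forall i, (forall k z, in_box a b z -> f k (upd z i (a 0 i)) = 0) ->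
        forall z, in_box a b z -> w (upd z i (a 0 i)) = 0].
Proof.
pose l := enum 'I_d.
pose c k := avgs l (f k) a.
have cE k z : avgs l (f k) z = c k by exact: avgs_enum_cst.
have V0 := ritg1_gt0 ab.
set V := ritg a b (fun=> 1) in V0.
have ccauchy k m : V * `|c k - c m| <= norm1 (fun z => f k z - f m z).
  have := norm1_avgs l (ctsB (@cf k) (@cf m)); apply: le_trans.
  rewrite (@eq_norm1 _ (fun=> c k - c m)); first by rewrite /norm1 ritg_cst.
  by move=> z _; rewrite avgsB// !cE.
have cc : cvg (c k @[k --> \oo]).
  apply/cauchy_cvgP; apply/cauchy_exP => e e0.
  have [N hN] := fcauchy (mulr_gt0 V0 (divr_gt0 e0 (ltr0Sn R 1))).
  exists (c N); exists N => // k /= Nk; rewrite /ball/=.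
  have := le_trans (ccauchy N k) (hN N k (leqnn N) Nk).
  rewrite ler_pM2l// => /le_lt_trans; apply.
  by rewrite ltr_pdivrMr// ltr_pMr// ltr1n.
pose c0 := lim (c k @[k --> \oo]).
pose w z := remainder l alpha z + c0.
have cw : continuous w by apply: ctsD; [exact: cts_remainder|exact: cts_cst].
have cfw k : continuous (fun z => f k z - w z) by exact: ctsB.
have fw : norm1 (fun z => f k z - w z) @[k --> \oo] --> 0.
  apply: (@squeeze0 _ (fun k => norm1 (fun z => remainder l (D k) z - remainder l alpha z) +
     V * `|c k - c0|)).
  - by move=> k; exact: norm1_ge0.
  - move=> k.
    rewrite (@eq_norm1 _ (fun z => (remainder l (D k) z - remainder l alpha z) + (c k - c0))).
      rewrite (le_trans (norm1D _ _))//.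
      + by apply: ctsB; exact: cts_remainder.
      + exact: cts_cst.
      + by rewrite lerD2l /norm1 ritg_cst.
    by move=> z zab; rewrite {1}(avgs_remainder k l zab) cE /w; ring.
  - rewrite -[X in _ --> X](addr0 0); apply: cvgD; first exact: norm1_remainder.
    rewrite -[X in _ --> X](mulr0 V); apply: cvgM; first exact: cvg_cst.
    rewrite -(normr0 R); apply: cvg_norm; rewrite -(subrr c0); apply: cvgB => //.
    exact: cvg_cst.
(* Used with [x] the [L^1] norm of the defect of an identity for [w], and [u] a bound from the
   approximants. *)
have cst0 (x : R) (u : nat -> R) : 0 <= x -> (forall k, x <= u k) -> u k @[k --> \oo] --> 0 -> x = 0.
  move=> x0 xu u0; have : x @[_ --> \oo] --> (0 : R) by exact: (@squeeze0 (fun=> x) u).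
  by move=> /(cvg_unique _ (cvg_cst _)); apply.
have wE i z : in_box a b z -> w z = avg i w z + osc i (alpha i) z.
  move=> zab; apply/eqP; rewrite -subr_eq0 opprD addrA; apply/eqP.
  have cz : continuous (fun z => w z - avg i w z - osc i (alpha i) z).
    by apply: ctsB; [apply: ctsB => //; exact: cts_avg|exact: cts_osc].
  apply: (norm1_eq0 cz _ zab).
  apply: (@cst0 _ (fun k => norm1 (fun z => f k z - w z) + norm1 (fun z => f k z - w z) +
     2 * len i * norm1 (fun z => D k i z - alpha i z))).
  - exact: norm1_ge0.
  - move=> k.
    rewrite (@eq_norm1 _ (fun z => (avg i (fun z => f k z - w z) z - (f k z - w z)) +
       osc i (fun z => D k i z - alpha i z) z)); last first.
      move=> y yab; rewrite avgB// oscB//; have := avg_osc k i yab.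
      by move=> ->; ring.
    have ca : continuous (avg i (fun z => f k z - w z)) by exact: cts_avg.
    have cD' : continuous (fun z => D k i z - alpha i z) by exact: ctsB.
    rewrite (le_trans (norm1D _ _))//; [exact: ctsB|exact: cts_osc|].
    rewrite lerD//; last exact: norm1_osc.
    by rewrite (le_trans (norm1B ca (cfw k)))// lerD2r norm1_avg.
  - rewrite -[X in _ --> X](addr0 0); apply: cvgD.
      by rewrite -[X in _ --> X](addr0 0); apply: cvgD.
    rewrite -[X in _ --> X](mulr0 (2 * len i)); apply: cvgM; first exact: cvg_cst.
    exact: Dalpha.
exists w; split => //.
  move=> i z zab.
  have zab' : in_box a b (upd z i (a 0 i)) by apply: upd_box => //; rewrite lexx ltW.
  rewrite (wE i _ zab) (wE i _ zab') avg_upd /osc prim_upda avg_upd; ring.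
move=> i f0 z zab.
have zab' : in_box a b (upd z i (a 0 i)) by apply: upd_box => //; rewrite lexx ltW.
(* [L^1] convergence says nothing on a face. But [f k = prim i (D k i)] on the whole box, so
   [w = prim i (alpha i)] can be tested there in [L^1], and [prim] vanishes on the face. *)
suff H : w (upd z i (a 0 i)) - prim i (alpha i) (upd z i (a 0 i)) = 0.
  by move: H; rewrite prim_upda subr0.
have cz : continuous (fun z => w z - prim i (alpha i) z) by apply: ctsB => //; exact: cts_prim.
apply: (norm1_eq0 cz _ zab').
apply: (@cst0 _ (fun k => len i * norm1 (fun z => D k i z - alpha i z) +
  norm1 (fun z => f k z - w z))).
- exact: norm1_ge0.
- move=> k; have cD' : continuous (fun z => D k i z - alpha i z) by exact: ctsB.
  rewrite (@eq_norm1 _ (fun z => prim i (fun z => D k i z - alpha i z) z - (f k z - w z))); last first.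
    by move=> y yab; rewrite primB// (fD k i yab) (f0 k y yab); ring.
  have cp : continuous (prim i (fun z => D k i z - alpha i z)) by exact: cts_prim.
  by rewrite (le_trans (norm1B cp (cfw k)))// lerD2r norm1_prim.
- rewrite -[X in _ --> X](addr0 0); apply: cvgD => //.
  rewrite -[X in _ --> X](mulr0 (len i)); apply: cvgM; first exact: cvg_cst.
  exact: Dalpha.
Qed.

End LocalPotential.

(** * The volume measure in charts *)

Section Measures.
Context {R : realType}.
Local Notation borel X := (g_sigma_algebraType (@open X)).

Lemma within_continuous_borel (X : ptopologicalType) (V : set X) (f : X -> R) :
  {within V, continuous f} -> measurable_fun (V : set (borel X)) f.
Proof.
move=> cf mV; apply: (measurability _ (RGenOInfty.measurableE R)) => //.
move=> _ [_ [a ->] <-].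
have oa : open (`]a, +oo[%classic : set R) by exact: interval_open.
have op : open (f @^-1` `]a, +oo[%classic : set (subspace V)) by move/continuousP : cf; apply.
have [U oU UV] := (open_subspaceP _ _).1 op.
have -> : V `&` f @^-1` `]a, +oo[%classic = U `&` V by rewrite UV setIC.
by apply: measurableI => //; exact: sub_sigma_algebra.
Qed.

Lemma continuous_borel (X : ptopologicalType) (f : X -> R) :
  continuous f -> measurable_fun (setT : set (borel X)) f.
Proof. by move=> cf; apply: within_continuous_borel; exact: continuous_subspaceT. Qed.

Lemma continuous_borel_map (X Y : ptopologicalType) (e : X -> Y) :
  continuous e -> measurable_fun (setT : set (borel X)) (e : borel X -> borel Y).
Proof.
move=> /continuousP ce.
have H : @measurable _ (borel Y) = <<s (@open Y : set (set (borel Y))) >> by [].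
have := @measurability _ _ (borel X) (borel Y) setT e _ H; apply.
by move=> _ [U oU <-]; rewrite setTI; apply: sub_sigma_algebra; exact: ce.
Qed.

(** Measurability is not assumed, because the integral of a nonnegative function is a supremum over
    the simple functions below it. This serves for integrands built from the weak differential. *)
Lemma le_integral_nonneg d (T : measurableType d) (m : {measure set T -> \bar R})
  (f g : T -> \bar R) : (forall x, 0 <= f x)%E -> (forall x, f x <= g x)%E ->
  (\int[m]_x f x <= \int[m]_x g x)%E.
Proof.
move=> f0 fg; have g0 x : (0 <= g x)%E by exact: le_trans (fg x).
rewrite !ge0_integralTE//; apply: ereal_sup_le => _ [h hf <-]; exists h => //= x.
exact: le_trans (fg x).
Qed.

Section Compare.
Context d1 d2 (X : measurableType d1) (Y : measurableType d2).
Variables (lam : {measure set X -> \bar R}) (mu : {measure set Y -> \bar R}).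
Variables (e : X -> Y) (me : measurable_fun setT e).
Variables (Q : set X) (mQ : measurable Q) (V : set Y) (mV : measurable V).
Hypothesis eV : forall x, V (e x).
Variables k1 k2 : {nonneg R}.
Hypothesis cmp : forall B, measurable B -> B `<=` V ->
  (k1%:num%:E * lam (Q `&` e @^-1` B) <= mu B <= k2%:num%:E * lam (Q `&` e @^-1` B))%E.

Local Notation lamQ := (mrestr lam mQ).
Let push : {measure set Y -> \bar R} := measure_function_pushforward__canonical__measure_function_Measure lamQ me.
Local Notation muV := (mrestr mu mV).

Let integral_push (f : Y -> \bar R) : measurable_fun setT f -> (forall y, 0 <= f y)%E ->
  (\int[push]_(y in V) f y = \int[lam]_(x in Q) f (e x))%E.
Proof.
move=> mf f0.
rewrite (@ge0_integral_pushforward _ _ _ _ _ _ me lamQ V f mV); last 2 first.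
  exact: measurable_funS mf.
  by move=> y _; exact: f0.
have -> : e @^-1` V = setT by apply/seteqP; split => // x _; exact: eV.
have mfe : measurable_fun setT (f \o e) by exact: measurableT_comp mf me.
rewrite (@ge0_negligible_integral _ _ _ lamQ setT (~` Q) (f \o e)) => //; last 3 first.
  exact: measurableC.
  by move=> x _; exact: f0.
  by rewrite /= /mrestr setIC setICr measure0.
rewrite setTD setCK; apply: eq_measure_integral => A _ AQ.
by rewrite /= /mrestr setIidl.
Qed.

Let integral_muV (f : Y -> \bar R) :
  (\int[muV]_(y in V) f y = \int[mu]_(y in V) f y)%E.
Proof. by apply: eq_measure_integral => A _ AV; rewrite /= /mrestr setIidl. Qed.

Let pushE B : push B = lam (Q `&` e @^-1` (B `&` V)).
Proof.
rewrite /push/= /pushforward /mrestr setIC; congr (lam (_ `&` _)).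
by apply/seteqP; split => x //= [].
Qed.

(** [cmp] says that on [V] the measure [mu] lies between multiples of the image under [e] of [lam]
    restricted to [Q]; integrals of nonnegative functions are monotone in the measure. *)
Lemma integral_compare (f : Y -> \bar R) : measurable_fun setT f -> (forall y, 0 <= f y)%E ->
  (k1%:num%:E * \int[lam]_(x in Q) f (e x) <= \int[mu]_(y in V) f y <=
   k2%:num%:E * \int[lam]_(x in Q) f (e x))%E.
Proof.
move=> mf f0; have mfV : measurable_fun V f by exact: measurable_funS mf.
rewrite -integral_push// -integral_muV -!ge0_integral_mscale//; apply/andP; split.
  apply: ge0_le_measure_integral => // B mB.
  have := @cmp (B `&` V) (measurableI _ _ mB mV) (@subIsetr _ _ _).
  by rewrite -pushE => /andP[].
apply: ge0_le_measure_integral => // B mB.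
have := @cmp (B `&` V) (measurableI _ _ mB mV) (@subIsetr _ _ _).
by rewrite -pushE => /andP[].
Qed.

End Compare.

Section BoxIntegral.
Context {d : nat}.
Implicit Types (a b z : 'rV[R]_d).

(* Precomposition with the projection onto the box turns continuity on the box into
   continuity everywhere. *)
Definition clampv a b z : 'rV[R]_d :=
  \row_i Num.max (a 0 i) (Num.min (z 0 i) (b 0 i)).

Lemma cts_clampv a b : continuous (clampv a b).
Proof.
apply: cts_rV => i; under eq_fun do rewrite mxE.
apply: cts_max; first exact: cts_cst.
by apply: cts_min; [exact: cts_coord|exact: cts_cst].
Qed.

Lemma clampv_box a b z : box a b -> in_box a b (clampv a b z).
Proof.
move=> ab i; rewrite mxE le_max lexx/= ge_max ge_min lexx orbT andbT.
exact/ltW.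
Qed.

Lemma clampv_id a b z : in_box a b z -> clampv a b z = z.
Proof.
move=> zab; apply/rowP => i; rewrite mxE; have /andP[az zb] := zab i.
by rewrite (min_idPl zb) (max_idPr az).
Qed.

Lemma closed_box a b : closed (in_box a b).
Proof.
suff -> : in_box a b = \bigcap_(i in [set: 'I_d])
   ((fun z : 'rV[R]_d => z 0 i) @^-1` `[a 0 i, b 0 i]%classic).
  apply: closed_bigI => i _; apply: preimage_closed; last exact: itv_closed.
  by move=> z _; exact: cts_coord.
apply/seteqP; split => z h; first by move=> i _ /=; rewrite in_itv/=; exact: h.
by move=> i; have := h i I; rewrite /= in_itv.
Qed.

Lemma measurable_box a b : measurable (in_box a b : set (borel 'rV[R]_d)).
Proof.
rewrite -[X in measurable X]setCK; apply: measurableC.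
by apply: sub_sigma_algebra; rewrite openC; exact: closed_box.
Qed.

End BoxIntegral.

Lemma iter_integral0 d : iter_integral (fun _ : 'rV[R]_d => 0%E) = 0%E.
Proof. by elim: d => [//|d IH] /=; under eq_integral do rewrite IH; exact: integral0. Qed.

Lemma iter_integral_box d (a b : 'rV[R]_d) (h : 'rV[R]_d -> R) : box a b -> continuous h ->
  iter_integral (patch (fun=> 0%E) (in_box a b) (fun z => (h z)%:E)) = (ritg a b h)%:E.
Proof.
elim: d a b h => [|d IH] a b h ab ch /=.
  by rewrite patchE mem_set// => -[].
rewrite /itg /Rintegral fineK; last first.
  apply: integrable_fin_num => //.
  exact: cont_integrable (cts_ritg_section ab ch).
rewrite [RHS]integral_mkcond; apply: eq_integral => t _.
rewrite patchE; case: ifPn => [|]; rewrite ?inE ?notin_setE/= in_itv/= => tab.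
  rewrite -(IH _ _ _ (box_tail ab)); last exact: cts_section.
  congr iter_integral; apply/funext => z; rewrite !patchE.
  have [zab|zab] := pselect (in_box (rtail a) (rtail b) z).
    by rewrite !mem_set//; apply/in_box_rowcons.
  by rewrite !memNset// => /in_box_rowcons[].
rewrite -[RHS](@iter_integral0 d); congr iter_integral; apply/funext => z.
by rewrite patchE memNset// => /in_box_rowcons[].
Qed.

End Measures.

Lemma det_gt0 (R : realType) n (G : 'M[R]_n) :
  (forall v : 'rV[R]_n, v != 0 -> 0 < (v *m G *m v^T) 0 0) -> 0 < \det G.
Proof.
move=> Gpos.
(* The determinant does not vanish on the segment from G to the identity matrix. *)
pose P : 'M[{poly R}]_n := (1 - 'X) *: map_mx polyC G + 'X%:M.
have PE s : (\det P).[s] = \det ((1 - s) *: G + s%:M).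
  rewrite -horner_evalE -det_map_mx; congr (\det _); apply/matrixP => i j.
  rewrite mxE /P !mxE /= /horner_eval hornerD hornerM hornerD hornerN !hornerE.
  by case: (i == j); rewrite ?mulr1n ?mulr0n ?hornerX ?horner0.
rewrite ltNge; apply/negP => G0.
have [|s /andP[s0 s1]] := @poly_ivt _ (\det P) 0 1 ler01.
  by rewrite !PE subr0 subrr scale1r scale0r add0r det1 ler01 raddf0 addr0 G0.
rewrite /root PE => /eqP d0.
suff : (1 - s) *: G + s%:M \in unitmx by rewrite unitmxE d0 unitr0.
rewrite -row_free_unit -kermx_eq0; apply/rowV0P => v /sub_kermxP vG.
apply/eqP/negPn/negP => v0.
have : (v *m ((1 - s) *: G + s%:M) *m v^T) 0 0 = 0 by rewrite vG mul0mx mxE.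
have -> : (v *m ((1 - s) *: G + s%:M) *m v^T) 0 0 =
    (1 - s) * (v *m G *m v^T) 0 0 + s * (v *m v^T) 0 0.
  rewrite mulmxDr mulmxDl -scalemxAr -scalemxAl mul_mx_scalar -scalemxAl.
  by rewrite [LHS]mxE [X in X + _]mxE [X in _ + X]mxE.
have vv : 0 < (v *m v^T) 0 0.
  rewrite mxE lt_def sumr_ge0 => [|i _]; last by rewrite mxE -expr2 sqr_ge0.
  rewrite andbT; apply: contra v0 => /eqP h; apply/eqP/rowP => i; rewrite mxE.
  have := psumr_eq0P (fun j _ => _) h; rewrite /= => /(_ _ i isT) => h'.
  have : v 0 i * v^T i 0 = 0 by apply: h' => j; rewrite mxE -expr2 sqr_ge0.
  by rewrite mxE => /eqP; rewrite mulf_eq0 orbb => /eqP.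
have Gv := Gpos v v0; apply/eqP; rewrite gt_eqF//.
have [->|sn0] := eqVneq s 0; first by rewrite subr0 mul1r mul0r addr0.
by rewrite ltr_wpDl ?mulr_ge0 ?subr_ge0// ?(ltW Gv)// mulr_gt0// lt_def sn0.
Qed.

Lemma cts_clamp (R : realType) d (a b : 'rV[R]_d) (X : topologicalType) (S : set 'rV[R]_d)
  (f : 'rV[R]_d -> X) : box a b -> in_box a b `<=` S ->
  (forall z, S z -> f y @[y --> within S (nbhs z)] --> f z) -> continuous (fun z => f (clampv a b z)).
Proof.
move=> ab QS cf z P Pz.
have Sz y : S (clampv a b y) by apply: QS; exact: clampv_box.
have H : \forall y \near clampv a b z, S y -> P (f y) by exact: cf (Sz z) P Pz.
have K : \forall y \near z, S (clampv a b y) -> P (f (clampv a b y)).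
  by exact: (@cts_clampv R d a b z _ H).
suff : \forall y \near z, P (f (clampv a b y)) by [].
by apply: filterS K => y h; apply: h; exact: Sz.
Qed.

Section GoodBox.
Context {R : realType} {n : nat} {M : ptopologicalType} (A : atlas R n M).
Hypothesis hM : is_manifold_with_boundary A.
Variable g : M -> 'M[R]_n.
Hypothesis hg : is_riemannian_metric A g 6.
Local Notation borelM := (g_sigma_algebraType (@open M)).
Variable mu : {measure set borelM -> \bar R}.
Hypothesis hmu : is_volume_measure A g mu.
Implicit Types c : chart A.

Lemma metric_in_pos c x (v : 'rV[R]_n) : cdom c x -> v != 0 ->
  0 < (v *m metric_in g c x *m v^T) 0 0.
Proof.
move=> cx v0; have cx' := mfd_chart_at hM x.
have -> : v *m metric_in g c x *m v^T =
    (v *m jacobian c (chart_at A x) x) *m g x *m (v *m jacobian c (chart_at A x) x)^T.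
  by rewrite /metric_in trmx_mul !mulmxA.
apply: (metric_pos hg).
apply: contra v0 => /eqP e; apply/eqP.
by rewrite -[v](mulmxK (jacobian_unit hM cx cx')) e mul0mx.
Qed.

Definition density c (z : 'rV[R]_n) := Num.sqrt (\det (metric_in g c (cinv c z))).

Lemma density_gt0 c z : cimg c z -> 0 < density c z.
Proof.
move=> /(cimgP hM)[cz _]; rewrite sqrtr_gt0; apply: det_gt0 => v; exact: metric_in_pos.
Qed.

Lemma density_cvg c z : cimg c z -> density c y @[y --> within (cimg c) (nbhs z)] --> density c z.
Proof.
move=> cz.
have H : \det (metric_in g c (cinv c y)) @[y --> within (cimg c) (nbhs z)] -->
         \det (metric_in g c (cinv c z)).
  by apply: llip_cvg => //; apply: llip_det => i j; exact: (metric_llip hM hg).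
exact: (cvg_comp _ _ H (@sqrt_continuous R _)).
Qed.

Lemma cinv_cvg c z : cimg c z -> cinv c y @[y --> within (cimg c) (nbhs z)] --> cinv c z.
Proof. by move=> cz P Pz; exact: (near_cinv hM cz Pz). Qed.

Definition chart_box c (a b : 'rV[R]_n) : set M := [set x | cdom c x /\ in_box a b (cmap c x)].

Section Box.
Variables (c : chart A) (a b : 'rV[R]_n).
Hypothesis ab : box a b.
Hypothesis Qc : in_box a b `<=` cimg c.

Lemma chart_boxP z : in_box a b z -> chart_box c a b (cinv c z).
Proof. by move=> zab; have /(cimgP hM)[cz e] := Qc zab; split => //; rewrite e. Qed.

Lemma measurable_chart_box : measurable (chart_box c a b : set borelM).
Proof.
have -> : chart_box c a b = cdom c `\` [set x | cdom c x /\ ~ in_box a b (cmap c x)].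
  by apply/seteqP; split => x [cx h']; split => //; [case|apply: contrapT => k; exact: h'].
apply: measurableD; first by apply: sub_sigma_algebra; exact: (mfd_cdom_open hM).
apply: sub_sigma_algebra; rewrite openE => x [cx nx].
have H : \forall y \near cmap c x, ~ in_box a b y.
  by apply: open_nbhs_nbhs; split => //; rewrite openC; exact: closed_box.
exact: (near_cmap hM cx H).
Qed.

Let W z := density c (clampv a b z).

Let ctsW : continuous W.
Proof. by apply: (cts_clamp ab Qc) => z; exact: density_cvg. Qed.

Let e z := cinv c (clampv a b z).

Let cts_e : continuous e.
Proof. by apply: (cts_clamp ab Qc) => z; exact: cinv_cvg. Qed.

Let volumeE B : measurable (B : set borelM) -> B `<=` chart_box c a b ->
  forall lam : {measure set (g_sigma_algebraType (@open 'rV[R]_n)) -> \bar R},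
  (forall f : _ -> \bar R, measurable_fun setT f -> (forall x, 0 <= f x)%E ->
    (\int[lam]_x f x)%E = iter_integral (f : 'rV[R]_n -> \bar R)) ->
  mu B = (\int[lam]_(z in in_box a b `&` e @^-1` B) (W z)%:E)%E.
Proof.
move=> mB BV lam lamE; rewrite (hmu (c := c) mB); last by move=> x /BV[].
have mS : measurable (in_box a b `&` e @^-1` B : set (g_sigma_algebraType (@open 'rV[R]_n))).
  apply: measurableI; first exact: measurable_box.
  by rewrite -[X in measurable X]setTI; exact: (continuous_borel_map cts_e).
have mW : measurable_fun [set: g_sigma_algebraType (@open 'rV[R]_n)] (EFin \o W).
  by apply/measurable_EFinP; exact: (continuous_borel ctsW).
have -> : cmap c @` B = in_box a b `&` e @^-1` B.
  apply/seteqP; split => [_ [x Bx <-]|y [yab /= By]].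
    have [cx xab] := BV x Bx; split => //=.
    by rewrite /e clampv_id// (mfd_cinvK hM).
  exists (e y) => //; rewrite /e clampv_id//.
  by have /(cimgP hM)[] := Qc yab.
have -> : patch (fun=> 0%E) (in_box a b `&` e @^-1` B)
    (fun z => (Num.sqrt (\det (metric_in g c (cinv c z))))%:E) =
    (fun z => (W z)%:E) \_ (in_box a b `&` e @^-1` B).
  apply/funext => z; rewrite !patchE.
  have [zS|zS] := boolP (z \in in_box a b `&` e @^-1` B); last by [].
  by have [zab _] := set_mem zS; rewrite /W clampv_id.
rewrite integral_mkcond -lamE//.
- apply/measurable_restrict => //; rewrite setTI; exact: measurable_funS mW.
- by move=> z; rewrite patchE; case: ifPn => // _; rewrite lee_fin /W sqrtr_ge0.
Qed.

Lemma measurable_box_fun (h : 'rV[R]_n -> R) : continuous h ->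
  measurable_fun [set: borelM] ((fun x => (h (cmap c x))%:E) \_ (chart_box c a b)).
Proof.
move=> ch; have mV := measurable_chart_box.
apply/measurable_restrict => //; rewrite setTI; apply/measurable_EFinP.
apply: within_continuous_borel.
have cc : {within cdom c, continuous (h \o cmap c)}.
  have cm := @mfd_cmap_continuous _ _ _ _ hM c.
  move=> x; apply: (@continuous_comp (subspace (cdom c)) _ _ (cmap c) h x (@cm x)).
  exact: (@ch (cmap c x)).
by apply: continuous_subspaceW cc => x [].
Qed.

Variables k1 k2 : R.
Hypothesis k10 : 0 < k1.
Hypothesis dens : forall z, in_box a b z -> k1 <= density c z <= k2.

(** Bounds on the density make integration against [mu] over a chart box equivalent to [ritg], so
    that convergence on [M] can be transferred to coordinates and back. *)
Lemma box_compare (h : 'rV[R]_n -> R) : continuous h -> (forall z, 0 <= h z) ->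
  ((k1 * ritg a b h)%:E <= \int[mu]_(x in chart_box c a b) (h (cmap c x))%:E <=
   (k2 * ritg a b h)%:E)%E.
Proof.
move=> ch h0; have [lam [_ lamE]] := @lebesgue_rowvec R n.
have k20 : 0 <= k2.
  have /andP[u v] := dens (clampv_box 0 ab).
  exact: le_trans (ltW k10) (le_trans u v).
have mQ := @measurable_box R n a b.
have mV := measurable_chart_box.
pose f := (fun x => (h (cmap c x))%:E) \_ (chart_box c a b).
have f0 x : (0 <= f x)%E by rewrite /f patchE; case: ifPn => // _; rewrite lee_fin.
have mf : measurable_fun [set: borelM] f by exact: measurable_box_fun.
have eV z : chart_box c a b (e z) by apply: chart_boxP; exact: clampv_box.
have := @integral_compare R _ _ _ _ lam mu e (continuous_borel_map cts_e) _ mQ _ mV eV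
  (NngNum (ltW k10)) (NngNum k20) _ f mf f0.
have fe : (\int[lam]_(z in in_box a b) f (e z) = (ritg a b h)%:E)%E.
  rewrite -(iter_integral_box ab ch) -lamE.
  - rewrite integral_mkcond; apply: eq_integral => z _; rewrite !patchE.
    case: ifPn => // /set_mem zab; rewrite /f patchE mem_set//.
    rewrite /e clampv_id//; have /(cimgP hM)[_ ->] // := Qc zab.
  - apply/measurable_restrict => //; rewrite setTI; apply/measurable_EFinP.
    by apply: measurable_funS (continuous_borel ch).
  - by move=> z; rewrite patchE; case: ifPn => // _; rewrite lee_fin.
have fV : (\int[mu]_(x in chart_box c a b) f x =
           \int[mu]_(x in chart_box c a b) (h (cmap c x))%:E)%E.
  by apply: eq_integral => x xV; rewrite /f patchE xV.
rewrite fe fV !EFinM; apply => B mB BV.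
have mS : measurable (in_box a b `&` e @^-1` B : set (g_sigma_algebraType (@open 'rV[R]_n))).
  apply: measurableI; first exact: measurable_box.
  by rewrite -[X in measurable X]setTI; exact: (continuous_borel_map cts_e).
rewrite (volumeE mB BV lamE) -!integral_cst//.
have mW : measurable_fun (in_box a b `&` e @^-1` B : set (g_sigma_algebraType (@open 'rV[R]_n)))
    (EFin \o W).
  by apply/measurable_EFinP; apply: measurable_funS (continuous_borel ctsW).
apply/andP; split; apply: ge0_le_integral => //.
- by move=> x _; rewrite lee_fin ltW.
- by move=> x [xab _]; rewrite lee_fin /W clampv_id//; have /andP[] := dens xab.
- by move=> x _; rewrite lee_fin sqrtr_ge0.
- by move=> x [xab _]; rewrite lee_fin /W clampv_id//; have /andP[] := dens xab.
Qed.

End Box.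
End GoodBox.

(** * Cauchy-Schwarz inequality for the metric and its dual *)

Section CauchySchwarz.
Context {R : realType} {n : nat}.
Variable G : 'M[R]_n.
Hypothesis Gsym : G^T = G.
Hypothesis Gpos : forall v : 'rV[R]_n, v != 0 -> 0 < (v *m G *m v^T) 0 0.
Implicit Types p v w : 'rV[R]_n.

Let form v w := (v *m G *m w^T) 0 0.

Let form_ge0 v : 0 <= form v v.
Proof. by have [->|/Gpos/ltW//] := eqVneq v 0; rewrite /form mul0mx mul0mx mxE. Qed.

Let formC v w : form v w = form w v.
Proof.
rewrite /form; have -> : v *m G *m w^T = (w *m G *m v^T)^T.
  by rewrite !trmx_mul trmxK Gsym mulmxA.
by rewrite mxE.
Qed.

Let formZl s v w : form (s *: v) w = s * form v w.
Proof. by rewrite /form -!scalemxAl mxE. Qed.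

Let formBl u v w : form (u - v) w = form u w - form v w.
Proof. by rewrite /form !mulmxBl mxE; congr (_ + _); rewrite mxE. Qed.

Lemma form_CS v w :
  (v *m G *m w^T) 0 0 ^+ 2 <= (v *m G *m v^T) 0 0 * (w *m G *m w^T) 0 0.
Proof.
rewrite -/(form v w) -/(form v v) -/(form w w).
have [->|v0] := eqVneq v 0; first by rewrite /form !mul0mx !mxE expr0n mul0r.
have vv : 0 < form v v := Gpos v0.
(* This vector is [form v v] times the component of [w] orthogonal to [v]. *)
have := form_ge0 (form v v *: w - form v w *: v).
have E u : form u (form v v *: w - form v w *: v) = form v v * form u w - form v w * form u v.
  by rewrite formC formBl !formZl ![form _ u]formC.
rewrite formBl !formZl !E (formC w v); set s := form v v in vv *.
have -> : s * (s * form w w - form v w * form v w) - form v w * (s * form v w - form v w * s) =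
   s * (s * form w w - form v w ^+ 2) by ring.
by rewrite pmulr_rge0// subr_ge0.
Qed.

Hypothesis Gunit : G \in unitmx.

Let inv_sym : (invmx G)^T = invmx G.
Proof. by rewrite trmx_inv Gsym. Qed.

Lemma coform_ge0 p : 0 <= (p *m invmx G *m p^T) 0 0.
Proof.
have -> : p *m invmx G *m p^T = (p *m invmx G) *m G *m (p *m invmx G)^T.
  by rewrite mulmxKV// trmx_mul inv_sym mulmxA.
exact: form_ge0.
Qed.

(** Cauchy-Schwarz between [v] and the vector [p *m invmx G] dual to [p]. *)
Lemma pairing_le p v : (p *m v^T) 0 0 ^+ 2 <=
  (p *m invmx G *m p^T) 0 0 * (v *m G *m v^T) 0 0.
Proof.
have -> : p *m v^T = (p *m invmx G) *m G *m v^T by rewrite mulmxKV.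
have -> : p *m invmx G *m p^T = (p *m invmx G) *m G *m (p *m invmx G)^T.
  by rewrite mulmxKV// trmx_mul inv_sym mulmxA.
exact: form_CS.
Qed.

End CauchySchwarz.

Section Lines.
Context {R : realType} {d : nat}.

Lemma pd_upd (S : set 'rV[R]_d) (f : 'rV[R]_d -> R) z i t l a b :
  (forall s, a <= s <= b -> S (upd z i s)) ->
  pd S f (upd z i t) i l -> hasd `[a, b] (fun s => f (upd z i s)) t l.
Proof.
move=> hS h e e0; have H := h e e0.
have ct : continuous (fun s : R => s - t) by apply: ctsB; [exact: cts_id|exact: cts_cst].
have H' : \forall s \near t, S (line (upd z i t) i (s - t)) ->
   `|f (line (upd z i t) i (s - t)) - f (line (upd z i t) i 0) - l * (s - t - 0)|
     <= e * `|s - t - 0|.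
  have ct' : s - t @[s --> t] --> (0 : R) by have := ct t; rewrite /continuous_at/= subrr.
  exact: (ct' _ H).
have E s : line (upd z i t) i (s - t) = upd z i s.
  by rewrite -[RHS](upd_upd z i t) /upd updE eqxx.
apply: filterS H' => s; rewrite E line0 subr0 => hs; rewrite /= in_itv/= => /hS; exact: hs.
Qed.

Lemma upd_pd (S : set 'rV[R]_d) (f : 'rV[R]_d -> R) z i l a b :
  (\forall h \near 0, S (line z i h) -> a <= z 0 i + h <= b) ->
  hasd `[a, b] (fun s => f (upd z i s)) (z 0 i) l -> pd S f z i l.
Proof.
move=> hS h e e0; have H := h e e0.
have ct : continuous (fun s : R => z 0 i + s) by apply: ctsD; [exact: cts_cst|exact: cts_id].
have E s : upd z i (z 0 i + s) = line z i s by rewrite /upd addrAC subrr add0r.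
have H' : \forall s \near (0 : R), (z 0 i + s) \in `[a, b] ->
   `|f (upd z i (z 0 i + s)) - f (upd z i (z 0 i)) - l * (z 0 i + s - z 0 i)|
     <= e * `|z 0 i + s - z 0 i|.
  have ct' : z 0 i + s @[s --> (0 : R)] --> z 0 i.
    by have := ct 0; rewrite /continuous_at/= addr0.
  exact: (ct' _ H).
apply: filterS2 H' hS => s k1 k2 Ss.
have E2 : z 0 i + s - z 0 i = s by rewrite addrAC subrr add0r.
move: k1; rewrite E upd_id E2 subr0 line0 in_itv/= => k1.
by apply: k1; exact: k2.
Qed.

(** Only the points of [S] near [z] have to lie in the box, so [z] may be on a face contained in the
    boundary of [S]; the derivative is then one-sided. *)
Lemma pd_of_box_ftc (S : set 'rV[R]_d) (a b : 'rV[R]_d) (w h : 'rV[R]_d -> R) z i :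
  in_box a b z -> (\forall y \near z, S y -> in_box a b y) -> continuous h ->
  (forall y, in_box a b y -> w y = w (upd y i (a 0 i)) + prim a i h y) ->
  pd S w z i (h z).
Proof.
move=> zb nb ch wE; apply: (@upd_pd S w z i _ (a 0 i) (b 0 i)).
  apply: filterS (near_line i nb) => s hs /hs /(_ i).
  by rewrite lineE eqxx.
have cu : continuous (fun s => h (upd z i s)).
  apply: (cts_comp _ ch); apply: cts_upd; last exact: cts_id.
  by move=> s; exact: cvg_cst.
have zi : a 0 i <= z 0 i <= b 0 i by exact: zb.
have := FTC1_hasd cu zi; rewrite upd_id => FT.
have := hasdD (@hasd_cst R `[a 0 i, b 0 i] (w (upd z i (a 0 i))) (z 0 i)) FT.
rewrite add0r; apply: hasd_near.
  apply: filterE => s; rewrite /= in_itv/= => sab; split => //.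
  rewrite (wE (upd z i s)) ?upd_upd; last exact: upd_box.
  have -> : prim a i h (upd z i s) = itg (a 0 i) s (fun r => h (upd z i r)).
    rewrite /prim updE eqxx.
    suff -> : (fun r => h (upd (upd z i s) i r)) = (fun r => h (upd z i r)) by [].
    by apply/funext => r; rewrite upd_upd.
  by [].
by rewrite upd_id [RHS](wE z zb).
Qed.

End Lines.

(** * Coordinate boxes with controlled metric *)

Section BoxExists.
Context {R : realType} {n : nat} {M : ptopologicalType} (A : atlas R n M).
Hypothesis hM : is_manifold_with_boundary A.
Variable g : M -> 'M[R]_n.
Hypothesis hg : is_riemannian_metric A g 6.
Implicit Types c : chart A.

(** [k1] and [k2] compare the Riemannian volume with Lebesgue measure. [K] bounds the squared
    lengths of the coordinate vectors, which controls the components of a covector by its norm. *)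
Definition box_bounds c (a b : 'rV[R]_n) (k1 k2 K : R) :=
  [/\ box a b, 0 < k1, 0 < K & forall z, in_box a b z ->
    [/\ cimg c z, k1 <= density g c z <= k2 & forall i, metric_in g c (cinv c z) i i <= K]].

Lemma relopen_ball (S : set 'rV[R]_n) (P : 'rV[R]_n -> Prop) z : relopen S -> S z ->
  (\forall y \near z, S y -> P y) ->
  exists2 r, 0 < r & forall y, half_space y -> ball z r y -> S y /\ P y.
Proof.
move=> [_ oS] Sz hP.
have H : \forall y \near z, half_space y -> S y /\ P y.
  apply: (@filterS2 _ _ _ _ _ _ _ (oS z Sz) hP) => y h1 h2 hy.
  by have Sy := h1 hy; split => //; exact: h2.
have /nbhs_ballP[r /= r0 hr] := H.
by exists r => // y hy yr; exact: hr.
Qed.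

Lemma exists_box c x (U : set M) : cdom c x -> nbhs x U ->
  exists a b k1 k2 K, [/\ box_bounds c a b k1 k2 K, in_box a b (cmap c x),
    forall z, in_box a b z -> U (cinv c z), nbhs x (chart_box c a b) &
    forall i : 'I_n, i = 0%N :> nat -> cmap c x 0 i = 0 -> a 0 i = 0].
Proof.
move=> cx xU; set z := cmap c x.
have cz : cimg c z by exact: cimg_cmap.
have rc := cimg_relopen hM c.
have W0 : 0 < density g c z by exact: (density_gt0 hM hg).
pose m i := metric_in g c (cinv c z) i i.
have K0 : 0 < 1 + \sum_i `|m i| by rewrite ltr_pwDl// sumr_ge0.
have H1 : \forall y \near z, cimg c y -> U (cinv c y).
  by apply: (near_cinv hM cz); rewrite (mfd_cinvK hM).
have H2 : \forall y \near z, cimg c y -> density g c z / 2 <= density g c y <= density g c z * 2.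
  have e0 : 0 < density g c z / 2 by rewrite divr_gt0.
  have /cvgrPdist_le H := density_cvg hM hg cz; have {}H := H _ e0.
  have H' : \forall y \near z, cimg c y -> `|density g c z - density g c y| <= density g c z / 2.
    by exact: H.
  apply: filterS H' => y h /h; rewrite ler_norml; move: (density g c z) (density g c y) W0.
  by move=> u v u0 /andP[h1 h2]; apply/andP; split; lra.
have H3 : \forall y \near z, cimg c y -> forall i, metric_in g c (cinv c y) i i <= 1 + \sum_i `|m i|.
  suff H : \forall y \near z, forall i, cimg c y -> metric_in g c (cinv c y) i i <= 1 + \sum_i `|m i|.
    by apply: filterS H => y h cy i; exact: h.
  apply: near_all => i.
  have /cvgrPdist_le H := llip_cvg cz (metric_llip hM hg i i cz); have {}H := H 1 ltr01.
  have H' : \forall y \near z, cimg c y -> `|m i - metric_in g c (cinv c y) i i| <= 1.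
    by exact: H.
  apply: filterS H' => y h /h; rewrite (bigD1 i)//=.
  have : 0 <= \sum_(j < n | j != i) `|m j| by rewrite sumr_ge0.
  have := ler_norm (m i); rewrite ler_norml.
  move: (m i) `|m i| (\sum_(j < n | j != i) `|m j|) (metric_in g c (cinv c y) i i).
  by move=> u u' s v h1 h2 /andP[h3 h4]; lra.
have [|r r0 hr] := @relopen_ball (cimg c) (fun y => [/\ U (cinv c y),
    density g c z / 2 <= density g c y <= density g c z * 2 &
    forall i, metric_in g c (cinv c y) i i <= 1 + \sum_i `|m i|]) z rc cz.
  apply: (@filterS3 _ _ _ _ _ _ _ _ H1 H2 H3) => y h1 h2 h3 cy.
  by split; [exact: h1|exact: h2|exact: h3].
have r20 : 0 < r / 2 by rewrite divr_gt0.
have hz : half_space z by exact: rc.1.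
(* Truncation at 0 keeps the box in the half-space; for a boundary point it puts a face of the box
   on the boundary, where the approximants vanish. *)
pose a : 'rV[R]_n := \row_i (if i == 0%N :> nat then Num.max 0 (z 0 i - r / 2) else z 0 i - r / 2).
pose b : 'rV[R]_n := \row_i (z 0 i + r / 2).
have az i : a 0 i <= z 0 i.
  rewrite mxE; have h : z 0 i - r / 2 <= z 0 i by rewrite gerBl ltW.
  by case: eqP => // i0; rewrite ge_max h hz.
have hbox y : in_box a b y -> half_space y /\ ball z r y.
  move=> yab; split=> [i i0|].
    have /andP[+ _] := yab i; rewrite mxE i0 eqxx; apply: le_trans.
    by rewrite le_max lexx.
  apply/ball_rVP => // i; have /andP[h1 h2] := yab i.
  have h3 : z 0 i - r / 2 <= y 0 i.
    by apply: le_trans h1; rewrite mxE; case: ifP => // _; rewrite le_max lexx orbT.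
  move: h2; rewrite mxE ltr_norml => h2; move: (z 0 i) (y 0 i) h2 h3 => u v h2 h3.
  by apply/andP; split; lra.
have bE i : b 0 i = z 0 i + r / 2 by rewrite mxE.
exists a, b, (density g c z / 2), (density g c z * 2), (1 + \sum_i `|m i|); split.
- split => //; [|by rewrite divr_gt0|].
    by move=> i; rewrite bE (le_lt_trans (az i))// ltrDl.
  by move=> y /hbox[h1 h2]; have [h3 [_ h4 h5]] := hr y h1 h2.
- by move=> i; rewrite az bE lerDl ltW.
- by move=> y /hbox[h1 h2]; have [_ []] := hr y h1 h2.
- have H : \forall y \near z, half_space y -> in_box a b y.
    have /nbhs_ballP : exists2 e : R, 0 < e & ball z e `<=` (fun y => half_space y -> in_box a b y).
      exists (r / 2) => // y /ball_rVP-/(_ r20) h hy i.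
      have := h i; rewrite bE mxE ltr_norml => /andP[h1 h2].
      have h3 : z 0 i - r / 2 <= y 0 i by move: (z 0 i) (y 0 i) h1 h2 => u v h1 h2; lra.
      apply/andP; split; last by move: (z 0 i) (y 0 i) h1 h2 => u v h1' h2'; lra.
      by case: eqP => // i0; rewrite ge_max h3 hy.
    by [].
  apply: filterS (near_cmap hM cx H) => y [cy hy]; split => //; apply: hy.
  by apply: rc.1; exact: cimg_cmap.
- move=> i i0 zi; rewrite mxE i0 eqxx -/z zi sub0r; apply/max_idPl.
  by rewrite oppr_le0 ltW.
Qed.

End BoxExists.

Section SquareIntegrals.
Context {R : realType}.

Lemma cvg0_le_ereal (r : nat -> R) (e : nat -> \bar R) : (forall k, 0 <= r k) ->
  (forall k, ((r k)%:E <= e k)%E) -> e k @[k --> \oo] --> 0%E -> r k @[k --> \oo] --> 0.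
Proof.
move=> r0 re e0.
have : (r k)%:E @[k --> \oo] --> 0%E.
  have z0 : (fun=> 0%E) k @[k --> \oo] --> (0%E : \bar R) by exact: cvg_cst.
  have nre : \forall k \near \oo, ((fun=> 0%E) k <= (r k)%:E <= e k)%E.
    by apply: nearW => k; rewrite re lee_fin r0.
  exact: squeeze_cvge nre _ z0 e0.
by move=> /fine_cvgP[].
Qed.

(** From [L^2] to [L^1] without square roots: [|h| <= s + h ^+ 2 / s] pointwise, with [s] such that
    its integral over the box is [e / 2]. *)
Lemma norm1_small d (a b : 'rV[R]_d) (e : R) : box a b -> 0 < e -> exists2 t, 0 < t &
  forall h : 'rV[R]_d -> R, continuous h -> ritg a b (fun z => h z ^+ 2) <= t -> norm1 a b h <= e.
Proof.
move=> ab e0; have V0 := ritg1_gt0 ab; set V := ritg a b (fun=> 1) in V0.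
pose s := e / (2 * V).
have s0 : 0 < s by rewrite divr_gt0// mulr_gt0.
exists (s * (e / 2)); first by rewrite mulr_gt0// divr_gt0.
move=> h ch hs.
have c2 : continuous (fun z => h z ^+ 2) by exact: ctsX.
have c3 : continuous (fun z => s^-1 * h z ^+ 2) by apply: ctsM => //; exact: cts_cst.
have cs : continuous (fun _ : 'rV[R]_d => s) by exact: cts_cst.
have : norm1 a b h <= ritg a b (fun z => s + s^-1 * h z ^+ 2).
  apply: le_ritg => //; [exact: cts_norm|exact: ctsD|move=> z _].
  have h2 : `|h z| ^+ 2 = h z ^+ 2 by rewrite real_normK// num_real.
  rewrite -h2 -(ler_pM2l s0) [leRHS]mulrDr mulVKf ?gt_eqF//.
  have := sqr_ge0 (s - `|h z|); have := normr_ge0 (h z).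
  by move: `|h z| => x x0; rewrite !expr2 => hxy; nra.
move=> /le_trans; apply; rewrite ritgD// (ritgZ s^-1 ab c2) (ritg_cst s ab) -/V.
have -> : V * s = e / 2 by rewrite /s; field; rewrite gt_eqF.
have : s^-1 * ritg a b (fun z => h z ^+ 2) <= e / 2 by rewrite ler_pdivrMl.
by move: (s^-1 * _) => x hx; lra.
Qed.

Lemma norm1_sq_cvg0 d (a b : 'rV[R]_d) (h : nat -> 'rV[R]_d -> R) : box a b ->
  (forall k, continuous (h k)) -> ritg a b (fun z => h k z ^+ 2) @[k --> \oo] --> 0 ->
  norm1 a b (h k) @[k --> \oo] --> 0.
Proof.
move=> ab ch h0; apply/cvgrPdist_le => e e0.
have [t t0 ht] := norm1_small ab e0.
have /cvgrPdist_le H := h0; have {}H := H t t0.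
apply: filterS H => k; rewrite !sub0r !normrN !ger0_norm ?norm1_ge0//; first exact: ht.
by apply: ritg_ge0 => z _; exact: sqr_ge0.
Qed.

End SquareIntegrals.

Section Continuity.
Context {R : realType} {n : nat} {M : ptopologicalType} (A : atlas R n M).
Hypothesis hM : is_manifold_with_boundary A.

Lemma chart_continuous (u : M -> R) :
  (forall (c : chart A) z, cimg c z -> u (cinv c y) @[y --> within (cimg c) (nbhs z)] --> u (cinv c z)) ->
  continuous u.
Proof.
move=> hu x P Px; pose c := chart_at A x; have cx : cdom c x := mfd_chart_at hM x.
have H : \forall y \near cmap c x, cimg c y -> P (u (cinv c y)).
  by have := hu c _ (cimg_cmap cx); rewrite (mfd_cinvK hM)// => h; exact: h.
suff : \forall y \near x, P (u y) by [].
apply: filterS (near_cmap hM cx H) => y [cy hy].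
by have := hy (cimg_cmap cy); rewrite (mfd_cinvK hM).
Qed.

Lemma Ck_continuous k (u : M -> R) : (forall c : chart A, Ck k (cimg c) (fun z => u (cinv c z))) ->
  continuous u.
Proof. by move=> hu; apply: chart_continuous => c z cz; exact: (Ck_cvg (hu c) cz). Qed.

Lemma continuous_chart (u : M -> R) (c : chart A) z : continuous u -> cimg c z ->
  u (cinv c y) @[y --> within (cimg c) (nbhs z)] --> u (cinv c z).
Proof. by move=> cu cz; exact: (cvg_comp _ _ (@cinv_cvg _ _ _ _ hM c z cz) (@cu _)). Qed.

Lemma C1_continuous_form (u : M -> R) (p : M -> 'rV[R]_n) :
  (forall c : chart A, Ck 1 (cimg c) (fun z => u (cinv c z))) -> has_differential A u p ->
  continuous_form A p.
Proof.
move=> hu hp c i z cz.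
have E y : cimg c y -> pderive (cimg c) (fun z => u (cinv c z)) y i = covector_in c p (cinv c y) 0 i.
  by move=> cy; apply: pd_pderive => //; [exact: relopen_lines (cimg_relopen hM c)|exact: hp].
have := @Ck_cvg _ _ 0 _ _ _ (Ck_pderive i (hu c)) cz; rewrite E// => H.
move=> P /H h.
have h' : \forall y \near z, cimg c y -> P (pderive (cimg c) (fun z => u (cinv c z)) y i).
  by exact: h.
suff h2 : \forall y \near z, cimg c y -> P (covector_in c p (cinv c y) 0 i) by exact: h2.
by apply: filterS h' => y k cy; rewrite -E//; exact: k.
Qed.

End Continuity.

(** * From weak to classical potentials *)

Section WeakPotential.
Context {R : realType} {n : nat} {M : ptopologicalType} (A : atlas R n M).
Hypothesis hM : is_manifold_with_boundary A.
Variable g : M -> 'M[R]_n.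
Hypothesis hg : is_riemannian_metric A g 6.
Local Notation borelM := (g_sigma_algebraType (@open M)).
Variable mu : {measure set borelM -> \bar R}.
Hypothesis hmu : is_volume_measure A g mu.
Implicit Types c : chart A.

Variables (u : nat -> M -> R) (p : nat -> M -> 'rV[R]_n) (alpha : M -> 'rV[R]_n).
Variables (psi : M -> R) (E : nat -> M -> \bar R) (N : set M).
Hypothesis cu : forall k, continuous (u k).
Hypothesis up : forall k, has_differential A (u k) (p k).
Hypothesis cp : forall k, continuous_form A (p k).
Hypothesis ubdry : forall k x, bdry A x -> u k x = 0.
Hypothesis calpha : continuous_form A alpha.
Hypothesis mpsi : measurable_fun [set: borelM] (psi : borelM -> R).
Hypothesis upsi : (\int[mu]_x ((u k x - psi x) ^+ 2)%:E)%E @[k --> \oo] --> 0%E.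
Hypothesis mN : measurable (N : set borelM).
Hypothesis muN : mu N = 0%E.
Hypothesis E0 : forall k x, (0 <= E k x)%E.
Hypothesis pE : forall k x, ~ N x ->
  ((((p k x - alpha x) *m invmx (g x) *m (p k x - alpha x)^T) 0 0)%:E <= E k x)%E.
Hypothesis Elim : (\int[mu]_x E k x)%E @[k --> \oo] --> 0%E.

Section InBox.
Variables (c : chart A) (a b : 'rV[R]_n) (k1 k2 K : R).
Hypothesis bb : box_bounds g c a b k1 k2 K.

Let ab : box a b. Proof. by case: bb. Qed.
Let k10 : 0 < k1. Proof. by case: bb. Qed.
Let K0 : 0 < K. Proof. by case: bb. Qed.
Let Qc : in_box a b `<=` cimg c. Proof. by move=> z zab; case: bb => _ _ _ /(_ z zab)[]. Qed.
Let dens z : in_box a b z -> k1 <= density g c z <= k2.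
Proof. by move=> zab; case: bb => _ _ _ /(_ z zab)[]. Qed.
Let gK z i : in_box a b z -> metric_in g c (cinv c z) i i <= K.
Proof. by move=> zab; case: bb => _ _ _ /(_ z zab)[]. Qed.

Definition box_fun (v : M -> R) (z : 'rV[R]_n) := v (cinv c (clampv a b z)).
Definition box_form (q : M -> 'rV[R]_n) i (z : 'rV[R]_n) :=
  covector_in c q (cinv c (clampv a b z)) 0 i.

Lemma cts_box_fun v : continuous v -> continuous (box_fun v).
Proof.
move=> cv.
exact: (@cts_clamp R n a b R (cimg c) (fun z => v (cinv c z)) ab Qc
  (fun z cz => continuous_chart hM cv cz)).
Qed.

Lemma cts_box_form q i : continuous_form A q -> continuous (box_form q i).
Proof.
move=> cq.
exact: (@cts_clamp R n a b R (cimg c) (fun z => covector_in c q (cinv c z) 0 i) ab Qc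
  (fun z cz => cq c i z cz)).
Qed.

Lemma box_fun_ftc v q : continuous v -> has_differential A v q -> continuous_form A q ->
  forall i z, in_box a b z ->
  box_fun v z = box_fun v (upd z i (a 0 i)) + prim a i (box_form q i) z.
Proof.
move=> cv vq cq i z zab; have /andP[az zb] := zab i.
have ub s : a 0 i <= s <= z 0 i -> in_box a b (upd z i s).
  by move=> /andP[s1 s2]; apply: upd_box => //; rewrite s1 (le_trans s2).
have cf : continuous (fun s => box_form q i (upd z i s)).
  apply: (cts_comp _ (@cts_box_form q i cq)); apply: cts_upd; last exact: cts_id.
  by move=> s; exact: cvg_cst.
have := @FTC2_hasd R (a 0 i) (z 0 i) _ (fun s => box_fun v (upd z i s)) az cf.
rewrite /prim upd_id => -> => [|t tz]; first by ring.
have -> : box_form q i (upd z i t) = covector_in c q (cinv c (upd z i t)) 0 i.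
  by rewrite /box_form clampv_id//; exact: ub.
have H : hasd `[a 0 i, z 0 i] (fun s => v (cinv c (upd z i s))) t
    (covector_in c q (cinv c (upd z i t)) 0 i).
  apply: (@pd_upd _ _ (cimg c) (fun y => v (cinv c y))).
    by move=> s /ub; exact: Qc.
  by apply: vq; apply: Qc; exact: ub.
apply: hasd_near H; last by rewrite /box_fun clampv_id//; exact: ub.
apply: filterE => s sz; split => //; rewrite /box_fun clampv_id//; apply: ub.
by move: sz; rewrite /= in_itv.
Qed.

Lemma box_compare_fun (h : 'rV[R]_n -> R) : continuous h -> (forall z, 0 <= h z) ->
  ((k1 * ritg a b h)%:E <= \int[mu]_(x in chart_box c a b) (h (cmap c x))%:E <=
   (k2 * ritg a b h)%:E)%E.
Proof. exact: (box_compare hM hg hmu ab Qc k10 dens). Qed.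

Lemma covector_inB q r x i : covector_in c (fun y => q y - r y) x 0 i =
  covector_in c q x 0 i - covector_in c r x 0 i.
Proof. by rewrite /covector_in mulmxBl mxE; congr (_ + _); rewrite mxE. Qed.

(** The [i]-th component in [c] is the pairing with the [i]-th coordinate vector of [c], whose
    squared length is [metric_in g c x i i]. *)
Lemma covector_sq_le q x i : metric_in g c x i i <= K ->
  covector_in c q x 0 i ^+ 2 <= K * (q x *m invmx (g x) *m (q x)^T) 0 0.
Proof.
move=> gx.
have Gs := Defs.metric_sym hg x; have Gp := @Defs.metric_pos _ _ _ _ _ _ hg x.
have Gu := metric_unit hg x.
pose v : 'rV[R]_n := row i (jacobian c (chart_at A x) x).
have -> : covector_in c q x 0 i = (q x *m v^T) 0 0.
  by rewrite /covector_in !mxE; apply: eq_bigr => j _; rewrite !mxE.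
apply: (le_trans (pairing_le Gs Gp Gu _ _)); rewrite mulrC ler_wpM2r ?coform_ge0//.
have -> : (v *m g x *m v^T) 0 0 = metric_in g c x i i.
  by rewrite /metric_in /v -row_mul mxE [RHS]mxE; apply: eq_bigr => j _; rewrite !mxE.
exact: gx.
Qed.

Lemma box_form_cvg i :
  norm1 a b (fun z => box_form (p k) i z - box_form alpha i z) @[k --> \oo] --> 0.
Proof.
pose h k z := box_form (p k) i z - box_form alpha i z.
have ch k : continuous (h k) by apply: ctsB; apply: cts_box_form.
have k1K : 0 < k1 * K^-1 by rewrite mulr_gt0 ?invr_gt0.
apply: (norm1_sq_cvg0 ab ch).
pose r k := ritg a b (fun z => h k z ^+ 2).
have r0 k : 0 <= r k by apply: ritg_ge0 => z _; exact: sqr_ge0.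
suff H : k1 * K^-1 * r k @[k --> \oo] --> 0.
  have rE : r = (fun k => (k1 * K^-1)^-1 * (k1 * K^-1 * r k)).
    by apply/funext => k; rewrite mulKf// gt_eqF.
  suff : r k @[k --> \oo] --> 0 by [].
  rewrite rE -[X in _ --> X](mulr0 (k1 * K^-1)^-1); apply: cvgM => //.
  exact: cvg_cst.
apply: (cvg0_le_ereal _ _ Elim) => k; first by rewrite mulr_ge0// ltW.
have c2 : continuous (fun z => h k z ^+ 2) by exact: ctsX.
have c3 : continuous (fun z => K^-1 * h k z ^+ 2) by apply: ctsM => //; exact: cts_cst.
(* With the factor [K^-1] inside, the integrand lies pointwise below the squared norm of the
   covector, hence below [E k]. *)
have h0 z : 0 <= K^-1 * h k z ^+ 2 by rewrite mulr_ge0 ?sqr_ge0// invr_ge0 ltW.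
have /andP[+ _] := box_compare_fun c3 h0.
rewrite (ritgZ _ ab c2) mulrA -/(r k) => /le_trans; apply.
have mV := measurable_chart_box hM c a b.
have mf := measurable_box_fun hM c a b c3.
(* The bound by [E] is available off the null set [N], which is removed first. *)
rewrite integral_mkcond (@ge0_negligible_integral _ _ _ mu _ N)//; last first.
  by move=> x _; rewrite patchE; case: ifPn => // _; rewrite lee_fin.
rewrite integral_mkcond; apply: le_integral_nonneg => x.
  by rewrite patchE; case: ifPn => // _; rewrite patchE; case: ifPn => // _; rewrite lee_fin.
rewrite patchE; case: ifPn => [/set_mem[_ Nx]|_]; last exact: E0.
rewrite patchE; case: ifPn => [/set_mem[cx xab]|_]; last exact: E0.
apply: le_trans (pE k Nx); rewrite lee_fin ler_pdivrMl// /h /box_form clampv_id//.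
rewrite (mfd_cinvK hM)// -covector_inB; apply: covector_sq_le.
by have := gK i xab; rewrite (mfd_cinvK hM).
Qed.

(** The limit [psi] is merely measurable and cannot enter [norm1], which is meant for continuous
    functions; the Cauchy property is what survives. *)
Lemma box_fun_cauchy e : 0 < e -> exists N, forall k l, (N <= k)%N -> (N <= l)%N ->
  norm1 a b (fun z => box_fun (u k) z - box_fun (u l) z) <= e.
Proof.
move=> e0; have [t t0 ht] := norm1_small ab e0.
(* One factor 1/2 comes from [(x - y) ^+ 2 / 2 <= (x - z) ^+ 2 + (y - z) ^+ 2], the other from the
   two indices [k] and [l]; [k1] from the comparison of measures. *)
have kt0 : 0 < k1 * 2^-1 * t / 2 by rewrite !mulr_gt0// ?invr_gt0.
have H : \forall k \near \oo, (\int[mu]_x ((u k x - psi x) ^+ 2)%:E < (k1 * 2^-1 * t / 2)%:E)%E.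
  have lt0 : (0 < (k1 * 2^-1 * t / 2)%:E)%E by rewrite lte_fin.
  have nb : nbhs 0%E [set y : \bar R | (y < (k1 * 2^-1 * t / 2)%:E)%E].
    by apply: open_nbhs_nbhs; split => //; exact: open_ereal_lt_ereal.
  exact: (upsi nb).
have [N0 _ HN] := H.
exists N0 => k l Nk Nl.
pose h z := box_fun (u k) z - box_fun (u l) z.
have ch : continuous h by apply: ctsB; exact: cts_box_fun.
apply: ht => //; have c2 : continuous (fun z => h z ^+ 2) by exact: ctsX.
have c3 : continuous (fun z => 2^-1 * h z ^+ 2) by apply: ctsM => //; exact: cts_cst.
have h0 z : 0 <= 2^-1 * h z ^+ 2 by rewrite mulr_ge0 ?sqr_ge0.
have /andP[+ _] := box_compare_fun c3 h0.
rewrite (ritgZ _ ab c2) mulrA => le1.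
have ms j : measurable_fun [set: borelM] (fun x => ((u j x - psi x) ^+ 2)%:E).
  apply/measurable_EFinP; apply: measurable_funX; apply: measurable_funB => //.
  exact: (continuous_borel (@cu j)).
have : (\int[mu]_(x in chart_box c a b) (2^-1 * h (cmap c x) ^+ 2)%:E <=
  \int[mu]_x (((u k x - psi x) ^+ 2)%:E + ((u l x - psi x) ^+ 2)%:E))%E.
  rewrite integral_mkcond; apply: le_integral_nonneg => x.
    by rewrite patchE; case: ifPn => // _; rewrite lee_fin.
  rewrite patchE -EFinD; case: ifPn => [/set_mem[cx xab]|_]; last by rewrite lee_fin addr_ge0 ?sqr_ge0.
  rewrite lee_fin /h /box_fun clampv_id// (mfd_cinvK hM)//.
  move: (u k x) (u l x) (psi x) => x1 x2 x3; have := sqr_ge0 (x1 - x3 + (x2 - x3)).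
  by rewrite !expr2 => hx; nra.
rewrite ge0_integralD//; try by move=> x _; rewrite lee_fin sqr_ge0.
move=> le2; have lt3 := lteD (HN k Nk) (HN l Nl).
have := le_lt_trans (le_trans le1 le2) lt3; rewrite -EFinD lte_fin => h3.
have k12 : 0 < k1 / 2 by rewrite divr_gt0.
rewrite -(ler_pM2l k12) ltW// (lt_le_trans h3)//.
by move: (k1 / 2) => y; lra.
Qed.

Lemma box_potential : exists w : 'rV[R]_n -> R,
  [/\ continuous w, norm1 a b (fun z => box_fun (u k) z - w z) @[k --> \oo] --> 0,
      forall i z, in_box a b z -> w z = w (upd z i (a 0 i)) + prim a i (box_form alpha i) z &
      forall i : 'I_n, i = 0%N :> nat -> a 0 i = 0 ->
        forall z, in_box a b z -> w (upd z i 0) = 0].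
Proof.
have [w [cw w1 w2 w3]] := @local_potential R n a b ab (box_form alpha)
  (fun k => box_fun (u k)) (fun k => box_form (p k))
  (fun i => @cts_box_form _ i calpha) (fun k => @cts_box_fun _ (@cu k))
  (fun k i => @cts_box_form _ i (@cp k))
  (fun k i z zab => @box_fun_ftc _ _ (@cu k) (@up k) (@cp k) i z zab)
  box_form_cvg box_fun_cauchy.
exists w; split => // i i0 a0 z zab.
suff : w (upd z i (a 0 i)) = 0 by rewrite a0.
apply: w3 => // k y yab.
have yab' : in_box a b (upd y i (a 0 i)) by apply: upd_box => //; rewrite lexx ltW.
rewrite /box_fun clampv_id//; apply: ubdry.
have /(cimgP hM)[cy e] := Qc yab'.
exists c; split => // j j0; rewrite e updE.
have -> : j = i by apply/val_inj; rewrite /= j0 i0.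
by rewrite eqxx a0.
Qed.

End InBox.
End WeakPotential.

(** [x2] and [x4] are values of two candidate limits, close to [x1] and [x3] respectively; a common
    approximant [x5] cannot be close to both. *)
Lemma half_dist_le (R : realType) (x1 x2 x3 x4 x5 : R) :
  `|x1 - x2| <= `|x1 - x3| / 4 -> `|x3 - x4| <= `|x1 - x3| / 4 ->
  `|x1 - x3| / 2 <= `|x5 - x2| + `|x5 - x4|.
Proof.
have t1 := ler_normD (x1 - x2) (x2 - x3); rewrite addrA subrK in t1.
have t2 := ler_normD (x2 - x4) (x4 - x3); rewrite addrA subrK in t2.
have t3 := ler_normD (x2 - x5) (x5 - x4); rewrite addrA subrK in t3.
rewrite [`|x2 - x5|]distrC in t3; rewrite [`|x4 - x3|]distrC in t2.
move: `|x1 - x2| `|x3 - x4| `|x1 - x3| `|x2 - x3| `|x2 - x4| `|x5 - x2| `|x5 - x4| t1 t2 t3.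
by move=> y1 y2 y3 y4 y5 y6 y7; lra.
Qed.

(** * Gluing the local potentials *)

Section WeakPotentialGlue.
Context {R : realType} {n : nat} {M : ptopologicalType} (A : atlas R n M).
Hypothesis hn : (0 < n)%N.
Hypothesis hM : is_manifold_with_boundary A.
Variable g : M -> 'M[R]_n.
Hypothesis hg : is_riemannian_metric A g 6.
Local Notation borelM := (g_sigma_algebraType (@open M)).
Variable mu : {measure set borelM -> \bar R}.
Hypothesis hmu : is_volume_measure A g mu.
Implicit Types c : chart A.
Variables (u : nat -> M -> R) (alpha : M -> 'rV[R]_n).
Hypothesis cu : forall k, continuous (u k).
Hypothesis calpha : continuous_form A alpha.

Definition local_limit c (a b : 'rV[R]_n) (w : 'rV[R]_n -> R) :=
  [/\ exists k1 k2 K, box_bounds g c a b k1 k2 K, continuous w,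
      norm1 a b (fun z => box_fun c a b (u k) z - w z) @[k --> \oo] --> 0,
      forall i z, in_box a b z -> w z = w (upd z i (a 0 i)) + prim a i (box_form c a b alpha i) z &
      forall i : 'I_n, i = 0%N :> nat -> a 0 i = 0 ->
        forall z, in_box a b z -> w (upd z i 0) = 0].

Lemma near_cts_cmap c x (w : 'rV[R]_n -> R) e : cdom c x -> continuous w -> 0 < e ->
  \forall y \near x, `|w (cmap c x) - w (cmap c y)| <= e.
Proof.
move=> cx cw e0.
have /cvgrPdist_le H := cw (cmap c x); have {}H := H e e0.
have H' : \forall y \near cmap c x, `|w (cmap c x) - w y| <= e by exact: H.
by apply: filterS (near_cmap hM cx H') => y [].
Qed.

(** Both are limits of the same [u k]. If they differed by [d] at [x], then on a small box around
    [x] their two errors would add up to at least [d / 2] for every [k], so the integrated errors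
    could not both tend to 0. *)
Lemma local_limit_unique c a b w c' a' b' w' x : local_limit c a b w -> local_limit c' a' b' w' ->
  nbhs x (chart_box c a b) -> nbhs x (chart_box c' a' b') -> w (cmap c x) = w' (cmap c' x).
Proof.
move=> [[k1 [k2 [K bb]]] cw w1 _ _] [[k1' [k2' [K' bb']]] cw' w1' _ _] xV xV'.
have [cx _] := nbhs_singleton xV; have [cx' _] := nbhs_singleton xV'.
apply/eqP; rewrite -subr_eq0 -normr_eq0; apply/negPn/negP => d0.
set d := `|_| in d0; have {}d0 : 0 < d by rewrite lt_def d0 normr_ge0.
have d4 : 0 < d / 4 by rewrite divr_gt0.
have H1 := near_cts_cmap cx cw d4; have H2 := near_cts_cmap cx' cw' d4.
have xU : nbhs x ((chart_box c a b `&` chart_box c' a' b') `&`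
    ((fun y => `|w (cmap c x) - w (cmap c y)| <= d / 4) `&`
     (fun y => `|w' (cmap c' x) - w' (cmap c' y)| <= d / 4))).
  by apply: filterI; apply: filterI.
have [a2 [b2 [l1 [l2 [L [bb2 xb2 bU _ _]]]]]] := exists_box hM hg cx xU.
have [ab2 l10 _ bd2] := bb2; have [ab k10 _ bd] := bb; have [ab' k10' _ bd'] := bb'.
(* A lower bound for the integral of [d / 2] over the small box, independent of [k]. *)
pose C := l1 * (ritg a2 b2 (fun=> 1) * (d / 2)).
have C0 : 0 < C by rewrite mulr_gt0// mulr_gt0 ?divr_gt0// ritg1_gt0.
pose h k z := `|box_fun c a b (u k) z - w z|.
pose h' k z := `|box_fun c' a' b' (u k) z - w' z|.
have ch k : continuous (h k).
  by apply: cts_norm; apply: ctsB => //; exact: (cts_box_fun hM bb (@cu k)).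
have ch' k : continuous (h' k).
  by apply: cts_norm; apply: ctsB => //; exact: (cts_box_fun hM bb' (@cu k)).
have h0 k z : 0 <= h k z by exact: normr_ge0.
have h0' k z : 0 <= h' k z by exact: normr_ge0.
have main k : C <= k2 * ritg a b (h k) + k2' * ritg a' b' (h' k).
  have /andP[_ le1] := box_compare_fun hM hg hmu bb (ch k) (h0 k).
  have /andP[_ le1'] := box_compare_fun hM hg hmu bb' (ch' k) (h0' k).
  have d20 (z : 'rV[R]_n) : 0 <= d / 2 by rewrite ltW// divr_gt0.
  have cd : continuous (fun _ : 'rV[R]_n => d / 2) by exact: cts_cst.
  have /andP[le2 _] := box_compare_fun hM hg hmu bb2 cd d20.
  rewrite (ritg_cst _ ab2) -/C in le2.
  rewrite -lee_fin EFinD (le_trans le2)// (le_trans _ (leeD le1 le1'))//.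
  rewrite integral_mkcond [X in (_ <= X + _)%E]integral_mkcond [X in (_ <= _ + X)%E]integral_mkcond.
  have pos c0 a0 b0 (f : 'rV[R]_n -> R) : (forall z, 0 <= f z) ->
      forall x, (0 <= ((fun x => (f (cmap c0 x))%:E) \_ (chart_box c0 a0 b0)) x)%E.
    by move=> f0 y; rewrite patchE; case: ifPn => // _; rewrite lee_fin.
  rewrite -ge0_integralD//; last 4 first.
  - by move=> y _; exact: pos.
  - exact: (measurable_box_fun hM c a b (ch k)).
  - by move=> y _; exact: pos.
  - exact: (measurable_box_fun hM c' a' b' (ch' k)).
  apply: le_integral_nonneg => y; first exact: (pos c a2 b2 (fun=> d / 2)).
  rewrite patchE; case: ifPn => [/set_mem[cy yab]|_]; last by rewrite adde_ge0// pos.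
  have := bU _ yab; rewrite (mfd_cinvK hM)// => -[[yV yV'] [e1 e2]].
  rewrite !patchE !mem_set// -EFinD lee_fin /h /h' /box_fun.
  have [_ yb] := yV; have [cy' yb'] := yV'; rewrite !clampv_id// !(mfd_cinvK hM)//.
  exact: half_dist_le e1 e2.
have lim0 : k2 * ritg a b (h k) + k2' * ritg a' b' (h' k) @[k --> \oo] --> 0.
  rewrite -[X in _ --> X](addr0 0); apply: cvgD.
    rewrite -[X in _ --> X](mulr0 k2); apply: cvgM; [exact: cvg_cst|exact: w1].
  rewrite -[X in _ --> X](mulr0 k2'); apply: cvgM; [exact: cvg_cst|exact: w1'].
have : C <= 0.
  by apply: (cvgr_to_ge lim0); apply: nearW => k; exact: main.
by rewrite leNgt C0.
Qed.

Hypothesis local_exists : forall c (a b : 'rV[R]_n) k1 k2 K, box_bounds g c a b k1 k2 K ->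
  exists w, local_limit c a b w.

Let local_at c x : cdom c x -> exists abw : 'rV[R]_n * 'rV[R]_n * ('rV[R]_n -> R),
  [/\ local_limit c abw.1.1 abw.1.2 abw.2, in_box abw.1.1 abw.1.2 (cmap c x),
      nbhs x (chart_box c abw.1.1 abw.1.2) &
      forall i : 'I_n, i = 0%N :> nat -> cmap c x 0 i = 0 -> abw.1.1 0 i = 0].
Proof.
move=> cx; have xT : nbhs x [set: M] by exact: filterT.
have [a [b [k1 [k2 [K [bb xb _ xV a0]]]]]] := exists_box hM hg cx xT.
by have [w hw] := local_exists bb; exists (a, b, w).
Qed.

(** Each point takes its value from a box chosen at that point. By uniqueness this agrees near the
    point with the limit in any other box around it, so every property reduces to a single box. *)
Lemma glue_potential : exists v : M -> R,
  [/\ continuous v, forall x, bdry A x -> v x = 0 & has_differential A v alpha].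
Proof.
have /choice[f hf] x := local_at (mfd_chart_at hM x).
pose v x := (f x).2 (cmap (chart_at A x) x).
have vE c a b w x : local_limit c a b w -> nbhs x (chart_box c a b) -> v x = w (cmap c x).
  move=> hw xV; have [h1 _ h2 _] := hf x; exact: (local_limit_unique h1 hw h2 xV).
have vnear c a b w (x : M) : local_limit c a b w -> nbhs x (chart_box c a b) ->
    \forall y \near x, v y = w (cmap c y).
  move=> hw xV; have xI : \forall y \near x, nbhs y (chart_box c a b) by exact: nbhs_interior.
  by apply: filterS xI => y; exact: vE.
exists v; split.
- move=> x; have cx := mfd_chart_at hM x; have [abw [hw _ xV _]] := local_at cx.
  have [_ cw _ _ _] := hw; apply/cvgrPdist_le => e e0.
  rewrite (vE _ _ _ _ _ hw xV).
  have H := near_cts_cmap cx cw e0; have H' := vnear _ _ _ _ _ hw xV.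
  suff : \forall y \near x, `|abw.2 (cmap (chart_at A x) x) - v y| <= e by [].
  by apply: filterS2 H H' => y + ->.
- move=> x [c [cx x0]]; have [abw [hw xb xV a0]] := local_at cx.
  pose i := Ordinal hn; have xi : cmap c x 0 i = 0 by exact: x0.
  rewrite (vE _ _ _ _ _ hw xV) -(upd_id (cmap c x) i) xi.
  by have [_ _ _ _ h] := hw; apply: h => //; exact: a0.
- move=> c z i cz; have /(cimgP hM)[cx zx] := cz; set x := cinv c z in cx zx *.
  have [[[a b] w] []] := local_at cx; rewrite /= zx => hw zb xV _.
  have [[k1 [k2 [K bb]]] cw _ wE _] := hw.
  have nV : \forall y \near z, cimg c y -> v (cinv c y) = w y /\ in_box a b y.
    have H : \forall y \near x, v y = w (cmap c y) /\ chart_box c a b y.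
      by apply: filterI; [exact: vnear hw xV|exact: xV].
    apply: filterS (near_cinv hM cz H) => y hy cy; have [h1 [_ h2]] := hy cy.
    by have /(cimgP hM)[_ e] := cy; move: h1 h2; rewrite e.
  have ->: covector_in c alpha x 0 i = box_form c a b alpha i z.
    by rewrite /box_form clampv_id.
  apply: (@pd_near R n (cimg c) (cimg c) w) => //.
    by apply: filterS nV => y h cy; split => //; have [->] := h cy.
  apply: (pd_of_box_ftc zb _ _ (wE i)).
    by apply: filterS nV => y h cy; have [] := h cy.
  exact: (@cts_box_form _ _ _ _ g c a b k1 k2 K bb alpha i calpha).
Qed.

End WeakPotentialGlue.

(** * Real and imaginary parts *)

Section ComplexParts.
Context {R : realType}.

Lemma sum_complexE (I : Type) (r : seq I) (P : pred I) (F : I -> R[i]) :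
  \sum_(i <- r | P i) F i = Complex (\sum_(i <- r | P i) complex.Re (F i))
                                    (\sum_(i <- r | P i) complex.Im (F i)).
Proof.
elim: r => [|i r IH]; first by rewrite !big_nil.
rewrite !big_cons; case: (P i) => //; rewrite IH.
by case: (F i).
Qed.

Definition to_complex n (a : 'rV[R]_n) : 'rV[R[i]]_n := map_mx (real_complex R) a.

Lemma re_to_complex n (a : 'rV[R]_n) : re_row (to_complex a) = a.
Proof. by apply/rowP => i; rewrite !mxE. Qed.

Lemma im_to_complex n (a : 'rV[R]_n) : im_row (to_complex a) = 0.
Proof. by apply/rowP => i; rewrite !mxE. Qed.

Lemma re_rowB n (a b : 'rV[R[i]]_n) : re_row (a - b) = re_row a - re_row b.
Proof. by apply/rowP => i; rewrite !mxE; case: (a 0 i); case: (b 0 i). Qed.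

Lemma pairingE n (a : 'rV[R[i]]_n) (v : 'rV[R]_n) :
  pairing a v = Complex (\sum_i re_row a 0 i * v 0 i) (\sum_i im_row a 0 i * v 0 i).
Proof.
rewrite /pairing sum_complexE; congr Complex; apply: eq_bigr => i _; rewrite mxE.
  by case: (a 0 i) => x y /=; rewrite mulr0 subr0.
by case: (a 0 i) => x y /=; rewrite mulr0 add0r.
Qed.

Lemma re_codot n (M : ptopologicalType) (g : M -> 'M[R]_n) x (a : 'rV[R[i]]_n) :
  complex.Re (codot g x a a) = (re_row a *m invmx (g x) *m (re_row a)^T) 0 0 +
    (im_row a *m invmx (g x) *m (im_row a)^T) 0 0.
Proof.
rewrite /codot mxE sum_complexE /= [X in _ = X + _]mxE [X in _ = _ + X]mxE -big_split/=.
apply: eq_bigr => j _.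
rewrite [X in complex.Re (X * _)]mxE sum_complexE.
have -> : \sum_i complex.Re (a 0 i * map_mx (real_complex R) (invmx (g x)) i j) =
   (re_row a *m invmx (g x)) 0 j.
  rewrite [RHS]mxE; apply: eq_bigr => i _; rewrite !mxE.
  by case: (a 0 i) => u v /=; rewrite mulr0 subr0.
have -> : \sum_i complex.Im (a 0 i * map_mx (real_complex R) (invmx (g x)) i j) =
   (im_row a *m invmx (g x)) 0 j.
  rewrite [RHS]mxE; apply: eq_bigr => i _; rewrite !mxE.
  by case: (a 0 i) => u v /=; rewrite mulr0 add0r.
move: (re_row a *m _) (im_row a *m _) => p q.
by rewrite !mxE; case: (a 0 j) => u v /=; rewrite mulrN opprK.
Qed.

End ComplexParts.

(** * Forms with vanishing solenoidal part *)

Section Solenoidal.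
Context {R : realType} {n : nat} {M : ptopologicalType} (A : atlas R n M).
Hypothesis hn : (0 < n)%N.
Hypothesis hM : is_manifold_with_boundary A.
Variable g : M -> 'M[R]_n.
Hypothesis hg : is_riemannian_metric A g 6.
Local Notation borelM := (g_sigma_algebraType (@open M)).
Variable mu : {measure set borelM -> \bar R}.
Hypothesis hmu : is_volume_measure A g mu.

Lemma le_cvg0e (e f : nat -> \bar R) : (forall k, (0 <= e k)%E) -> (forall k, (e k <= f k)%E) ->
  f k @[k --> \oo] --> 0%E -> e k @[k --> \oo] --> 0%E.
Proof.
move=> e0 ef f0; have z0 : (fun=> 0%E) k @[k --> \oo] --> (0%E : \bar R) by exact: cvg_cst.
have nre : \forall k \near \oo, ((fun=> 0%E) k <= e k <= f k)%E.
  by apply: nearW => k; rewrite e0 ef.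
exact: squeeze_cvge nre _ z0 f0.
Qed.

Lemma re_codot_ge0 x (a : 'rV[R[i]]_n) : 0 <= complex.Re (codot g x a a).
Proof.
have Gs := Defs.metric_sym hg x; have Gp := @Defs.metric_pos _ _ _ _ _ _ hg x.
by rewrite re_codot addr_ge0// coform_ge0// (metric_unit hg).
Qed.

(** Here [alpha] equals almost everywhere the weak differential [eta] of some [psi] in [H^1_0]. The
    real parts of the test functions that approximate [psi] are the sequence [u]; they vanish on the
    boundary. *)
Lemma solenoidal_potential (alpha : M -> 'rV[R]_n) : continuous_form A alpha ->
  solenoidal_part A g mu (fun x => to_complex (alpha x)) (fun=> 0) ->
  exists v : M -> R,
  [/\ continuous v, forall x, bdry A x -> v x = 0 & has_differential A v alpha].
Proof.
move=> calpha [psi [eta [[[mpsi _] _ [phi [tphi phi1 phi2]]] _ [N [mN N0 hN]]]]].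
pose u k x := complex.Re (phi k x).
pose p k x := re_row (differential A (phi k) x).
have Ck1 k (c : chart A) : Ck 1 (cimg c) (fun z => u k (cinv c z)).
  by have [/(_ 1%N c)[]] := tphi k.
have cu k : continuous (u k) by apply: (@Ck_continuous _ _ _ _ hM 1); exact: Ck1.
have up k : has_differential A (u k) (p k).
  apply: (C1_has_differential hM (Ck1 k)) => x.
  by apply/rowP => i; rewrite !mxE.
have cp k : continuous_form A (p k) by exact: (C1_continuous_form hM (Ck1 k)).
have ub k x : bdry A x -> u k x = 0.
  move=> xb; have [_ _ h] := tphi k; rewrite /u.
  have [->//|px] := eqVneq (phi k x) 0.
  have px' : [set x | phi k x != 0] x by [].
  by have := h x (subset_closure px').
have upsi : (\int[mu]_x ((u k x - complex.Re (psi x)) ^+ 2)%:E)%E @[k --> \oo] --> 0%E.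
  apply: (le_cvg0e _ _ phi1) => k.
    by apply: integral_ge0 => x _; rewrite lee_fin sqr_ge0.
  apply: le_integral_nonneg => x; rewrite lee_fin ?sqr_ge0//.
  rewrite /u; case: (phi k x) (psi x) => x1 y1 [x2 y2] /=.
  by rewrite lerDl sqr_ge0.
apply: (@glue_potential _ _ _ _ hn hM _ hg _ hmu u alpha cu calpha) => c a b k1 k2 K bb.
(* The full complex norm, whose integrals tend to 0 by [H10]; off [N] it dominates the squared norm
   of the real part since [eta] is there the real form [alpha]. *)
pose E k x := (complex.Re (codot g x (differential A (phi k) x - eta x)
                                 (differential A (phi k) x - eta x)))%:E.
have E0 k x : (0 <= E k x)%E by rewrite lee_fin re_codot_ge0.
have pE k x : ~ N x ->
    ((((p k x - alpha x) *m invmx (g x) *m (p k x - alpha x)^T) 0 0)%:E <= E k x)%E.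
  move=> Nx; have ex : 0 = to_complex (alpha x) - eta x by apply: contrapT => h; exact: Nx (hN x h).
  have {}ex : eta x = to_complex (alpha x) by apply/eqP; rewrite eq_sym -subr_eq0 -ex.
  have Gs := Defs.metric_sym hg x; have Gp := @Defs.metric_pos _ _ _ _ _ _ hg x.
  rewrite lee_fin re_codot ex re_rowB re_to_complex lerDl coform_ge0//.
  exact: (metric_unit hg).
have [w [w1 w2 w3 w4]] := @box_potential _ _ _ _ hM _ hg _ hmu u p alpha
  (fun x => complex.Re (psi x)) E N cu up cp ub calpha mpsi upsi mN N0 E0 pE phi2 c a b k1 k2 K bb.
by exists w; split => //; exists k1, k2, K.
Qed.

End Solenoidal.

Lemma cvg_comp_pair (I : Type) (F : set_system I) {FF : Filter F} (X Y Z : topologicalType)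
    (h : X * Y -> Z) (u : I -> X) (v : I -> Y) (x : X) (y : Y) (l : Z) :
  u i @[i --> F] --> x -> v i @[i --> F] --> y -> h p @[p --> (x, y)] --> l ->
  h (u i, v i) @[i --> F] --> l.
Proof.
move=> ux vy hl; apply: (@cvg_comp _ _ _ (fun i => (u i, v i)) h F (nbhs (x, y)) (nbhs l)) => //.
exact: cvg_pair.
Qed.

(** * Moments along null geodesics *)

Section CtsForms.
Context {R : realType} {n : nat} {M : ptopologicalType} (A : atlas R n M).
Hypothesis hM : is_manifold_with_boundary A.
Implicit Types c : chart A.

(** Joint continuity is required of components in a fixed chart: [F s x] itself is written in
    [chart_at A x], which may jump with [x]. *)
Definition cts_form2 (F : R -> M -> 'rV[R]_n) := forall c i s x, cdom c x ->
  covector_in c (F p.1) p.2 0 i @[p --> (s, x)] --> covector_in c (F s) x 0 i.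

Lemma covector_inE c (a : M -> 'rV[R]_n) x i :
  covector_in c a x 0 i = \sum_j jacobian c (chart_at A x) x i j * a x 0 j.
Proof. by rewrite mxE; apply: eq_bigr => j _; rewrite !mxE mulrC. Qed.

Lemma cts_form2_time (F : R -> M -> 'rV[R]_n) c x i : cts_form2 F ->
  continuous (fun s => covector_in c (F s) x 0 i).
Proof.
move=> cF; under eq_fun do rewrite covector_inE.
apply: cts_sum => j; apply: ctsM; first exact: cts_cst.
move=> s; have cx := mfd_chart_at hM x.
have H := cF (chart_at A x) j s x cx.
have E t : covector_in (chart_at A x) (F t) x 0 j = F t x 0 j by rewrite (covector_in_id hM).
have : covector_in (chart_at A x) (F t) x 0 j @[t --> s] --> covector_in (chart_at A x) (F s) x 0 j.
  exact: (cvg_comp_pair (@cvg_id _ (nbhs s)) (@cvg_cst _ x _ (nbhs s) _) H).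
by under eq_fun do rewrite E; rewrite E.
Qed.

Lemma continuous_form_cvg (a : M -> 'rV[R]_n) c x i : continuous_form A a -> cdom c x ->
  covector_in c a y 0 i @[y --> x] --> covector_in c a x 0 i.
Proof.
move=> ca cx P Px; have H := ca c i _ (cimg_cmap cx); rewrite (mfd_cinvK hM)// in H.
have {}H : \forall y \near cmap c x, cimg c y -> P (covector_in c a (cinv c y) 0 i).
  by exact: (H P Px).
suff : \forall y \near x, P (covector_in c a y 0 i) by [].
apply: filterS (near_cmap hM cx H) => y [cy /(_ (cimg_cmap cy))].
by rewrite (mfd_cinvK hM).
Qed.

Lemma cvg_continuous_form (a : M -> 'rV[R]_n) :
  (forall c i x, cdom c x -> covector_in c a y 0 i @[y --> x] --> covector_in c a x 0 i) ->
  continuous_form A a.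
Proof.
move=> ha c i z cz; have /(cimgP hM)[cx _] := cz.
exact: (cvg_comp _ _ (@cinv_cvg _ _ _ _ hM c z cz) (ha c i _ cx)).
Qed.

Lemma cts_form2_section (F : R -> M -> 'rV[R]_n) s : cts_form2 F -> continuous_form A (F s).
Proof.
move=> cF; apply: cvg_continuous_form => c i x cx.
exact: (cvg_comp_pair (@cvg_cst _ s _ (nbhs x) _) (@cvg_id _ (nbhs x)) (cF c i s x cx)).
Qed.

End CtsForms.

Section AlongGeodesic.
Context {R : realType} {n : nat} {M : ptopologicalType} (A : atlas R n M).
Hypothesis hM : is_manifold_with_boundary A.
Variable g : M -> 'M[R]_n.
Hypothesis hg : is_riemannian_metric A g 6.
Implicit Types c : chart A.
Variables (L : R) (gamma : R -> M).
Hypothesis L0 : 0 < L.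
Hypothesis geo : geodesic A g L gamma.

(** Functions along the geodesic, composed with it, become continuous on all of [R], as [itg] and
    its lemmas require. *)
Definition clamp1 (t : R) := Num.max 0 (Num.min t L).

Lemma clamp1_itv t : 0 <= clamp1 t <= L.
Proof. by rewrite le_max lexx/= ge_max ge_min lexx orbT (ltW L0). Qed.

Lemma clamp1_id t : 0 <= t <= L -> clamp1 t = t.
Proof. by move=> /andP[t0 tL]; rewrite /clamp1 (min_idPl tL) (max_idPr t0). Qed.

Lemma cts_clamp1 : continuous clamp1.
Proof. by apply: cts_max; [exact: cts_cst|apply: cts_min; [exact: cts_id|exact: cts_cst]]. Qed.

Lemma near_clamp1 t (P : R -> Prop) : (\forall s \near clamp1 t, `[0, L]%classic s -> P s) ->
  \forall s \near t, P (clamp1 s).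
Proof.
move=> H; have K : \forall s \near t, `[0, L]%classic (clamp1 s) -> P (clamp1 s).
  by exact: (@cts_clamp1 t _ H).
by apply: filterS K => s; apply; rewrite /= in_itv/=; exact: clamp1_itv.
Qed.

Lemma cvg_clamp1 (X : topologicalType) (f : R -> X) t :
  f s @[s --> within `[0, L] (nbhs (clamp1 t))] --> f (clamp1 t) ->
  f (clamp1 s) @[s --> t] --> f (clamp1 t).
Proof.
move=> H P Px; have {}H : \forall s \near clamp1 t, `[0, L]%classic s -> P (f s).
  by exact: (H P Px).
exact: (near_clamp1 H).
Qed.

Lemma cts_geodesic : continuous (gamma \o clamp1).
Proof.
move=> t; have [/subspace_continuousP cg _] := geo.
apply: cvg_clamp1; apply: cg; rewrite /= in_itv/=; exact: clamp1_itv.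
Qed.

Definition along (a : M -> 'rV[R]_n) (t : R) :=
  \sum_i a (gamma t) 0 i * velocity A `[0, L] gamma t 0 i.

Lemma along_chart c (a : M -> 'rV[R]_n) t : 0 <= t <= L -> cdom c (gamma t) ->
  along a t = \sum_j covector_in c a (gamma t) 0 j * vel c L gamma j t.
Proof.
move=> tL cx; have cx' := mfd_chart_at hM (gamma t); set c' := chart_at A (gamma t) in cx' *.
have velE i : velocity A `[0, L] gamma t 0 i =
    \sum_j vel c L gamma j t * jacobian c c' (gamma t) j i.
  rewrite mxE; apply: hasd_derive_in; first exact: itv_proper.
  apply: (hasd_chart hM _ cx cx') => [|j]; last exact: (geodesic_pos j geo tL cx).
  by apply: filterS2 (geodesic_near hM geo tL cx) (geodesic_near hM geo tL cx') => s h1 h2 h;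
    split; [exact: h1|exact: h2].
rewrite /along.
under eq_bigr do rewrite velE mulr_sumr.
rewrite exchange_big/=; apply: eq_bigr => j _; rewrite covector_inE mulr_suml.
by apply: eq_bigr => i _; ring.
Qed.

Lemma cts_along2 (F : R -> M -> 'rV[R]_n) : cts_form2 A F ->
  continuous (fun p : R * R => along (F p.1) (clamp1 p.2)).
Proof.
move=> cF [s t]; have tL := clamp1_itv t; pose c := chart_at A (gamma (clamp1 t)).
have cx : cdom c (gamma (clamp1 t)) := mfd_chart_at hM _.
pose f (p : R * R) := \sum_j covector_in c (F p.1) (gamma (clamp1 p.2)) 0 j * vel c L gamma j (clamp1 p.2).
have E p : cdom c (gamma (clamp1 p.2)) -> along (F p.1) (clamp1 p.2) = f p.
  by move=> h; apply: along_chart => //; exact: clamp1_itv.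
have H : f p @[p --> (s, t)] --> f (s, t).
  rewrite /f; apply: cvg_sumR => j; apply: cvgM.
    exact: (cvg_comp_pair (@cts_fst R R (s, t))
      (@cts_comp _ _ _ _ _ (@cts_snd R R) cts_geodesic (s, t)) (cF c j s _ cx)).
  have hv := cvg_clamp1 (vel_cvg (i := j) geo tL cx).
  exact: (cvg_comp _ _ (@cts_snd R R (s, t)) hv).
have nc : \forall p \near (s, t), cdom c (gamma (clamp1 p.2)).
  have n1 := near_clamp1 (geodesic_near hM geo tL cx).
  exact: (@cts_snd R R (s, t) _ n1).
have E0 : along (F s) (clamp1 t) = f (s, t) by exact: (E (s, t) cx).
move=> P; rewrite /= E0 => /H h.
have h' : \forall p \near (s, t), P (f p) by exact: h.
suff : \forall p \near (s, t), P (along (F p.1) (clamp1 p.2)) by [].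
by apply: filterS2 nc h' => p /E ->.
Qed.

Lemma cts_along (a : M -> 'rV[R]_n) : continuous_form A a -> continuous (along a \o clamp1).
Proof.
move=> ca; have c2 : cts_form2 A (fun=> a).
  move=> c i s x cx.
  exact: (cvg_comp _ _ (@cts_snd R M (s, x)) (continuous_form_cvg hM (i := i) ca cx)).
exact: (@continuous_curry1 R R R (fun s t => along a (clamp1 t)) (cts_along2 c2) 0).
Qed.

Lemma hasd_along (u : M -> R) a t : has_differential A u a -> continuous_form A a ->
  0 <= t <= L -> hasd `[0, L] (fun s => u (gamma s)) t (along a t).
Proof.
move=> hu ca tL; have cx := mfd_chart_at hM (gamma t).
rewrite (along_chart a tL cx).
apply: (differential_chain hM hu ca cx); first exact: (geodesic_near hM geo tL cx).
by move=> i; exact: (geodesic_pos i geo tL cx).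
Qed.

End AlongGeodesic.

Section ItgSums.
Context {R : realType}.

Lemma itg_sum (I : Type) (r : seq I) (f : I -> R -> R) (a b : R) :
  (forall i, continuous (f i)) ->
  itg a b (fun s => \sum_(i <- r) f i s) = \sum_(i <- r) itg a b (f i).
Proof.
move=> cf; elim: r => [|i r IH].
  by rewrite big_nil; apply: itg0 => x _; rewrite big_nil.
rewrite big_cons -IH -itgD//; last exact: cts_sum.
by apply: eq_itg => x _; rewrite big_cons.
Qed.

Lemma itg_binomial (T t : R) (h : R -> R) k : continuous h ->
  itg 0 T (fun s => (s - t) ^+ k * h s) =
  \sum_(j < k.+1) 'C(k, j)%:R * (- t) ^+ (k - j) * itg 0 T (fun s => s ^+ j * h s).
Proof.
move=> ch.
have cj j : continuous (fun s : R => s ^+ j * h s).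
  by apply: ctsM => //; apply: ctsX; exact: cts_id.
have -> : itg 0 T (fun s => (s - t) ^+ k * h s) =
  itg 0 T (fun s => \sum_(j < k.+1) ('C(k, j)%:R * (- t) ^+ (k - j)) * (s ^+ j * h s)).
  apply: eq_itg => s _; rewrite [s - t]addrC exprDn mulr_suml; apply: eq_bigr => j _.
  by rewrite -mulr_natl !mulrA.
rewrite itg_sum; first by apply: eq_bigr => j _; rewrite itgZ.
by move=> j; apply: ctsM => //; exact: cts_cst.
Qed.

(* The terms of index j and j.-1 telescope because j C(k, j) = (k - j + 1) C(k, j - 1). *)
Lemma binomial_shift (k : nat) (x : R) (u : nat -> R) :
  \sum_(j < k) 'C(k, j)%:R * x ^+ (k - j) * (- j%:R * u j.-1) =
  - (\sum_(j < k) ('C(k, j) * (k - j))%:R * x ^+ (k - j).-1 * u j) + k%:R * u k.-1.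
Proof.
case: k => [|k]; first by rewrite !big_ord0 oppr0 mul0r addr0.
rewrite big_ord_recl /= mulr0n oppr0 mul0r mulr0 add0r.
rewrite [X in _ = - X + _]big_ord_recr/= subSnn expr0 mulr1 muln1 binSn.
rewrite opprD subrK -sumrN; apply: eq_bigr => j _.
rewrite /bump add1n subSS add0n.
have jk : (j <= k)%N by exact: ltnW.
rewrite subSn//=.
have e : ('C(k.+1, j.+1) * j.+1 = 'C(k.+1, j) * (k - j).+1)%N.
  by rewrite mulnC mul_bin_left mulnC subSn.
by rewrite -e natrM; ring.
Qed.

Lemma hasdX (D : set R) (f : R -> R) m t l : hasd D f t l ->
  hasd D (fun s => f s ^+ m) t (m%:R * f t ^+ m.-1 * l).
Proof.
move=> hf; elim: m => [|m IH].
  by rewrite !mul0r; under eq_fun do rewrite expr0; exact: hasd_cst.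
have := hasdM hf IH; under [in X in X -> _]eq_fun do rewrite -exprS.
suff -> : l * f t ^+ m + f t * (m%:R * f t ^+ m.-1 * l) = m.+1%:R * f t ^+ m.+1.-1 * l by [].
case: m {IH} => [|m] /=; first by rewrite !mul0r mulr0 addr0 expr0; ring.
by rewrite exprS -[m.+2%:R]natr1; ring.
Qed.

Lemma hasd_powN (D : set R) m t : hasd D (fun s => (- s) ^+ m) t (- m%:R * (- t) ^+ m.-1).
Proof.
have := hasdX m (hasdN (hasd_id D t)).
suff -> : m%:R * (- t) ^+ m.-1 * -1 = - m%:R * (- t) ^+ m.-1 by [].
by rewrite mulrN1 mulNr.
Qed.

End ItgSums.

(** * Induction on the moments *)

Section RealRays.
Context {R : realType} {n : nat} {M : ptopologicalType} (A : atlas R n M).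
Hypothesis hM : is_manifold_with_boundary A.
Variable g : M -> 'M[R]_n.
Hypothesis hg : is_riemannian_metric A g 6.
Variable T : R.
Hypothesis T0 : 0 < T.

Definition potential (v : M -> R) (a : M -> 'rV[R]_n) :=
  [/\ continuous v, forall x, bdry A x -> v x = 0 & has_differential A v a].

Definition real_ray L gamma (f : M -> R) (a : M -> 'rV[R]_n) :=
  itg 0 L (fun t => f (gamma (clamp1 L t)) + along A L gamma a (clamp1 L t)).

Hypothesis hI : forall (f : M -> R) a, continuous f -> continuous_form A a ->
  (forall L gamma, maximal_geodesic A g L gamma -> 0 < L -> real_ray L gamma f a = 0) ->
  (forall x, f x = 0) /\ exists v, potential v a.

Variables (F0 : R -> M -> R) (Fs : R -> M -> 'rV[R]_n).
Hypothesis cF0 : continuous (fun p => F0 p.1 p.2).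
Hypothesis cFs : cts_form2 A Fs.
Hypothesis F00 : forall s x, s <= 0 \/ T <= s -> F0 s x = 0.
Hypothesis Fs0 : forall s x, s <= 0 \/ T <= s -> Fs s x = 0.
Hypothesis hL : forall L gamma t0, maximal_geodesic A g L gamma -> 0 < L ->
  itg 0 L (fun t => F0 (t0 + t) (gamma (clamp1 L t)) + along A L gamma (Fs (t0 + t)) (clamp1 L t)) = 0.

Definition moment_fun k x := itg 0 T (fun s => s ^+ k * F0 s x).
Definition moment_form k x : 'rV[R]_n := \row_i itg 0 T (fun s => s ^+ k * Fs s x 0 i).

Lemma Fs_time x i : continuous (fun s => Fs s x 0 i).
Proof.
have E s : covector_in (chart_at A x) (Fs s) x 0 i = Fs s x 0 i by rewrite (covector_in_id hM).
by have := cts_form2_time hM (c := chart_at A x) (x := x) (i := i) cFs; under eq_fun do rewrite E.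
Qed.

Lemma F0_time x : continuous (F0 ^~ x).
Proof. exact: (@continuous_curry2 R M R F0 cF0 x). Qed.

Lemma cts_pow_mul (h : R -> R) k : continuous h -> continuous (fun s : R => s ^+ k * h s).
Proof. by move=> ch; apply: ctsM => //; apply: ctsX; exact: cts_id. Qed.

Lemma cts_moment_fun k : continuous (moment_fun k).
Proof.
apply: continuous_itg_param; first exact: ltW.
apply: ctsM; first by apply: ctsX; exact: cts_snd.
exact: (@cts_comp2 _ _ _ _ F0 snd fst cF0 (@cts_snd M R) (@cts_fst M R)).
Qed.

Lemma covector_moment_form k (c : chart A) x i : covector_in c (moment_form k) x 0 i =
  itg 0 T (fun s => s ^+ k * covector_in c (Fs s) x 0 i).
Proof.
rewrite covector_inE.
have -> : \sum_j jacobian c (chart_at A x) x i j * moment_form k x 0 j =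
   \sum_j itg 0 T (fun s => jacobian c (chart_at A x) x i j * (s ^+ k * Fs s x 0 j)).
  have cj j : continuous (fun s : R => s ^+ k * Fs s x 0 j) by apply: cts_pow_mul; exact: Fs_time.
  by apply: eq_bigr => j _; rewrite [moment_form k x 0 j]mxE itgZ.
rewrite -itg_sum; last first.
  by move=> j; apply: ctsM; [exact: cts_cst|apply: cts_pow_mul; exact: Fs_time].
apply: eq_itg => s _; rewrite covector_inE mulr_sumr; apply: eq_bigr => j _; ring.
Qed.

Lemma along_moment_form k L gamma t : along A L gamma (moment_form k) t =
  itg 0 T (fun s => s ^+ k * along A L gamma (Fs s) t).
Proof.
rewrite /along.
have cj j : continuous (fun s : R => s ^+ k * Fs s (gamma t) 0 j) by apply: cts_pow_mul; exact: Fs_time.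
have -> : (fun s => s ^+ k * (\sum_i Fs s (gamma t) 0 i * velocity A `[0, L] gamma t 0 i)) =
   (fun s => \sum_i velocity A `[0, L] gamma t 0 i * (s ^+ k * Fs s (gamma t) 0 i)).
  by apply/funext => s; rewrite mulr_sumr; apply: eq_bigr => j _; ring.
rewrite itg_sum; last by move=> j; apply: ctsM; [exact: cts_cst|exact: cj].
by apply: eq_bigr => j _; rewrite itgZ// mxE mulrC.
Qed.

Lemma cts_moment_form k : continuous_form A (moment_form k).
Proof.
apply: (cvg_continuous_form hM) => c i x cx.
rewrite covector_moment_form; under eq_fun do rewrite covector_moment_form.
have H (s : R) : covector_in c (Fs p.2) p.1 0 i @[p --> (x, s)] --> covector_in c (Fs s) x 0 i.
  have h := cFs (i := i) (s := s) cx.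
  have h1 := @cts_snd M R (x, s); have h2 := @cts_fst M R (x, s).
  have := cvg_comp_pair h1 h2 h; exact.
apply: cvg_itg; first exact: ltW.
- by move=> y; apply: cts_pow_mul; exact: (cts_form2_time hM).
- move=> s _; apply: cvgM.
    have cX : continuous (fun s : R => s ^+ k) by apply: ctsX; exact: cts_id.
    exact: (@cts_comp _ _ _ _ _ (@cts_snd M R) cX (x, s)).
  exact: H.
- by apply: cts_pow_mul; exact: (cts_form2_time hM).
Qed.

Section OneGeodesic.
Variables (L : R) (gamma : R -> M).
Hypothesis (L0 : 0 < L) (hmax : maximal_geodesic A g L gamma).

Let geo : geodesic A g L gamma. Proof. exact: maximal_geodesicP hmax L0. Qed.
Local Notation cl := (clamp1 L).

Lemma ray_moments k : itg 0 L (fun t => \sum_(j < k.+1) 'C(k, j)%:R * (- cl t) ^+ (k - j) *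
  (moment_fun j (gamma (cl t)) + along A L gamma (moment_form j) (cl t))) = 0.
Proof.
pose H s t := F0 s (gamma (cl t)) + along A L gamma (Fs s) (cl t).
have cH : continuous (fun p => H p.1 p.2).
  apply: ctsD; last exact: (cts_along2 hM L0 geo cFs).
  exact: (@cts_comp2 _ _ _ _ F0 fst (fun p : R * R => gamma (cl p.2)) cF0 (@cts_fst R R)
     (cts_comp (@cts_snd R R) (cts_geodesic L0 geo))).
have H0 s t : s <= 0 \/ T <= s -> H s t = 0.
  move=> hs; rewrite /H F00// add0r /along big1// => i _.
  by rewrite Fs0// mxE mul0r.
have hH t0 : itg 0 L (fun t => H (t0 + t) t) = 0.
  exact: hL.
rewrite -[RHS](moments_of_rays (ltW T0) (ltW L0) cH H0 hH k).
apply: eq_itg => t tL; rewrite (clamp1_id tL).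
have ct : continuous (H ^~ t) by exact: (continuous_curry2 cH).
rewrite itg_binomial//; apply: eq_bigr => j _; congr (_ * _).
rewrite /moment_fun along_moment_form -itgD; last 2 first.
- by apply: cts_pow_mul; exact: (continuous_curry2 cF0).
- apply: cts_pow_mul; have := @continuous_curry2 R R R (fun s t => along A L gamma (Fs s) (cl t)) (cts_along2 hM L0 geo cFs) t.
  by under eq_fun do rewrite (clamp1_id tL).
by apply: eq_itg => s _; rewrite /H (clamp1_id tL) mulrDr.
Qed.

Lemma ray_step k (u : nat -> M -> R) :
  (forall j, (j < k)%N -> potential (u j) (moment_form j)) ->
  (forall j x, (j < k)%N -> moment_fun j x = - j%:R * u j.-1 x) ->
  real_ray L gamma (fun x => moment_fun k x + k%:R * u k.-1 x) (moment_form k) = 0.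
Proof.
move=> hu ha.
(* Integration by parts: G vanishes at both ends because the potentials u j vanish on the
   boundary. *)
pose G t := \sum_(j < k) 'C(k, j)%:R * ((- t) ^+ (k - j) * u j (gamma t)).
pose G' t := \sum_(j < k) 'C(k, j)%:R * (- (k - j)%:R * (- t) ^+ (k - j).-1 * u j (gamma (cl t)) +
   (- t) ^+ (k - j) * along A L gamma (moment_form j) (cl t)).
have cu (j : 'I_k) : continuous (fun t => u j (gamma (cl t))).
  by have [cu _ _] := hu j (ltn_ord j); exact: (cts_comp (cts_geodesic L0 geo) cu).
have ca j : continuous (fun t => along A L gamma (moment_form j) (cl t)).
  exact: (cts_along hM L0 geo (cts_moment_form (k := j))).
have cpow j : continuous (fun t : R => (- t) ^+ j) by apply: ctsX; apply: ctsN; exact: cts_id.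
have cG' : continuous G'.
  apply: cts_sum => j; apply: ctsM; first exact: cts_cst.
  apply: ctsD; apply: ctsM => //; apply: ctsM => //; exact: cts_cst.
have dG t : 0 <= t <= L -> hasd `[0, L] G t (G' t).
  move=> tL; apply: hasd_sum => j; apply: hasdZ; rewrite (clamp1_id tL).
  have [_ _ du] := hu j (ltn_ord j).
  have h1 := hasd_along hM L0 geo du (cts_moment_form (k := j)) tL.
  have h2 := hasdM (hasd_powN `[0, L]%classic (k - j) t) h1.
  by rewrite mulrC [X in _ + X]mulrC in h2; rewrite mulrC [X in _ + X]mulrC.
have G0 : G 0 = 0.
  rewrite /G big1// => j _; have [_ ub _] := hu j (ltn_ord j).
  by rewrite (maximal_geodesic_end0 hmax ub) !mulr0.
have GL : G L = 0.
  rewrite /G big1// => j _; have [cuj ub _] := hu j (ltn_ord j).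
  by rewrite (maximal_geodesic_endL hM hg hmax L0 cuj ub) !mulr0.
have iG : itg 0 L G' = 0 by rewrite (FTC2_hasd (ltW L0) cG' dG) GL G0 subrr.
have cS : continuous (fun t => \sum_(j < k.+1) 'C(k, j)%:R * (- cl t) ^+ (k - j) *
  (moment_fun j (gamma (cl t)) + along A L gamma (moment_form j) (cl t))).
  apply: cts_sum => j; apply: ctsM.
    apply: ctsM; first exact: cts_cst.
    exact: (cts_comp (@cts_clamp1 R L) (@cpow (k - j)%N)).
  apply: ctsD; last exact: ca.
  exact: (cts_comp (cts_geodesic L0 geo) (cts_moment_fun (k := j))).
suff E : real_ray L gamma (fun x => moment_fun k x + k%:R * u k.-1 x) (moment_form k) =
    itg 0 L (fun t => \sum_(j < k.+1) 'C(k, j)%:R * (- cl t) ^+ (k - j) *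
      (moment_fun j (gamma (cl t)) + along A L gamma (moment_form j) (cl t))) - itg 0 L G'.
  by rewrite E ray_moments iG subrr.
rewrite -itgB//; apply: eq_itg => t tL; rewrite (clamp1_id tL) big_ord_recr/= binn subnn expr0 !mul1r.
pose S := \sum_(j < k) 'C(k, j)%:R * ((- t) ^+ (k - j) * along A L gamma (moment_form j) t).
have e1 : \sum_(j < k) 'C(k, j)%:R * (- t) ^+ (k - j) *
    (moment_fun j (gamma t) + along A L gamma (moment_form j) t) =
    \sum_(j < k) 'C(k, j)%:R * (- t) ^+ (k - j) * (- j%:R * u j.-1 (gamma t)) + S.
  rewrite -big_split/=; apply: eq_bigr => j _.
  by rewrite (ha j _ (ltn_ord j)); ring.
have e2 : G' t =
    - (\sum_(j < k) ('C(k, j) * (k - j))%:R * (- t) ^+ (k - j).-1 * u j (gamma t)) + S.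
  rewrite /G' -sumrN -big_split/=; apply: eq_bigr => j _; rewrite (clamp1_id tL) natrM.
  by ring.
rewrite e1 e2 (binomial_shift _ _ (fun j => u j (gamma t))).
clear e1 e2; clearbody S.
by move: (\sum_(j < k) _) S (along _ _ _ _ _) => x1 x2 x3; ring.
Qed.

End OneGeodesic.
Lemma potential0 a : (forall x, a x = 0) -> potential (fun=> 0) a.
Proof.
move=> a0; split => // [x|c z i cz]; first exact: cvg_cst.
have -> : covector_in c a (cinv c z) 0 i = 0.
  by rewrite covector_inE big1// => j _; rewrite a0 [X in _ * X]mxE mulr0.
exact: hasd_cst.
Qed.

(** The moments of the spatial part vanish and have potential 0. With these potentials [ray_step]
    turns the induction into the vanishing of all moments of [F0]. *)
Lemma real_function_zero : (forall s x, Fs s x = 0) ->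
  forall s x, 0 <= s <= T -> F0 s x = 0.
Proof.
move=> Fs00.
have mf0 k x : moment_form k x = 0.
  by apply/rowP => i; rewrite !mxE; apply: itg0 => s _; rewrite Fs00 mxE mulr0.
have m0 k : forall x, moment_fun k x = 0.
  elim/ltn_ind: k => k IH.
  have [] := @hI (fun x => moment_fun k x + k%:R * 0) (moment_form k).
  - by under eq_fun do rewrite mulr0 addr0; exact: cts_moment_fun.
  - exact: cts_moment_form.
  - move=> L gamma hmax L0; apply: (@ray_step L gamma L0 hmax k (fun _ _ => 0)).
      by move=> j _; exact: potential0.
    by move=> j x jk; rewrite IH// mulr0.
  - by move=> + _ x => /(_ x); rewrite mulr0 addr0.
move=> s x sT; apply: (moments_inj T0 (@F0_time x) _ sT) => k; exact: m0.
Qed.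

Lemma moment_potentials : exists u : nat -> M -> R, forall k,
  potential (u k) (moment_form k) /\ forall x, moment_fun k x = - k%:R * u k.-1 x.
Proof.
(* A potential is selected for every form that has one before the induction starts, so that the
   sequence [u] is explicit and no dependent choice is required. *)
have /choice[U hU] : forall a, exists v, (exists w, potential w a) -> potential v a.
  move=> a; have [[w hw]|h] := pselect (exists w, potential w a); first by exists w.
  by exists (fun=> 0).
exists (fun k => U (moment_form k)); elim/ltn_ind => k IH.
have [] := @hI (fun x => moment_fun k x + k%:R * U (moment_form k.-1) x) (moment_form k).
- apply: ctsD; first exact: cts_moment_fun.
  case: k IH => [|k] IH; first by under eq_fun do rewrite mul0r; exact: cts_cst.
  apply: ctsM; first exact: cts_cst.
  by have [[cu _ _] _] := IH k (ltnSn k).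
- exact: cts_moment_form.
- move=> L gamma hmax L0; apply: (@ray_step L gamma L0 hmax k (fun k => U (moment_form k))).
    by move=> j jk; have [] := IH j jk.
  by move=> j x jk; have [_] := IH j jk; exact.
- move=> h1 h2; split; first exact: hU.
  by move=> x; apply/eqP; rewrite mulNr -addr_eq0; apply/eqP.
Qed.

Lemma real_potential : exists psi : R -> M -> R,
  [/\ continuous (fun p => psi p.1 p.2), forall x, psi 0 x = 0 /\ psi T x = 0,
      forall s x, bdry A x -> 0 <= s <= T -> psi s x = 0,
      forall s x, 0 <= s <= T -> hasd `[0, T] (psi ^~ x) s (F0 s x) &
      forall s, 0 <= s <= T -> has_differential A (psi s) (Fs s)].
Proof.
have [u hu] := moment_potentials.
pose psi s x := itg 0 s (F0 ^~ x).
have cpsi : continuous (fun p => psi p.1 p.2).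
  apply: (@cts_itg_ub2 _ _ (fun (p : R * M) r => F0 r p.2) (fun p => p.1) 0).
    exact: (@cts_comp2 _ _ _ _ F0 snd (fun q : R * M * R => q.1.2) cF0 (@cts_snd _ _)
      (cts_comp (@cts_fst _ _) (@cts_snd _ _))).
  exact: cts_fst.
(* [psi T x] is the moment of order 0 of the time component, for which the relation reads
   [moment_fun 0 x = 0]. *)
have psiT x : psi T x = 0.
  have [_ /(_ x)] := hu 0%N; rewrite oppr0 mul0r => <-.
  by apply: eq_itg => s _; rewrite expr0 mul1r.
have cps x : continuous (psi ^~ x) by exact: (continuous_curry2 cpsi).
have dpsi s x : 0 <= s <= T -> hasd `[0, T] (psi ^~ x) s (F0 s x).
  by apply: FTC1_hasd; exact: (continuous_curry2 cF0).
(* Integrating the derivative of [s ^+ k.+1 * psi s x], whose boundary terms vanish, relates this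
   moment to [moment_fun k.+1 x = - k.+1%:R * u k x]. *)
have mpsi k x : itg 0 T (fun s => s ^+ k * psi s x) = u k x.
  have cF := @F0_time x.
  have c1 : continuous (fun s : R => s ^+ k * psi s x) by exact: cts_pow_mul.
  have c2 : continuous (fun s : R => s ^+ k.+1 * F0 s x) by exact: cts_pow_mul.
  have c3 : continuous (fun s : R => k.+1%:R * (s ^+ k * psi s x)).
    by apply: ctsM => //; exact: cts_cst.
  have := @FTC2_hasd R 0 T (fun s => k.+1%:R * (s ^+ k * psi s x) + s ^+ k.+1 * F0 s x)
    (fun s => s ^+ k.+1 * psi s x) (ltW T0).
  move=> /(_ (ctsD c3 c2)) H; have {}H := H _.
  have : k.+1%:R * itg 0 T (fun s => s ^+ k * psi s x) + moment_fun k.+1 x = 0.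
    rewrite -itgZ// -itgD// H; first by rewrite psiT mulr0 exprS !mul0r subrr.
    move=> s sT; have := hasdM (hasdX k.+1 (hasd_id `[0, T]%classic s)) (dpsi s x sT).
    suff -> : k.+1%:R * s ^+ k.+1.-1 * 1 * psi s x + s ^+ k.+1 * F0 s x =
      k.+1%:R * (s ^+ k * psi s x) + s ^+ k.+1 * F0 s x by [].
    by rewrite /=; ring.
  have [_ ->] := hu k.+1; rewrite /= mulNr => /eqP; rewrite subr_eq0 => /eqP.
  by apply: mulfI; rewrite pnatr_eq0.
exists psi; split => //.
- by move=> x; split => //; exact: itgaa.
- move=> s x xb; apply: (moments_inj T0 (cps x)) => k.
  by rewrite mpsi; have [[_ ub _] _] := hu k; exact: ub.
move=> s sT c z i cz; have /(cimgP hM)[cx zx] := cz.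
have xT : nbhs (cinv c z) [set: M] by exact: filterT.
have [a [b [k1 [k2 [K [bb zb _ xV _]]]]]] := exists_box hM hg cx xT.
rewrite zx in zb; have [ab _ _ hQ] := bb.
have Qc : in_box a b `<=` cimg c by move=> y /hQ[].
have ce : continuous (fun y => cinv c (clampv a b y)).
  by apply: (@cts_clamp _ _ _ _ _ (cimg c)) => // y; exact: cinv_cvg.
have nb : \forall y \near z, cimg c y -> in_box a b y.
  apply: filterS (near_cinv hM cz xV) => y h cy; have [_] := h cy.
  by have /(cimgP hM)[_ ->] := cy.
have cbf r : continuous (box_form c a b (Fs r) i).
  have cr : continuous_form A (Fs r) by exact: (@cts_form2_section _ _ _ _ hM Fs r cFs).
  move=> y; exact: (@cts_box_form _ _ _ _ g c a b k1 k2 K bb _ i cr).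
(* The increment of [psi s] along a coordinate segment minus the integral of the spatial part is a
   continuous function of [s]. Its moment of order [k] is the same expression for [u k] and
   [moment_form k], which is 0; so it vanishes, and differentiability in space follows. *)
have key y : in_box a b y -> box_fun c a b (psi s) y =
    box_fun c a b (psi s) (upd y i (a 0 i)) + prim a i (box_form c a b (Fs s) i) y.
  move=> yab.
  pose P r t := box_form c a b (Fs r) i (upd y i t).
  have cP : continuous (fun p => P p.1 p.2).
    move=> [r t]; rewrite /P /box_form.
    have cy : cdom c (cinv c (clampv a b (upd y i t))).
      by have /(cimgP hM)[] := Qc _ (clampv_box (upd y i t) ab).
    have cut : continuous (fun p : R * R => cinv c (clampv a b (upd y i p.2))).
      apply: (cts_comp _ ce); apply: cts_upd; last exact: cts_snd.
      by move=> p; exact: cvg_cst.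
    exact: (cvg_comp_pair (@cts_fst R R (r, t)) (cut (r, t)) (cFs (i := i) (s := r) cy)).
  have aiy : a 0 i <= y 0 i by have /andP[] := yab i.
  pose f r := box_fun c a b (psi r) y - box_fun c a b (psi r) (upd y i (a 0 i)) -
    itg (a 0 i) (y 0 i) (P r).
  have c1 w : continuous (fun r => box_fun c a b (psi r) w) by exact: cps.
  have c2 : continuous (fun r => itg (a 0 i) (y 0 i) (P r)) by exact: continuous_itg_param.
  have c3 : continuous f by apply: ctsB => //; exact: ctsB.
  suff : f s = 0 by move=> /eqP; rewrite subr_eq0 subr_eq addrC => /eqP.
  apply: (moments_inj T0 c3 _ sT) => k.
  have -> : (fun t => t ^+ k * f t) = (fun t => t ^+ k * box_fun c a b (psi t) y -
      t ^+ k * box_fun c a b (psi t) (upd y i (a 0 i)) - t ^+ k * itg (a 0 i) (y 0 i) (P t)).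
    by apply/funext => t; rewrite /f; ring.
  have d1 w : continuous (fun t : R => t ^+ k * box_fun c a b (psi t) w) by exact: cts_pow_mul.
  have d2 : continuous (fun t : R => t ^+ k * itg (a 0 i) (y 0 i) (P t)) by exact: cts_pow_mul.
  rewrite itgB//; last exact: ctsB.
  rewrite itgB// !mpsi.
  have [[cu _ du] _] := hu k.
  have := @box_fun_ftc _ _ _ _ g c a b k1 k2 K bb _ _ cu du (cts_moment_form (k := k)) i y yab.
  rewrite -/(box_fun c a b (u k) y) -/(box_fun c a b (u k) (upd y i (a 0 i))) => ->.
  rewrite [X in X - _](_ : _ = prim a i (box_form c a b (moment_form k) i) y); last by ring.
  have dP : continuous (fun p : R * R => p.1 ^+ k * P p.1 p.2).
    by apply: ctsM => //; apply: ctsX; exact: cts_fst.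
  have -> : itg 0 T (fun t => t ^+ k * itg (a 0 i) (y 0 i) (P t)) =
     itg 0 T (fun t => itg (a 0 i) (y 0 i) (fun r => t ^+ k * P t r)).
    by apply: eq_itg => t _; rewrite itgZ//; exact: (continuous_curry1 cP).
  rewrite (@itg_Fubini _ (fun t r => t ^+ k * P t r))// ?(ltW T0)//.
  apply/eqP; rewrite subr_eq0; apply/eqP; apply: eq_itg => r _.
  by rewrite /box_form covector_moment_form.
have := pd_of_box_ftc zb nb (cbf s) key; rewrite /box_form clampv_id//.
apply: pd_near => //; apply: filterS nb => y h cy; split => //.
by rewrite /box_fun clampv_id//; exact: h.
Qed.

End RealRays.

(** * Charts of the space-time *)

Section SpacetimeCharts.
Context {R : realType} {n : nat} {M : ptopologicalType} (A : atlas R n M).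
Hypothesis hM : is_manifold_with_boundary A.
Variable T : R.
Hypothesis T0 : 0 < T.
Implicit Types c : chart A.
Local Notation ST := (spacetime_atlas A T).
Local Notation cimgS c := (@cimg _ _ _ ST c).
Local Notation cinvS c := (@cinv _ _ _ ST c).
Local Notation cmapS c := (@cmap _ _ _ ST c).

Lemma cmapSE c p : cmapS c p = rowcons (p.1, cmap c p.2).
Proof. by []. Qed.

Lemma cinvSE c s z : cinvS c (rowcons (s, z)) = (s, cinv c z).
Proof.
rewrite /= /rowcons; congr (_, cinv c _).
  by rewrite (row_mxKl (s%:M : 'rV[R]_1)) mxE.
by rewrite (row_mxKr (s%:M : 'rV[R]_1)).
Qed.

Lemma cimgSP c s z : cimgS c (rowcons (s, z)) <-> 0 <= s <= T /\ cimg c z.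
Proof.
split=> [[[s' x] [/= s'T cx] e]|[sT [x cx <-]]]; last by exists (s, x).
have e0 := congr1 (fun w : 'rV[R]_(n.+1) => w 0 ord0) (e : rowcons (s', cmap c x) = rowcons (s, z)).
rewrite !rowcons0 /= in e0; subst s'; split => //; exists x => //.
apply/rowP => i.
have := congr1 (fun w : 'rV[R]_(n.+1) => w 0 (lift ord0 i)) (e : rowcons (s, cmap c x) = rowcons (s, z)).
by rewrite !rowconsS.
Qed.

Lemma rowconsE (y : 'rV[R]_(1 + n)) : exists s z, y = rowcons (s, z).
Proof. by exists (y 0 ord0), (rtail y); rewrite rowconsK. Qed.

Lemma line_rowcons0 s (z : 'rV[R]_n) h :
  line (rowcons (s, z)) ord0 h = rowcons (s + h, z).
Proof.
apply/rowP => i; rewrite lineE; case: (unliftP ord0 i) => [j ->|->].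
  by rewrite !rowconsS.
by rewrite !rowcons0.
Qed.

Lemma line_rowconsS s (z : 'rV[R]_n) i h :
  line (rowcons (s, z)) (lift ord0 i) h = rowcons (s, line z i h).
Proof.
apply/rowP => j; rewrite lineE; case: (unliftP ord0 j) => [k ->|->].
  by rewrite !rowconsS lineE (inj_eq lift_inj).
by rewrite !rowcons0.
Qed.

Lemma pdS_time c (u : R * M -> R) s z l : cimg c z ->
  hasd `[0, T] (fun t => u (t, cinv c z)) s l ->
  pd (cimgS c) (fun y => u (cinvS c y)) (rowcons (s, z)) ord0 l.
Proof.
move=> cz hu e e0; have H := hu e e0.
have cs : s + h @[h --> (0 : R)] --> s.
  have : continuous (fun h : R => s + h) by apply: ctsD; [exact: cts_cst|exact: cts_id].
  by move=> /(_ 0); rewrite /continuous_at/= addr0.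
have H' : \forall h \near (0 : R), `[0, T]%classic (s + h) ->
   `|u (s + h, cinv c z) - u (s, cinv c z) - l * (s + h - s)| <= e * `|s + h - s|.
  exact: (cs _ H).
apply: filterS H' => h; rewrite /mkset !line_rowcons0 !cinvSE addr0 subr0.
rewrite [s + h - s]addrAC subrr add0r => k /cimgSP[sh _]; apply: k.
by rewrite in_itv.
Qed.

Lemma pdS_space c (u : R * M -> R) s z i l : pd (cimg c) (fun w => u (s, cinv c w)) z i l ->
  pd (cimgS c) (fun y => u (cinvS c y)) (rowcons (s, z)) (lift ord0 i) l.
Proof.
move=> hu e e0; apply: filterS (hu e e0) => h; rewrite /mkset !line_rowconsS !cinvSE => k.
by move=> /cimgSP[_]; exact: k.
Qed.

Lemma cimgS_lines c : has_lines (cimgS c).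
Proof.
move=> y i; have [s [z ->]] := rowconsE y; move=> /cimgSP[sT cz].
case: (unliftP ord0 i) => [j ->|->].
  have -> : [set h | cimgS c (line (rowcons (s, z)) (lift ord0 j) h)] = [set h | cimg c (line z j h)].
    apply/seteqP; split => h /=; rewrite line_rowconsS; first by move=> /cimgSP[].
    by move=> ch; apply/cimgSP.
  exact: (relopen_lines (cimg_relopen hM c)).
have P := itv_proper T0 sT.
apply: within_dnbhs_proper => e e0.
pose Q t := [/\ t != s, `|s - t| < e & 0 <= t <= T].
have /(@filter_ex _ _ P)[t [ts te tT]] : within `[0, T] s^' Q.
  have H : \forall t \near s, t != s -> `[0, T]%classic t -> Q t.
    have := nbhsx_ballx s e e0; apply: filterS => t ht ts; rewrite /= in_itv/= => tT.
    by split.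
  exact: H.
exists (t - s); split; first by rewrite subr_eq0.
  by rewrite sub0r opprB.
by rewrite /mkset line_rowcons0 addrC subrK; apply/cimgSP.
Qed.

Lemma jacobianS c c' p : cdom c p.2 -> cdom c' p.2 -> spacetime T p ->
  [/\ @jacobian _ _ _ ST c c' p ord0 ord0 = 1,
      forall j, @jacobian _ _ _ ST c c' p ord0 (lift ord0 j) = 0,
      forall i, @jacobian _ _ _ ST c c' p (lift ord0 i) ord0 = 0 &
      forall i j, @jacobian _ _ _ ST c c' p (lift ord0 i) (lift ord0 j) = jacobian c c' p.2 i j].
Proof.
case: p => s x /= cx cx' sT; have cz := cimg_cmap cx.
have Sz : cimgS c (rowcons (s, cmap c x)) by apply/cimgSP.
have JE i j l : pd (cimgS c) (fun y => cmapS c' (cinvS c y) 0 j) (rowcons (s, cmap c x)) i l ->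
    @jacobian _ _ _ ST c c' (s, x) i j = l.
  move=> h; rewrite /jacobian [LHS]mxE; apply: pd_pderive => //; exact: cimgS_lines.
have u0 (q : R * M) : cmapS c' q 0 ord0 = q.1 by rewrite cmapSE rowcons0.
have uS j (q : R * M) : cmapS c' q 0 (lift ord0 j) = cmap c' q.2 0 j by rewrite cmapSE rowconsS.
split=> [|j|i|i j]; apply: JE.
- apply: (@pdS_time c (fun q => cmapS c' q 0 ord0)) => //.
  have E t : t = cmapS c' (t, cinv c (cmap c x)) 0 ord0 by exact: (esym (u0 (t, _))).
  by apply: hasd_near (hasd_id `[0, T]%classic s) => //; apply: filterE => t tT; split => //; exact: E.
- apply: (@pdS_time c (fun q => cmapS c' q 0 (lift ord0 j))) => //.
  have E t : cmap c' (cinv c (cmap c x)) 0 j = cmapS c' (t, cinv c (cmap c x)) 0 (lift ord0 j).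
    by exact: (esym (uS j (t, _))).
  apply: hasd_near (hasd_cst `[0, T]%classic (cmap c' (cinv c (cmap c x)) 0 j) s); last exact: E.
  by apply: filterE => t tT; split => //; exact: E.
- apply: (@pdS_space c (fun q => cmapS c' q 0 ord0)) => //.
  have E h : s = cmapS c' (s, cinv c (line (cmap c x) i h)) 0 ord0 by exact: (esym (u0 (s, _))).
  apply: hasd_near (hasd_cst [set h | cimg c (line (cmap c x) i h)] s 0); last exact: E.
  by apply: filterE => t tT; split => //; exact: E.
- apply: (@pdS_space c (fun q => cmapS c' q 0 (lift ord0 j))) => //.
  have E h : cmap c' (cinv c (line (cmap c x) i h)) 0 j =
    cmapS c' (s, cinv c (line (cmap c x) i h)) 0 (lift ord0 j) by exact: (esym (uS j (s, _))).
  apply: hasd_near (jacobian_pd hM i j cx cx'); last exact: E.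
  by apply: filterE => t tT; split => //; exact: E.
Qed.

Definition time_part (F : R * M -> 'rV[R]_(1 + n)) s x : R := F (s, x) 0 ord0.
Definition space_part (F : R * M -> 'rV[R]_(1 + n)) s x : 'rV[R]_n :=
  \row_i F (s, x) 0 (lift ord0 i).

Lemma covector_inS c (F : R * M -> 'rV[R]_(1 + n)) s x : cdom c x -> 0 <= s <= T ->
  @covector_in _ _ _ ST c F (s, x) 0 ord0 = time_part F s x /\
  forall i, @covector_in _ _ _ ST c F (s, x) 0 (lift ord0 i) = covector_in c (space_part F s) x 0 i.
Proof.
move=> cx sT; have cx' := mfd_chart_at hM x.
have [J1 J2 J3 J4] := @jacobianS c (chart_at A x) (s, x) cx cx' sT.
have E i : @covector_in _ _ _ ST c F (s, x) 0 i =
    F (s, x) 0 ord0 * @jacobian _ _ _ ST c (chart_at A x) (s, x) i ord0 +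
    \sum_j F (s, x) 0 (lift ord0 j) * @jacobian _ _ _ ST c (chart_at A x) (s, x) i (lift ord0 j).
  rewrite /covector_in mxE big_ord_recl; congr (_ * _ + _); first by rewrite mxE.
  by apply: eq_bigr => j _; congr (_ * _); rewrite mxE.
split=> [|i].
  by rewrite E J1 mulr1 big1 ?addr0// => j _; rewrite J2 mulr0.
rewrite E J3 mulr0 add0r covector_inE; apply: eq_bigr => j _.
by rewrite J4 mulrC; congr (_ * _); rewrite mxE.
Qed.

Lemma near_cmapS c s x (P : 'rV[R]_(1 + n) -> Prop) : cdom c x ->
  (\forall y \near rowcons (s, cmap c x), P y) ->
  \forall p \near (s, x), cdom c p.2 /\ P (rowcons (p.1, cmap c p.2)).
Proof.
move=> cx /nbhs_ballP[r /= r0 hr].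
have h2 := near_cmap hM cx (nbhsx_ballx (cmap c x) r r0).
have h1 := nbhsx_ballx s r r0.
have H1 : \forall p \near (s, x), ball s r p.1 by exact: (@cts_fst R M (s, x) _ h1).
have H2 : \forall p \near (s, x), cdom c p.2 /\ ball (cmap c x) r (cmap c p.2).
  exact: (@cts_snd R M (s, x) _ h2).
apply: filterS2 H1 H2 => -[s' x'] /= b1 [cx' b2]; split => //; apply: hr.
suff : (@rowcons R n @^-1` ball (rowcons (s, cmap c x)) r) (s', cmap c x') by [].
rewrite ball_rowcons//; split; first by rewrite /= rowcons0.
suff -> : \row_i rowcons (s, cmap c x) 0 (lift ord0 i) = cmap c x by [].
by apply/rowP => i; rewrite mxE rowconsS.
Qed.

(** [H] is the extension by zero of [h]. For [0 < s < T] a neighbourhood of [(s, x)] stays in the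
    slab, so the limit within the slab is a full limit; otherwise [H] is 0 near [(s, x)]. *)
Lemma cvg_extension c s x (h H : R * M -> R) : cdom c x ->
  (forall y, cimgS c y -> h (cinvS c w) @[w --> within (cimgS c) (nbhs y)] --> h (cinvS c y)) ->
  (forall p, 0 < p.1 < T -> cdom c p.2 -> H p = h p) ->
  (~ (0 < s < T) -> \forall p \near (s, x), H p = 0) ->
  H p @[p --> (s, x)] --> H (s, x).
Proof.
move=> cx ch Hh H0; have [sT|sT] := pselect (0 < s < T); last first.
  have Hn := H0 sT; rewrite (nbhs_singleton Hn).
  move=> P P0; suff : \forall p \near (s, x), P (H p) by [].
  by apply: filterS Hn => p ->; exact: nbhs_singleton P0.
have Sz : cimgS c (rowcons (s, cmap c x)).
  by apply/cimgSP; split; [have /andP[a b] := sT; rewrite !ltW|exact: cimg_cmap].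
rewrite (Hh (s, x))//; have := ch _ Sz; rewrite cinvSE (mfd_cinvK hM)// => hc P /hc hP.
have {}hP : \forall y \near rowcons (s, cmap c x), cimgS c y -> P (h (cinvS c y)) by exact: hP.
have N1 : \forall p \near (s, x), 0 < p.1 < T.
  have o : \forall t \near s, 0 < t < T.
    have /andP[s0 s1] := sT.
    have o1 : nbhs s [set t : R | 0 < t] by apply: open_nbhs_nbhs; split => //; exact: open_gt.
    have o2 : nbhs s [set t : R | t < T] by apply: open_nbhs_nbhs; split => //; exact: open_lt.
    by apply: filterS2 o1 o2 => t /= -> ->.
  exact: (@cts_fst R M (s, x) _ o).
suff : \forall p \near (s, x), P (H p) by [].
apply: filterS2 N1 (near_cmapS cx hP) => -[t y] tT [cy hy].
have Sy : cimgS c (rowcons (t, cmap c y)).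
  by apply/cimgSP; split; [have /andP[a b] := tT; rewrite !ltW|exact: cimg_cmap].
have Ey : cinvS c (rowcons (t, cmap c y)) = (t, y) by rewrite cinvSE (mfd_cinvK hM).
have {}hy : P (h (cinvS c (rowcons (t, cmap c y)))) by exact: hy.
by rewrite (Hh (t, y))//; rewrite Ey in hy.
Qed.

End SpacetimeCharts.

(** * Extension by zero and regularity of the potential *)

Section RealSpacetime.
Context {R : realType} {n : nat} {M : ptopologicalType} (A : atlas R n M).
Hypothesis hM : is_manifold_with_boundary A.
Variable g : M -> 'M[R]_n.
Hypothesis hg : is_riemannian_metric A g 6.
Variable T : R.
Hypothesis T0 : 0 < T.
Implicit Types c : chart A.
Local Notation ST := (spacetime_atlas A T).
Local Notation cimgS c := (@cimg _ _ _ ST c).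
Local Notation cinvS c := (@cinv _ _ _ ST c).
Local Notation cmapS c := (@cmap _ _ _ ST c).

Lemma Dg_ge0 x : (0 <= Dg A g x)%E.
Proof. by apply: ereal_sup_ubound; left. Qed.

(** As [Dg] is nonnegative, [calE] lies in [0 < t < T]; a point outside this slab is off the
    support, which is closed. *)
Lemma near_supp (V : zmodType) (u : R * M -> V) (s : R) (x : M) : supp T u `<=` calE A T g ->
  ~ (0 < s < T) -> \forall p \near (s, x), spacetime T p -> u p = 0.
Proof.
move=> su sT; have nsu : ~ supp T u (s, x).
  move=> /su[_ /= /andP[h1 h2]]; apply: sT; have D0 := Dg_ge0 x.
  have := le_lt_trans D0 h1; rewrite lte_fin => ->.
  by rewrite -lte_fin (lt_le_trans h2)// leeBlDr ?leeDl//; case: (Dg A g x) D0 h1.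
apply: contrapT => h; apply: nsu => U pU; apply: contrapT => hU; apply: h.
apply: filterS pU => p Up sp; apply/eqP/negPn/negP => up; apply: hU.
by exists p.
Qed.

Definition ext (V : zmodType) (u : R * M -> V) s x := if 0 <= s <= T then u (s, x) else 0.

Lemma ext0 (V : zmodType) (u : R * M -> V) (s : R) (x : M) :
  (forall (s : R) (x : M), ~ (0 < s < T) -> \forall p \near (s, x), spacetime T p -> u p = 0) ->
  s <= 0 \/ T <= s -> ext u s x = 0.
Proof.
move=> hu sT; rewrite /ext; case: ifPn => // sT'.
have ns : ~ (0 < s < T) by move=> /andP[h1 h2]; case: sT; rewrite leNgt ?h1 ?h2.
exact: (nbhs_singleton (hu s x ns)).
Qed.

Lemma near_ext (V : zmodType) (u : R * M -> V) (s : R) (x : M) :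
  (\forall p \near (s, x), spacetime T p -> u p = 0) -> \forall p \near (s, x), ext u p.1 p.2 = 0.
Proof. by apply: filterS => -[t y] h; rewrite /ext; case: ifPn => // tT; exact: h. Qed.

Lemma extE (V : zmodType) (u : R * M -> V) s x : 0 <= s <= T -> ext u s x = u (s, x).
Proof. by rewrite /ext => ->. Qed.

Lemma itv_le (s : R) : 0 < s < T -> 0 <= s <= T.
Proof. by move=> /andP[a b]; rewrite !ltW. Qed.

Lemma cts_ext (q : R * M -> R) : (forall c, Ck 0 (cimgS c) (fun z => q (cinvS c z))) ->
  (forall (s : R) (x : M), ~ (0 < s < T) -> \forall p \near (s, x), spacetime T p -> q p = 0) ->
  continuous (fun p => ext q p.1 p.2).
Proof.
move=> cq hq [s x].
apply: (@cvg_extension _ _ _ A hM T (chart_at A x) s x q (fun p => ext q p.1 p.2)).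
- exact: mfd_chart_at.
- by move=> y cy; exact: (Ck_cvg (cq _) cy).
- by move=> [t y] tT _; rewrite /= extE//; exact: itv_le.
- by move=> /(hq s x)/near_ext.
Qed.

Section RealForm.
Variable F : R * M -> 'rV[R]_(1 + n).
Hypothesis CF : forall c i, Ck 1 (cimgS c) (fun y => @covector_in _ _ _ ST c F (cinvS c y) 0 i).
Hypothesis hF : forall (s : R) (x : M), ~ (0 < s < T) -> \forall p \near (s, x), spacetime T p -> F p = 0.

Definition F0 s x : R := ext (fun p => time_part F p.1 p.2) s x.
Definition Fs s x : 'rV[R]_n := ext (fun p => space_part F p.1 p.2) s x.

Lemma covector_in_at c (a b : M -> 'rV[R]_n) x i : a x = b x ->
  covector_in c a x 0 i = covector_in c b x 0 i.
Proof. by rewrite /covector_in => ->. Qed.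

Lemma hF0 (s : R) (x : M) : ~ (0 < s < T) -> \forall p \near (s, x), spacetime T p -> time_part F p.1 p.2 = 0.
Proof.
move=> /(hF x); apply: filterS => -[t y] h tT.
by rewrite /time_part h// mxE.
Qed.

Lemma hFs (s : R) (x : M) : ~ (0 < s < T) -> \forall p \near (s, x), spacetime T p -> space_part F p.1 p.2 = 0.
Proof.
move=> /(hF x); apply: filterS => -[t y] h tT.
by apply/rowP => i; rewrite !mxE h// mxE.
Qed.

Lemma cts_F0 : continuous (fun p => F0 p.1 p.2).
Proof.
move=> [s x].
apply: (@cvg_extension _ _ _ A hM T (chart_at A x) s x
  (fun p => @covector_in _ _ _ ST (chart_at A x) F p 0 ord0) (fun p => F0 p.1 p.2)).
- exact: mfd_chart_at.
- by move=> y cy; exact: (Ck_cvg (CF _ _) cy).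
- move=> [t y] tT cy; have tT' := itv_le tT.
  by have [-> _] := covector_inS hM T0 F cy tT'; rewrite /= /F0 extE.
- by move=> /(@hF0 s x)/near_ext.
Qed.

Lemma cts_Fs : cts_form2 A Fs.
Proof.
move=> c i s x cx.
apply: (@cvg_extension _ _ _ A hM T c s x
  (fun p => @covector_in _ _ _ ST c F p 0 (lift ord0 i)) (fun p => covector_in c (Fs p.1) p.2 0 i)).
- exact: cx.
- by move=> y cy; exact: (Ck_cvg (CF _ _) cy).
- move=> [t y] tT cy; have tT' := itv_le tT.
  have [_ ->] := covector_inS hM T0 F cy tT'; apply: covector_in_at.
  by rewrite /Fs extE.
- move=> /(@hFs s x)/near_ext; apply: filterS => -[t y] /= h.
  by rewrite covector_inE big1// => j _; rewrite /Fs h [X in _ * X]mxE mulr0.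
Qed.

Lemma F0_out s x : s <= 0 \/ T <= s -> F0 s x = 0.
Proof. by apply: ext0 => t y; exact: hF0. Qed.

Lemma Fs_out s x : s <= 0 \/ T <= s -> Fs s x = 0.
Proof. by apply: ext0 => t y; exact: hFs. Qed.

(** The null curve has time velocity 1, so the time component of the form enters the ray as a
    function. *)
Lemma null_pairing L gamma t0 t : 0 < L -> 0 <= t <= L ->
  \sum_i ext F (t0 + t) (gamma t) 0 i * velocity ST `[0, L] (null_curve t0 gamma) t 0 i =
  F0 (t0 + t) (gamma t) + along A L gamma (Fs (t0 + t)) t.
Proof.
move=> L0 tL; rewrite big_ord_recl; congr (_ + _).
  have -> : velocity ST `[0, L] (null_curve t0 gamma) t 0 ord0 = 1.
    rewrite /velocity mxE; apply: hasd_derive_in; first exact: itv_proper.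
    have := hasdD (hasd_cst `[0, L]%classic t0 t) (hasd_id `[0, L]%classic t).
    rewrite add0r; apply: hasd_near.
      apply: filterE => s sL; split; first exact: sL.
      exact: esym (rowcons0 (t0 + s, cmap (chart_at A (gamma t)) (gamma s))).
    exact: esym (rowcons0 (t0 + t, cmap (chart_at A (gamma t)) (gamma t))).
  by rewrite mulr1 /F0 /ext; case: ifPn => // _; rewrite mxE.
apply: eq_bigr => i _; congr (_ * _).
  by rewrite /Fs /ext /space_part; case: ifPn => _; rewrite [RHS]mxE// mxE.
rewrite /velocity [LHS]mxE [RHS]mxE; congr (derive_in _ _ _).
by apply/funext => s; exact: (rowconsS (t0 + s, cmap (chart_at A (gamma t)) (gamma s))).
Qed.

Section Potential.
Variable psi : R -> M -> R.
Hypothesis cpsi : continuous (fun p => psi p.1 p.2).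
Hypothesis dpsi : forall s x, 0 <= s <= T -> hasd `[0, T] (psi ^~ x) s (F0 s x).
Hypothesis spsi : forall s, 0 <= s <= T -> has_differential A (psi s) (Fs s).

Lemma cinvS_cvg c y : cimgS c y -> cinvS c w @[w --> within (cimgS c) (nbhs y)] --> cinvS c y.
Proof.
have [s [z ->]] := rowconsE y; move=> /cimgSP[sT cz]; rewrite cinvSE => P [[B1 B2] /= [b1 b2] BP].
have ct : continuous (fun w : 'rV[R]_(n.+1) => \row_i w 0 (lift ord0 i)).
  by apply: cts_rV => i; under eq_fun do rewrite mxE; exact: cts_coord.
have h1 : \forall w \near (rowcons (s, z) : 'rV[R]_n.+1), B1 ((w : 'rV[R]_n.+1) 0 ord0).
  by have := @cts_coord R n.+1 ord0 (rowcons (s, z)); rewrite /continuous_at rowcons0; apply.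
pose r (w : 'rV[R]_n.+1) : 'rV[R]_n := \row_i w 0 (lift ord0 i).
have rE t v : r (rowcons (t, v)) = v by apply/rowP => i; rewrite mxE rowconsS.
have h2 : \forall w \near (rowcons (s, z) : 'rV[R]_n.+1), cimg c (r w) -> B2 (cinv c (r w)).
  have := ct (rowcons (s, z)); rewrite /continuous_at -/(r (rowcons (s, z))) rE.
  by move=> ctr; exact: (ctr _ (near_cinv hM cz b2)).
suff : \forall w \near rowcons (s, z), cimgS c w -> P (cinvS c w) by move=> h; exact: h.
apply: filterS2 h1 h2 => w; have [t [v ->]] := rowconsE w.
rewrite rowcons0 rE => k1 k2 /cimgSP[_ cv]; rewrite cinvSE; apply: BP; split => //=; exact: k2.
Qed.

Lemma potential_pd c y i : cimgS c y ->
  pd (cimgS c) (fun w => psi (cinvS c w).1 (cinvS c w).2) y i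
    (@covector_in _ _ _ ST c F (cinvS c y) 0 i).
Proof.
have [s [z ->]] := rowconsE y; move=> /cimgSP[sT cz]; rewrite cinvSE.
have /(cimgP hM)[cx _] := cz; have [E0 ES] := covector_inS hM T0 F cx sT.
case: (unliftP ord0 i) => [j ->|->].
  rewrite ES; apply: (@pdS_space _ _ _ A T c (fun q => psi q.1 q.2)).
  have -> : covector_in c (space_part F s) (cinv c z) 0 j = covector_in c (Fs s) (cinv c z) 0 j.
    by apply: covector_in_at; rewrite /Fs extE.
  exact: spsi.
rewrite E0; apply: (@pdS_time _ _ _ A T c (fun q => psi q.1 q.2)) => //.
have -> : time_part F s (cinv c z) = F0 s (cinv c z) by rewrite /F0 extE.
exact: dpsi.
Qed.

Lemma potential_pderive c y i : cimgS c y ->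
  pderive (cimgS c) (fun w => psi (cinvS c w).1 (cinvS c w).2) y i =
  @covector_in _ _ _ ST c F (cinvS c y) 0 i.
Proof. by move=> cy; apply: pd_pderive => //; [exact: cimgS_lines|exact: potential_pd]. Qed.

(** The first derivatives of [psi] are the components of [F], which are [C^1]; this is the gain of
    one derivative. *)
Lemma potential_C2 c : Ck 2 (cimgS c) (fun w => psi (cinvS c w).1 (cinvS c w).2).
Proof.
have h : {within cimgS c, continuous (fun w => psi (cinvS c w).1 (cinvS c w).2)}.
  apply/subspace_continuousP => y cy.
  exact: (cvg_comp _ _ (cinvS_cvg cy) (@cpsi (cinvS c y))).
split => // i; split=> [y cy|].
  exact: pd_pderivable (potential_pd i cy).
apply: (@eq_Ck _ _ 1 _ (fun y => @covector_in _ _ _ ST c F (cinvS c y) 0 i)).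
- exact: cimgS_lines.
- by move=> y cy; rewrite potential_pderive.
- exact: CF.
Qed.

Lemma potential_differential p i : spacetime T p ->
  pderive (cimgS (chart_at A p.2)) (fun w => psi (cinvS (chart_at A p.2) w).1 (cinvS (chart_at A p.2) w).2)
    (cmapS (chart_at A p.2) p) i = F p 0 i.
Proof.
case: p => s x sT; have cx := mfd_chart_at hM x; set c := chart_at A x in cx *.
have cy : cimgS c (rowcons (s, cmap c x)) by apply/cimgSP; split => //; exact: cimg_cmap.
rewrite -[LHS]/(pderive (cimgS c) (fun w => psi (cinvS c w).1 (cinvS c w).2) (rowcons (s, cmap c x)) i).
rewrite potential_pderive// cinvSE (mfd_cinvK hM)//.
have [E0 ES] := covector_inS hM T0 F cx sT.
case: (unliftP ord0 i) => [j ->|->]; last by rewrite E0.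
by rewrite ES (covector_in_id hM) mxE.
Qed.

End Potential.
End RealForm.
End RealSpacetime.

(** * Return to the complex-valued statement *)

Section Integrals.
Context {R : realType}.

Lemma Rintegral_itg (L : R) (f h : R -> R) : continuous h -> (forall t, 0 < t < L -> f t = h t) ->
  Rintegral (@lebesgue_measure R) `]0, L[ f = itg 0 L h.
Proof.
move=> ch fh; rewrite -itg_oo//; apply: eq_Rintegral => t.
by rewrite inE/= in_itv/=; exact: fh.
Qed.

Lemma cintegral_parts d (X : measurableType d) (m : {measure set X -> \bar R}) (D : set X) h z :
  cintegral m D h = z ->
  Rintegral m D (fun x => complex.Re (h x)) = complex.Re z /\
  Rintegral m D (fun x => complex.Im (h x)) = complex.Im z.
Proof. by move=> <-. Qed.

(** An exit time is an infimum of positive numbers, so [L = 0] is not excluded by definition; such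
    rays carry no information. *)
Lemma empty_ray (L : R) (f : R -> R[i]) : L <= 0 ->
  cintegral (@lebesgue_measure R) `]0, L[ f = 0.
Proof.
move=> L0; rewrite /cintegral set_itv_ge; first by rewrite !Rintegral_set0.
by rewrite bnd_simp -leNgt.
Qed.

End Integrals.

Section NullRay.
Context {R : realType} {n : nat} {M : ptopologicalType} (A : atlas R n M).
Hypothesis hM : is_manifold_with_boundary A.
Variables (g : M -> 'M[R]_n) (L : R) (gamma : R -> M).
Hypotheses (L0 : 0 < L) (geo : geodesic A g L gamma).

Lemma cts_null_ray (F0 : R -> M -> R) (Fs : R -> M -> 'rV[R]_n) (t0 : R) :
  continuous (fun p => F0 p.1 p.2) -> cts_form2 A Fs ->
  continuous (fun t => F0 (t0 + t) (gamma (clamp1 L t)) + along A L gamma (Fs (t0 + t)) (clamp1 L t)).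
Proof.
move=> c0 cs.
have ct : continuous (fun t : R => t0 + t) by apply: ctsD; [exact: cts_cst|exact: cts_id].
apply: ctsD; first exact: (@cts_comp2 _ _ _ _ F0 _ _ c0 ct (cts_geodesic L0 geo)).
exact: (@cts_comp2 _ _ _ _ (fun s t => along A L gamma (Fs s) (clamp1 L t)) _ _
  (cts_along2 hM L0 geo cs) ct (@cts_id R)).
Qed.

End NullRay.

Section RealInjectivity.
Context {R : realType} {n : nat} {M : ptopologicalType} (A : atlas R n M).
Hypothesis hn : (0 < n)%N.
Hypothesis hM : is_manifold_with_boundary A.
Variable g : M -> 'M[R]_n.
Hypothesis hg : is_riemannian_metric A g 6.
Variable mu : {measure set (g_sigma_algebraType (@open M)) -> \bar R}.
Hypothesis hmu : is_volume_measure A g mu.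
Hypothesis hinj : forall (f : M -> R[i]) (alpha : M -> 'rV[R[i]]_n),
  Ck_fun A 0 f -> Ck_form A 0 alpha ->
  (forall L gamma, maximal_geodesic A g L gamma -> ray_transform A L gamma f alpha = 0) ->
  (forall x, f x = 0) /\ solenoidal_part A g mu alpha (fun=> 0).

Lemma Ck0_cst d (S : set 'rV[R]_d) (k : R) : Ck 0 S (fun=> k).
Proof. by split; [apply/subspace_continuousP => z _; exact: cvg_cst|]. Qed.

Lemma real_injectivity (f : M -> R) (a : M -> 'rV[R]_n) : continuous f -> continuous_form A a ->
  (forall L gamma, maximal_geodesic A g L gamma -> 0 < L -> real_ray A L gamma f a = 0) ->
  (forall x, f x = 0) /\ exists v, potential A v a.
Proof.
move=> cf ca hray.
have [] := @hinj (fun x => Complex (f x) 0) (fun x => to_complex (a x)).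
- move=> c; split; last exact: Ck0_cst.
  by split => //; apply/subspace_continuousP => z cz; exact: continuous_chart.
- move=> c i; split.
    have -> : (fun z => covector_in c (fun x => re_row (to_complex (a x))) (cinv c z) 0 i) =
        (fun z => covector_in c a (cinv c z) 0 i).
      by apply/funext => z; apply: covector_in_at; rewrite re_to_complex.
    by split => //; apply/subspace_continuousP; exact: ca.
  have E x : covector_in c (fun x => im_row (to_complex (a x))) x 0 i = 0.
    by rewrite covector_inE big1// => j _; rewrite im_to_complex [X in _ * X]mxE mulr0.
  by under eq_fun do rewrite E; exact: Ck0_cst.
- move=> L gamma hmax; have [L0|L0] := leP L 0; first exact: empty_ray.
  have geo := maximal_geodesicP hmax L0.
  have c1 : continuous (fun t => f (gamma (clamp1 L t)) + along A L gamma a (clamp1 L t)).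
    apply: ctsD; last exact: (cts_along hM L0 geo ca).
    exact: (cts_comp (cts_geodesic L0 geo) cf).
  have clE t : 0 < t < L -> clamp1 L t = t.
    by move=> /andP[t0 tL]; apply: clamp1_id; rewrite !ltW.
  rewrite /ray_transform /cintegral; congr Complex.
    rewrite -[RHS](hray L gamma hmax L0); apply: (Rintegral_itg c1) => t tL.
    by rewrite pairingE re_to_complex /= clE.
  have c0 : continuous (fun _ : R => (0 : R)) by exact: cts_cst.
  rewrite (Rintegral_itg c0); first by apply: itg0.
  move=> t _; rewrite pairingE im_to_complex /= big1 ?addr0// => i _.
  by rewrite mxE mul0r.
- move=> h1 h2; split; first by move=> x; have := h1 x => -[].
  by have [v hv] := solenoidal_potential hn hM hg hmu ca h2; exists v.
Qed.

End RealInjectivity.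

Unset Implicit Arguments.

Theorem proposition1p4 (R : realType) (n : nat) (hn : (2 <= n)%N)
  (M : ptopologicalType) (A : atlas R n M)
  (hM : is_manifold_with_boundary A)
  (hcompact : compact [set: M]) (hconnected : connected [set: M])
  (g : M -> 'M[R]_n) (hg : is_riemannian_metric A g 6)
  (mu : {measure set (g_sigma_algebraType (@open M)) -> \bar R})
  (hmu : is_volume_measure A g mu)
  (T : R) (hT : (2%:E * DgM A g < T%:E)%E)
  (q : R * M -> R[i]) (F : R * M -> 'rV[R[i]]_(1 + n))
  (hq : Ck_fun (spacetime_atlas A T) 0 q)
  (hF : Ck_form (spacetime_atlas A T) 1 F)
  (hsupp_q : supp T q `<=` calE A T g)
  (hsupp_F : supp T F `<=` calE A T g)
  (hinj : forall (f : M -> R[i]) (alpha : M -> 'rV[R[i]]_n),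
     Ck_fun A 0 f -> Ck_form A 0 alpha ->
     (forall L gamma, maximal_geodesic A g L gamma ->
        ray_transform A L gamma f alpha = 0) ->
     (forall x, f x = 0) /\ solenoidal_part A g mu alpha (fun=> 0)) :
  ((forall L gamma t0, maximal_geodesic A g L gamma ->
      light_ray_fun T q L (null_curve t0 gamma) = 0) ->
   forall p, spacetime T p -> q p = 0) /\
  ((forall L gamma t0, maximal_geodesic A g L gamma ->
      light_ray_form A T F L (null_curve t0 gamma) = 0) ->
   exists psi : R * M -> R[i],
     [/\ Ck_fun (spacetime_atlas A T) 2 psi,
         forall p, bdry_spacetime A T p -> psi p = 0 &
         forall p, spacetime T p ->
           F p = differential (spacetime_atlas A T) psi p]).
Proof.
(* [hT] and [D_g(M) >= 0]; the latter is read at a point of [M]. *)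
have T0 : 0 < T.
  rewrite -lte_fin (le_lt_trans _ hT)// mule_ge0//.
  by apply: (le_trans (Dg_ge0 A g (point : M))); apply: ereal_sup_ubound; exists point.
have n0 : (0 < n)%N by exact: ltnW.
have hI := real_injectivity n0 hM hg hmu hinj.
have clE (L t : R) : 0 < t < L -> clamp1 L t = t.
  by move=> /andP[t0 tL]; apply: clamp1_id; rewrite !ltW.
split=> hray.
  (* [r] stands for the real or the imaginary part, each of which satisfies the real problem with
     zero spatial part. *)
  have sol (r : R[i] -> R) : r 0 = 0 ->
      (forall c : chart A, Ck 0 (@cimg _ _ _ (spacetime_atlas A T) c)
         (fun z => r (q (@cinv _ _ _ (spacetime_atlas A T) c z)))) ->
      (forall L gamma t0, maximal_geodesic A g L gamma ->
         Rintegral (@lebesgue_measure R) `]0, L[ (fun t => r (extend0 T q (null_curve t0 gamma t))) = 0) ->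
      forall s x, 0 <= s <= T -> r (q (s, x)) = 0.
    move=> r0 cr hr.
    have nq (s : R) (x : M) : ~ (0 < s < T) -> \forall p \near (s, x), spacetime T p -> r (q p) = 0.
      move=> ns; apply: filterS (near_supp (V := R[i]) x hsupp_q ns) => p h sp.
      by rewrite (h sp).
    have c0 := cts_ext hM cr nq.
    have cz : cts_form2 A (fun (_ : R) (_ : M) => (0 : 'rV[R]_n)).
      move=> c i s x cx.
      have E y : covector_in c (fun=> (0 : 'rV[R]_n)) y 0 i = 0.
        by rewrite covector_inE big1// => j _; rewrite [X in _ * X]mxE mulr0.
      by rewrite E; under eq_fun do rewrite E; exact: cvg_cst.
    have out (s : R) (x : M) : s <= 0 \/ T <= s -> ext T (fun p => r (q p)) s x = 0 by exact: ext0.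
    have res := real_function_zero hM hg T0 hI c0 cz out (fun _ _ _ => erefl) _ (fun _ _ => erefl).
    move=> s x sT; rewrite -[LHS]/((fun p => r (q p)) (s, x)) -(extE (T := T) _ x sT).
    apply: res sT => L gamma t0 hmax L0.
    have geo := maximal_geodesicP hmax L0.
    rewrite -[RHS](hr L gamma t0 hmax); symmetry; apply: Rintegral_itg.
      exact: (@cts_null_ray _ _ _ _ hM _ _ _ L0 geo (ext T (fun p => r (q p))) _ t0 c0 cz).
    move=> t tL; rewrite (clE _ _ tL) /along big1 ?addr0; last by move=> i _; rewrite mxE mul0r.
    by rewrite /extend0 /ext /null_curve /=; case: ifP.
  move=> [s x] sT.
  have hRe := sol (@complex.Re R) erefl (fun c => (hq c).1)
    (fun L gamma t0 h => (cintegral_parts (hray L gamma t0 h)).1) s x sT.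
  have hIm := sol (@complex.Im R) erefl (fun c => (hq c).2)
    (fun L gamma t0 h => (cintegral_parts (hray L gamma t0 h)).2) s x sT.
  by move: hRe hIm; case: (q (s, x)) => a b /= -> ->.
(* The same device for forms: [r] acts on components and commutes with the pairing against real
   velocities. *)
have sol (r : R[i] -> R) : r 0 = 0 ->
    (forall (a : 'rV[R[i]]_(1 + n)) v, r (pairing a v) = \sum_i map_mx r a 0 i * v 0 i) ->
    (forall (c : chart A) i, Ck 1 (@cimg _ _ _ (spacetime_atlas A T) c)
       (fun z => @covector_in _ _ _ (spacetime_atlas A T) c (fun x => map_mx r (F x))
          (@cinv _ _ _ (spacetime_atlas A T) c z) 0 i)) ->
    (forall L gamma t0, maximal_geodesic A g L gamma ->
       Rintegral (@lebesgue_measure R) `]0, L[ (fun t => r (pairing (extend0 T F (null_curve t0 gamma t))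
          (velocity (spacetime_atlas A T) `[0, L] (null_curve t0 gamma) t))) = 0) ->
    exists psi : R -> M -> R, [/\ forall x, psi 0 x = 0 /\ psi T x = 0,
      forall s x, bdry A x -> 0 <= s <= T -> psi s x = 0,
      forall c : chart A, Ck 2 (@cimg _ _ _ (spacetime_atlas A T) c)
        (fun w => psi (@cinv _ _ _ (spacetime_atlas A T) c w).1 (@cinv _ _ _ (spacetime_atlas A T) c w).2) &
      forall p i, spacetime T p ->
        pderive (@cimg _ _ _ (spacetime_atlas A T) (chart_at A p.2))
          (fun w => psi (@cinv _ _ _ (spacetime_atlas A T) (chart_at A p.2) w).1
                        (@cinv _ _ _ (spacetime_atlas A T) (chart_at A p.2) w).2)
          (@cmap _ _ _ (spacetime_atlas A T) (chart_at A p.2) p) i = r (F p 0 i)].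
  move=> r0 rp CF hr; pose G p := map_mx r (F p).
  have nG (s : R) (x : M) : ~ (0 < s < T) -> \forall p \near (s, x), spacetime T p -> G p = 0.
    move=> ns; apply: filterS (near_supp (V := 'rV[R[i]]_(1 + n)) x hsupp_F ns) => p h sp.
    by apply/rowP => i; rewrite !mxE (h sp) mxE.
  have c0 := cts_F0 hM T0 CF nG; have cs := cts_Fs hM T0 CF nG.
  have [] := real_potential hM hg T0 hI c0 cs (F0_out nG) (Fs_out nG).
    move=> L gamma t0 hmax L0; have geo := maximal_geodesicP hmax L0.
    rewrite -[RHS](hr L gamma t0 hmax); symmetry; apply: Rintegral_itg.
      exact: (@cts_null_ray _ _ _ _ hM _ _ _ L0 geo (F0 T G) _ t0 c0 cs).
    move=> t tL; rewrite (clE _ _ tL) rp -null_pairing ?itv_le//.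
    apply: eq_bigr => i _; congr (_ * _).
    by rewrite /extend0 /ext /null_curve /=; case: ifP => _ //; rewrite !mxE.
  move=> psi [p1 p2 p3 p4 p5]; exists psi; split => //.
    by move=> c; exact: (potential_C2 hM T0 CF p1 p4 p5).
  by move=> p i sp; rewrite (potential_differential hM T0 p4 p5 i sp) mxE.
have reP (a : 'rV[R[i]]_(1 + n)) v : complex.Re (pairing a v) = \sum_i map_mx (@complex.Re R) a 0 i * v 0 i.
  by rewrite pairingE.
have imP (a : 'rV[R[i]]_(1 + n)) v : complex.Im (pairing a v) = \sum_i map_mx (@complex.Im R) a 0 i * v 0 i.
  by rewrite pairingE.
have [psi1 [a1 b1 c1 d1]] := sol (@complex.Re R) erefl reP (fun c i => (hF c i).1)
  (fun L gamma t0 h => (cintegral_parts (hray L gamma t0 h)).1).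
have [psi2 [a2 b2 c2 d2]] := sol (@complex.Im R) erefl imP (fun c i => (hF c i).2)
  (fun L gamma t0 h => (cintegral_parts (hray L gamma t0 h)).2).
exists (fun p => Complex (psi1 p.1 p.2) (psi2 p.1 p.2)); split.
- by move=> c; split; [exact: c1|exact: c2].
- move=> [s x] [sT /= h].
  suff [-> ->] : psi1 s x = 0 /\ psi2 s x = 0 by [].
  case: h => [->|[->|h]].
  + by have [-> _] := a1 x; have [-> _] := a2 x.
  + by have [_ ->] := a1 x; have [_ ->] := a2 x.
  + by split; [exact: b1|exact: b2].
- move=> p sp; apply/rowP => i; rewrite [RHS]mxE.
  transitivity (Complex (complex.Re (F p 0 i)) (complex.Im (F p 0 i))); first by case: (F p 0 i).
  by rewrite -(d1 p i sp) -(d2 p i sp).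
Qed.
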